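(* Assume that $X_0=(u_0,v_0)^\top\in\mathbb H^1$ and $\mathbf Q^{\frac12}\in\mathcal L_2(L^2)$. For every $N\in\mathbb N^+$, the mild solution $X^N=(u^N,v^N)^\top$ of the spectral Galerkin discretization satisfies the energy evolution law $$\mathbb E\big(V_1(u^N(t),v^N(t))\big)=V_1(u^N_0,v^N_0)+\tfrac12\mathrm{Tr}\Big((P_N\mathbf Q^{\frac12})(P_N\mathbf Q^{\frac12})^*\Big)t,\qquad t\in\mathbb R^+.$$
   Context: Setting. $\mathcal O=(0,1)^d$ with $d\in\{1,2\}$, $L^p=L^p(\mathcal O;\mathbb R)$, and $\Lambda$ is the Laplacian on $\mathcal O$ with homogeneous Dirichlet boundary condition; $0<\lambda_1\le\lambda_2\le\cdots$ are the eigenvalues of $-\Lambda$ with eigenfunctions $\{e_i\}$ forming an orthonormal basis of $L^2$. $\dot{\mathbb H}^r=\mathcal D((-\Lambda)^{r/2})$ with $\|x\|_{\dot{\mathbb H}^r}^2=\sum_i\lambda_i^r\langle x,e_i\rangle_{L^2}^2$, $r\in\mathbb R$; $\mathbb H^r=\dot{\mathbb H}^r\times\dot{\mathbb H}^{r-1}$ with the product norm. $\mathcal L_2(L^2)$ denotes the Hilbert–Schmidt operators on $L^2$. $W$ is an $L^2$-valued $\mathbf Q$-Wiener process on a filtered probability space, where $\mathbf Q$ is a symmetric, positive definite operator of finite trace on $L^2$. $f(u)=c_3u^3+c_2u^2+c_1u+c_0$ with $c_3>0$ is a real polynomial. The initial data $u_0,v_0$ are deterministic. Spectral Galerkin discretization.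 $P_N\zeta=\sum_{i=1}^N\langle\zeta,e_i\rangle_{L^2}e_i$, $U_N=\mathrm{span}\{e_1,\dots,e_N\}$, $\Lambda_N=\Lambda P_N$. $X^N=(u^N,v^N)^\top$ is the $U_N\times U_N$-valued mild solution of $du^N=v^Ndt$, $dv^N=\Lambda_Nu^Ndt-P_N(f(u^N))dt+P_NdW$, $u^N(0)=u^N_0=P_Nu_0$, $v^N(0)=v^N_0=P_Nv_0$. Energy. $F:L^4\to\mathbb R$ is a potential functional of $f$, i.e. $\frac{\partial F}{\partial u}(u)=f(u)$ (meaning $DF(u)w=\int_{\mathcal O}f(u)w\,dx$), chosen so that $a_1\|u\|_{L^4}^4-b_1\le F(u)\le a_2\|u\|_{L^4}^4+b_2$ for some positive constants $a_1,a_2,b_1,b_2$. $V_1:\mathbb H^1\to\mathbb R$, $V_1(u,v)=\frac12\|u\|_{\dot{\mathbb H}^1}^2+\frac12\|v\|_{L^2}^2+F(u)+C_1$ with a constant $C_1\ge b_1$. *)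

(* Defs.v *)
From HB Require Import structures.
From mathcomp Require Import all_boot all_order all_algebra.
From mathcomp Require Import all_classical all_reals all_analysis.
Import Order.TTheory GRing.Theory Num.Theory.
Import numFieldNormedType.Exports.

Set Implicit Arguments.
Unset Strict Implicit.
Unset Printing Implicit Defensive.

Local Open Scope classical_set_scope.
Local Open Scope ring_scope.

Definition measure_rv_display : measure_display -> measure_display.
Proof. exact. Qed.

Section measurable_rv.
Context {dsp : measure_display} {T : sigmaRingType dsp}.
Variable n : nat.

Let coord : 'I_n -> 'rV[T]_n -> T := fun i x => x ord0 i.

Let rv_set0 : g_sigma_preimage coord set0.
Proof. exact: sigma_algebra0. Qed.

Let rv_setC A : g_sigma_preimage coord A -> g_sigma_preimage coord (~` A).
Proof. exact: sigma_algebraC. Qed.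

Let rv_bigcup (F : (set 'rV[T]_n)^nat) :
  (forall i, g_sigma_preimage coord (F i)) ->
  g_sigma_preimage coord (\bigcup_i (F i)).
Proof. exact: sigma_algebra_bigcup. Qed.

HB.instance Definition _ := @isMeasurable.Build (measure_rv_display dsp)
  'rV[T]_n (g_sigma_preimage coord) rv_set0 rv_setC rv_bigcup.

End measurable_rv.

Section cube.
Variable R : realType.

Lemma measurable_coord n (i : 'I_n) :
  measurable_fun [set: 'rV[R]_n] (fun x : 'rV[R]_n => x ord0 i).
Proof.
move=> _ Y mY; rewrite setTI; apply: sub_sigma_algebra => /=.
rewrite -bigcup_seq/=; exists i => /=; first by rewrite mem_index_enum.
by exists Y => //; rewrite setTI.
Qed.

Lemma measurable_fun_rvP dsp (T : measurableType dsp) n (f : T -> 'rV[R]_n) :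
  (forall i, measurable_fun [set: T] (fun x => f x ord0 i)) ->
  measurable_fun [set: T] f.
Proof.
move=> mf.
have H : g_sigma_preimage (fun i => (fun x : 'rV[R]_n => x ord0 i) \o f) `<=`
    measurable.
  apply: smallest_sub; first exact: sigma_algebra_measurable.
  case: n => [|n] in f mf *; first by rewrite big_ord0.
  rewrite -bigcup_mkord_ord; apply: bigcup_sub => i Ii.
  by move=> A [B mB <-]; exact: mf.
move: H; rewrite (g_sigma_preimage_comp (fun i (x : 'rV[R]_n) => x ord0 i)) => H _ A mA.
by apply: H; exists A.
Qed.

Definition cons_rv n (x : measurableTypeR R * 'rV[R]_n) : 'rV[R]_n.+1 :=
  row_mx (const_mx (x.1 : R) : 'rV[R]_1) x.2.

Lemma measurable_cons_rv n : measurable_fun setT (@cons_rv n).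
Proof.
apply: measurable_fun_rvP => i; rewrite /cons_rv.
case: (split_ordP (i : 'I_(1 + n))) => j ->.
  rewrite (_ : (fun _ => _) = fst); first exact: measurable_fst.
  by apply/funext => x; rewrite (row_mxEl (const_mx (x.1 : R) : 'rV[R]_1)) mxE.
rewrite (_ : (fun _ => _) = (fun y : 'rV[R]_n => y ord0 j) \o snd).
  apply: measurableT_comp; first exact: measurable_coord.
  exact: measurable_snd.
by apply/funext => x; rewrite (row_mxEr (const_mx (x.1 : R) : 'rV[R]_1)).
Qed.

HB.instance Definition _ n :=
  isMeasurableFun.Build _ _ _ _ (@cons_rv n) (@measurable_cons_rv n).

Definition lebesgue01 : set (measurableTypeR R) -> \bar R :=
  mrestr (@lebesgue_measure R) (measurable_itv `]0%R, 1%R[).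

HB.instance Definition _ := Measure.on lebesgue01.

Lemma lebesgue01_setT : lebesgue01 setT = 1%E.
Proof.
rewrite /lebesgue01 /mrestr setTI lebesgue_measure_itv/= lte_fin ltr01.
by rewrite oppr0 adde0.
Qed.

HB.instance Definition _ :=
  Measure_isProbability.Build _ _ _ lebesgue01 lebesgue01_setT.

(* Lebesgue measure on (0,1)^n, extended by 0 to the space of row vectors. *)
Fixpoint cube_measure (n : nat) : probability 'rV[R]_n R :=
  if n is m.+1 then
    distribution (lebesgue01 \x cube_measure m)%E (@cons_rv m)
  else \d_ (0 : 'rV[R]_0).

Definition open_cube n : set 'rV[R]_n :=
  [set y | forall i, 0 < y ord0 i < 1].

Definition closed_cube n : set 'rV[R]_n :=
  [set y | forall i, 0 <= y ord0 i <= 1].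

Definition partial n (i : 'I_n) (phi : 'rV[R]_n -> R) (y : 'rV[R]_n) : R :=
  'D_(delta_mx ord0 i) phi y.

Definition laplacian n (phi : 'rV[R]_n -> R) (y : 'rV[R]_n) : R :=
  \sum_(i < n) partial i (partial i phi) y.

Definition C2_on n (A : set 'rV[R]_n) (phi : 'rV[R]_n -> R) : Prop :=
  forall y, A y -> forall i j : 'I_n,
    [/\ derivable phi y (delta_mx ord0 i),
        {for y, continuous (partial i phi)},
        derivable (partial i phi) y (delta_mx ord0 j) &
        {for y, continuous (partial j (partial i phi))}].

End cube.

(* Elements of L^p are represented by functions; equality in L^p is almost
   everywhere equality [x = y %[ae cube_measure R d]]. *)
Notation L2 R d := (LfunType (cube_measure R d) (lee1n 2)).
Notation L4 R d := (LfunType (cube_measure R d) (lee1n 4)).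

Section L2_space.
Variables (R : realType) (d : nat).
Local Notation mu := (cube_measure R d).
Implicit Types x y : L2 R d.
Implicit Types T S : L2 R d -> L2 R d.

Definition normL (p : R) (x : 'rV[R]_d -> R) : R :=
  fine 'N[mu]_(p%:E)[EFin \o x]%E.

Definition ip (x y : 'rV[R]_d -> R) : R := \int[mu]_z (x z * y z).

Definition bounded_linear T : Prop :=
  (forall (a : R) x y, T (a *: x + y) = (a *: T x + T y : L2 R d) %[ae mu]) /\
  (exists C : R, forall x, normL 2 (T x) <= C * normL 2 x).

Definition symmetric_op T : Prop := forall x y, ip (T x) y = ip x (T y).

Definition positive_definite T : Prop :=
  forall x, ~ (x = cst 0 %[ae mu]) -> 0 < ip (T x) x.

Definition is_sqrt_op T S : Prop :=
  [/\ bounded_linear S, symmetric_op S, (forall x, 0 <= ip (S x) x) &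
      forall x, S (S x) = T x %[ae mu]].

(* The adjoint is determined up to almost everywhere equality of its values. *)
Definition adjoint T : L2 R d -> L2 R d :=
  xget (id : L2 R d -> L2 R d) [set S : L2 R d -> L2 R d | forall x y, ip (T x) y = ip x (S y)].

Definition is_onb (e : nat -> L2 R d) : Prop :=
  (forall i j, ip (e i) (e j) = (i == j)%:R) /\
  (forall x, (forall i, ip x (e i) = 0) -> x = cst 0 %[ae mu]).

(* [e] is an orthonormal basis; the value of [trace e T], for T positive or
   trace class, and the property [hilbert_schmidt e T] do not depend on it. *)
Definition trace (e : nat -> L2 R d) T : \bar R :=
  (\sum_(i <oo) (ip (T (e i)) (e i))%:E)%E.

Definition hilbert_schmidt (e : nat -> L2 R d) T : Prop :=
  (\sum_(i <oo) (normL 2 (T (e i)) ^+ 2)%:E < +oo)%E.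

Definition dirichlet_eigenpair (l : R) (x : L2 R d) : Prop :=
  exists phi : 'rV[R]_d -> R,
    [/\ x = phi %[ae mu],
        {within @closed_cube R d, continuous phi},
        C2_on (@open_cube R d) phi,
        (forall z, closed_cube z -> ~ open_cube z -> phi z = 0) &
        forall z, open_cube z -> - laplacian phi z = l * phi z].

(* Indices start from 0.  Since [e] is a basis, [lam] lists every eigenvalue of
   -Lambda with its multiplicity. *)
Definition dirichlet_eigenbasis (lam : nat -> R) (e : nat -> L2 R d) : Prop :=
  [/\ (forall i, 0 < lam i), nondecreasing_seq lam,
      (forall i, dirichlet_eigenpair (lam i) (e i)) & is_onb e].

End L2_space.

Section galerkin.
Variables (R : realType) (d : nat) (lam : nat -> R) (e : nat -> L2 R d).
Local Notation mu := (cube_measure R d).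

(* Squared norm of \dot H^r; for r >= 0 that space is the subset of L^2 on which
   this is finite. *)
Definition dotH_norm2 (r : R) (x : L2 R d) : \bar R :=
  (\sum_(i <oo) (lam i `^ r * ip x (e i) ^+ 2)%:E)%E.

Definition in_H1 (u v : L2 R d) : Prop :=
  (dotH_norm2 1 u < +oo)%E /\ (dotH_norm2 0 v < +oo)%E.

Definition in_UN (N : nat) (x : L2 R d) : Prop :=
  exists c : 'I_N -> R, x = (\sum_(i < N) c i *: e i : L2 R d) %[ae mu].

(* g(-Lambda) P_N *)
Definition fcalcN (N : nat) (g : R -> R) (x : 'rV[R]_d -> R) : L2 R d :=
  \sum_(i < N) (g (lam i) * ip x (e i)) *: e i.

Definition projN (N : nat) := fcalcN N (fun=> 1).

(* The group exp(t A_N) on U_N x U_N generated by A_N (u, v) = (v, Lambda_N u),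
   where Lambda_N e_i = - lam_i e_i. *)
Definition groupN (N : nat) (t : R) (x : L2 R d * L2 R d) :
    L2 R d * L2 R d :=
  (fcalcN N (fun l => cos (Num.sqrt l * t)) x.1 +
   fcalcN N (fun l => sin (Num.sqrt l * t) / Num.sqrt l) x.2,
   fcalcN N (fun l => - Num.sqrt l * sin (Num.sqrt l * t)) x.1 +
   fcalcN N (fun l => cos (Num.sqrt l * t)) x.2).

(* Integral over [0, t] of a U_N-valued function. *)
Definition intN (N : nat) (t : R) (G : R -> L2 R d) : L2 R d :=
  \sum_(i < N) (\int[lebesgue_measure]_(s in `[0, t]) ip (G s) (e i)) *: e i.

Definition cubic (c0 c1 c2 c3 : R) (r : R) : R :=
  c3 * r ^+ 3 + c2 * r ^+ 2 + c1 * r + c0.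

(* The directional derivative of F at u along w is the integral of f(u) w, for
   all u and w in L^4.  This forces F to respect almost everywhere equality on
   L^4; its values outside L^4 play no role. *)
Definition potential (f : R -> R) (F : ('rV[R]_d -> R) -> R) : Prop :=
  forall u w : L4 R d,
    is_derive (0 : R) (1 : R) (fun s : R => F (u + s *: w : L4 R d))
      (ip (f \o u) w).

Definition energy (F : ('rV[R]_d -> R) -> R) (C1 : R) (u v : L2 R d) : R :=
  2^-1 * fine (dotH_norm2 1 u) + 2^-1 * normL 2 v ^+ 2 + F u + C1.

End galerkin.

Section stochastics.
Variables (R : realType) (d : nat).
Variables (dO : measure_display) (Omega : measurableType dO).
Variables (P : probability Omega R) (Fil : R -> set (set Omega)).
Local Notation mu := (cube_measure R d).

(* The sigma-algebra generated by an L^2-valued map; as L^2 is separable, its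
   open balls generate the Borel sets. *)
Definition sigma_of (xi : Omega -> L2 R d) : set (set Omega) :=
  <<s [set A | exists (x : L2 R d) (r : R),
         A = [set w | normL 2 (xi w - x : L2 R d) < r]] >>.

Definition filtration : Prop :=
  (forall t, 0 <= t -> sigma_algebra setT (Fil t) /\ Fil t `<=` measurable) /\
  (forall s t, 0 <= s -> s <= t -> Fil s `<=` Fil t).

Definition adapted (X : R -> Omega -> L2 R d) : Prop :=
  forall t, 0 <= t -> sigma_of (X t) `<=` Fil t.

Definition continuous_path (x : R -> L2 R d) : Prop :=
  forall t, 0 <= t ->
    normL 2 (x s - x t : L2 R d) @[s --> within `[0, +oo[ (nbhs t)] --> (0 : R).

(* N(0, v) with variance v; [normal_prob] is not the Dirac mass when its deviation is 0. *)
Definition centered_gaussian (v : R) : set (measurableTypeR R) -> \bar R :=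
  if v == 0 then \d_ (0 : R) else normal_prob 0 (Num.sqrt v).

Definition Q_wiener (Q : L2 R d -> L2 R d) (W : R -> Omega -> L2 R d) : Prop :=
  [/\ {ae P, forall w, W 0 w = cst 0 %[ae mu]},
      {ae P, forall w, continuous_path (W ^~ w)},
      adapted W,
      (forall s t, 0 <= s -> s <= t -> forall A B,
         Fil s A -> sigma_of (fun w => W t w - W s w : L2 R d) B ->
         P (A `&` B) = (P A * P B)%E) &
      (forall s t, 0 <= s -> s <= t -> forall (h : L2 R d)
           (B : set (measurableTypeR R)), measurable B ->
         P [set w | B (ip (W t w - W s w : L2 R d) h)] =
         centered_gaussian ((t - s) * ip (Q h) h) B)].

(* [I] is the integral over [0, t] of the deterministic operator-valued
   integrand [Phi] against dW: the mean-square limit of the left-point sums as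
   the mesh tends to 0.  Used only for integrands continuous in time. *)
Definition wiener_integral (W : R -> Omega -> L2 R d)
    (Phi : R -> L2 R d -> L2 R d) (t : R) (I : Omega -> L2 R d) : Prop :=
  sigma_of I `<=` measurable /\
  forall eps : R, 0 < eps -> exists2 delta : R, 0 < delta &
    forall (n : nat) (s : nat -> R), s 0%N = 0 -> s n = t ->
      (forall k, (k < n)%N -> s k <= s k.+1 /\ s k.+1 - s k < delta) ->
      ('E_P[fun w => (normL 2 (\sum_(k < n)
          Phi (s k) (W (s k.+1) w - W (s k) w) - I w : L2 R d) ^+ 2)%R]
       <= eps%:E)%E.

Variables (lam : nat -> R) (e : nat -> L2 R d).

Definition galerkin_mild_solution (N : nat) (f : R -> R)
    (W : R -> Omega -> L2 R d) (u0 v0 : L2 R d)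
    (u v : R -> Omega -> L2 R d) : Prop :=
  let E := groupN lam e N in let PN := projN lam e N in
  [/\ (forall t w, 0 <= t -> in_UN e N (u t w) /\ in_UN e N (v t w)),
      adapted u /\ adapted v,
      {ae P, forall w, continuous_path (u ^~ w) /\ continuous_path (v ^~ w)} &
      forall t, 0 <= t -> exists I J : Omega -> L2 R d,
        [/\ wiener_integral W (fun s x => (E (t - s) (0, PN x)).1) t I,
            wiener_integral W (fun s x => (E (t - s) (0, PN x)).2) t J &
            {ae P, forall w,
              u t w = ((E t (PN u0, PN v0)).1 +
                intN e N t (fun s => (E (t - s)
                  (0, - PN (f \o u s w))).1) + I w : L2 R d) %[ae mu] /\
              v t w = ((E t (PN u0, PN v0)).2 +
                intN e N t (fun s => (E (t - s)
                  (0, - PN (f \o u s w))).2) + J w : L2 R d) %[ae mu]}]].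

End stochastics.

(* Main.v *)
Require Import Defs.
From HB Require Import structures.
From mathcomp Require Import all_boot all_order all_algebra.
From mathcomp Require Import all_classical all_reals all_analysis.
From mathcomp Require Import measurable_realfun ring lra.
Import Order.TTheory GRing.Theory Num.Theory.
Import numFieldNormedType.Exports.

(** The noise enters the velocity equation additively, and this makes the
    energy law accessible path by path.  Along e_0, ..., e_(N-1) let x_i, v_i
    and b_i be the coordinates of u^N, v^N and W, and put z_i = v_i - b_i.
    Almost every path then solves an ordinary differential equation with
    continuous data,
      x_i' = z_i + b_i,   z_i' = - lam_i x_i - force_i(x),
    where force is the gradient of the quartic polynomial
    Phi(c) = F(sum_i c_i e_i).  The function
    H = 1/2 sum_i (lam_i x_i^2 + z_i^2) + Phi(x) satisfies
    H' = - sum_i z_i' b_i, and summation by parts turns the integral of this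
    identity into a limit of left-point sums over uniform grids s_k of [0, t]
    ([energy_balance]):
      sum_i z_i(t) b_i(t) + H(t) - H(0) = lim_n M_n,
      M_n = sum_i sum_k z_i(s_k) (b_i(s_(k+1)) - b_i(s_k)).
    Expanding v_i^2 = z_i^2 + 2 z_i b_i + b_i^2, the energy at time t is
    V_1(0) + lim_n M_n + 1/2 sum_i b_i(t)^2.  The last sum has mean
    t sum_i <Q e_i, e_i>, and sum_i <Q e_i, e_i> over i < N is the trace of
    (P_N Q^(1/2)) (P_N Q^(1/2))^* ([trace_projN_sqrt]).

    It remains to see that lim_n M_n has mean zero.  Each M_n is a martingale
    transform of the Wiener increments, so E M_n = 0 and E M_n^2 is controlled
    by the second moments of z ([martingale_transform]).  A bound on these,
    uniform in time, comes from the quartic lower bound on F: it gives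
    |H'| <= C (H + b1 + 1)^(3/4) sum_i |b_i|, hence H + b1 + 1 is at most the
    fourth power of a constant plus C times the integral of sum_i |b_i|
    ([hamiltonian_bound]), and the fourth moments of b are finite.  Boundedness
    in L^2 then lets the mean pass to the limit: Fatou's lemma is applied to
    the nonnegative variables +-M_n + eps M_n^2 + 1/(4 eps)
    ([zero_mean_limit]).

    Two points link this to the mild formulation.  The stochastic convolutions
    are mean-square limits of left-point sums, and these sums also converge
    path by path, since their integrands are smooth in time; the two limits
    agree almost surely ([L2_limit_unique], [wiener_integral_coord]).  This
    gives the variation-of-constants formula for almost every path, first at
    nonnegative rational times and then everywhere by continuity
    ([mild_driven_path]).  The eigenfunctions are essentially bounded, being
    continuous on the closed cube, so every integral of a polynomial in a
    finite combination of them is a polynomial in the coefficients. *)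

Set Implicit Arguments.
Unset Strict Implicit.
Unset Printing Implicit Defensive.

Local Open Scope classical_set_scope.
Local Open Scope ring_scope.

(** * Derivatives of real functions and limits of finite sums *)

Section real_derivatives.
Variable R : realType.
Implicit Types (f g : R -> R) (s a b : R).

Lemma is_derive1_fct f g s a : f =1 g -> is_derive s 1 f a ->
  is_derive s 1 g a.
Proof. by move=> /funext ->. Qed.

Lemma is_derive1D f g s a b : is_derive s 1 f a -> is_derive s 1 g b ->
  is_derive s 1 (fun t => f t + g t) (a + b).
Proof. by move=> df dg; exact: is_deriveD. Qed.

Lemma is_derive1B f g s a b : is_derive s 1 f a -> is_derive s 1 g b ->
  is_derive s 1 (fun t => f t - g t) (a - b).
Proof. by move=> df dg; exact: is_deriveB. Qed.

Lemma is_derive1Z f (c : R) s a : is_derive s 1 f a ->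
  is_derive s 1 (fun t => c * f t) (c * a).
Proof. by move=> df; exact: is_deriveZ. Qed.

Lemma is_derive1M f g s a b : is_derive s 1 f a -> is_derive s 1 g b ->
  is_derive s 1 (fun t => f t * g t) (a * g s + f s * b).
Proof.
move=> df dg; have h := is_deriveM df dg.
apply: is_derive_eq; rewrite /GRing.scale/=; ring.
Qed.

Lemma is_derive1X f n s a : is_derive s 1 f a ->
  is_derive s 1 (fun t => f t ^+ n) (n%:R * f s ^+ n.-1 * a).
Proof.
by move=> df; have h := is_deriveX n df; apply: is_derive1_fct h => t; rewrite exprfctE.
Qed.

Lemma is_derive1_sum n (F : 'I_n -> R -> R) (dF : 'I_n -> R) s :
  (forall i, is_derive s 1 (F i) (dF i)) ->
  is_derive s 1 (fun t => \sum_i F i t) (\sum_i dF i).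
Proof.
move=> h; apply: is_derive1_fct (is_derive_sum h) => t.
by rewrite fct_sumE.
Qed.

(** Directional derivatives of F are given at the origin of a line; this moves
    the base point along the line. *)
Lemma is_derive1_translate f (s a : R) :
  is_derive (0 : R) (1 : R) (fun h => f (s + h)) a -> is_derive s 1 f a.
Proof.
move=> df.
have ds : is_derive s 1 (fun t : R => t - s) 1.
  by apply: is_derive_eq; rewrite subr0.
have {}df : is_derive (s - s) 1 (fun h : R => f (s + h)) a by rewrite subrr.
have := @is_derive1_comp _ (fun h => f (s + h)) (fun t => t - s) s a 1 df ds; rewrite mulr1.
by apply: is_derive1_fct => t /=; rewrite subrKC.
Qed.

Lemma cvg_sum_ord (T : Type) (Fi : set_system T) {FF : Filter Fi} n
    (F : 'I_n -> T -> R) (l : 'I_n -> R) :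
  (forall i, F i x @[x --> Fi] --> l i) ->
  (\sum_(i < n) F i x) @[x --> Fi] --> \sum_(i < n) l i.
Proof.
by move=> h; apply: (@cvg_big R^o) => //; exact: add_continuous.
Qed.

Lemma cvg_pow (T : Type) (Fi : set_system T) {FF : Filter Fi} (f : T -> R)
    (l : R) n : f x @[x --> Fi] --> l -> f x ^+ n @[x --> Fi] --> l ^+ n.
Proof.
move=> fl; elim: n => [|n IH]; first exact: cvg_cst.
by rewrite exprS; under eq_fun do rewrite exprS; exact: cvgM.
Qed.

End real_derivatives.

(** * Essentially bounded functions on a probability space *)

Section ess_bounded.
Context d (T : measurableType d) (R : realType) (mu : probability T R).
Implicit Types f g h : T -> R.

Lemma ae_eq_Rintegral f g : measurable_fun setT f -> measurable_fun setT g ->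
  {ae mu, forall z, f z = g z} -> \int[mu]_z f z = \int[mu]_z g z.
Proof.
move=> mf mg fg; congr fine; apply: ae_eq_integral => //.
- exact/measurable_EFinP.
- exact/measurable_EFinP.
- by apply: filterS fg => z -> _.
Qed.

Lemma ae_eq_integrable f g : measurable_fun setT f -> measurable_fun setT g ->
  {ae mu, forall z, f z = g z} -> mu.-integrable setT (EFin \o g) ->
  mu.-integrable setT (EFin \o f).
Proof.
move=> mf mg fg /integrableP[_ ig]; apply/integrableP.
split; first exact/measurable_EFinP.
rewrite (ae_eq_integral (fun z => `|(EFin \o g) z|%E))//.
- by apply: measurableT_comp => //; exact/measurable_EFinP.
- by apply: measurableT_comp => //; exact/measurable_EFinP.
- by apply: filterS fg => z /= -> _.
Qed.

Lemma Rintegral_sum (I : Type) (s : seq I) (F : I -> T -> R) :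
  (forall i, mu.-integrable setT (EFin \o F i)) ->
  \int[mu]_z (\sum_(i <- s) F i z) = \sum_(i <- s) \int[mu]_z F i z.
Proof.
move=> iF; elim: s => [|i s IH].
  rewrite big_nil; under eq_Rintegral do rewrite big_nil.
  by rewrite Rintegral_cst// mul0r.
rewrite big_cons -IH -RintegralD//.
  by apply: eq_Rintegral => z _; rewrite big_cons.
rewrite [X in integrable _ _ X](_ : _ =
    fun z => (\sum_(j <- s) (EFin \o F j) z)%E); last first.
  by apply/funext => z /=; rewrite sumEFin.
by apply: integrable_sum => // j _; exact: iF.
Qed.

Lemma ae_bounded_Rintegral f (C : R) : mu.-integrable setT (EFin \o f) ->
  0 <= C -> {ae mu, forall z, `|f z| <= C} -> `|\int[mu]_z f z| <= C.
Proof.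
move=> intf C0 fC; apply: le_trans (le_normr_Rintegral _ intf) _ => //.
rewrite -lee_fin fineK; last first.
  apply: integrable_fin_num => //.
  by have := integrable_abse intf; apply: eq_integrable.
apply: (@le_trans _ _ (\int[mu]_z (cst C%:E z))%E).
  apply: ae_ge0_le_integral => //.
  - case/integrableP : intf => /measurable_EFinP mf _.
    by apply/measurable_EFinP; exact: measurableT_comp.
  - by apply: filterS fC => z fz _; rewrite lee_fin.
by rewrite integral_cst//= probability_setT mule1.
Qed.

(** On a probability space these functions form an algebra contained in every
    L^p, so polynomials in the eigenfunctions can be integrated freely. *)
Definition ess_bounded f := measurable_fun setT f /\
  exists K : R, {ae mu, forall z, `|f z| <= K}.

Lemma ess_bounded_integrable f : ess_bounded f ->
  mu.-integrable setT (EFin \o f).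
Proof.
move=> [mf [K fK]]; apply/integrableP; split; first exact/measurable_EFinP.
apply: (@le_lt_trans _ _ (\int[mu]_z (cst (Num.max K 0)%:E z))%E).
  apply: ae_ge0_le_integral => //.
  - by apply: measurableT_comp => //; exact/measurable_EFinP.
  - by move=> z _; rewrite lee_fin le_max lexx orbT.
  - by apply: filterS fK => z fz _ /=; rewrite lee_fin le_max fz.
by rewrite integral_cst//= probability_setT mule1 ltry.
Qed.

Lemma ess_bounded_cst c : ess_bounded (cst c).
Proof. by split=> //; exists `|c|; exact: nearW. Qed.

Lemma ess_boundedD f g : ess_bounded f -> ess_bounded g ->
  ess_bounded (fun z => f z + g z).
Proof.
move=> [mf [K fK]] [mg [L gL]]; split; first exact: measurable_funD.
exists (K + L); apply: filterS2 fK gL => z fz gz.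
by rewrite (le_trans (ler_normD _ _))// lerD.
Qed.

Lemma ess_boundedM f g : ess_bounded f -> ess_bounded g ->
  ess_bounded (fun z => f z * g z).
Proof.
move=> [mf [K fK]] [mg [L gL]]; split; first exact: measurable_funM.
exists (K * L); apply: filterS2 fK gL => z fz gz.
by rewrite normrM ler_pM.
Qed.

Lemma ess_bounded_sum (I : Type) (s : seq I) (F : I -> T -> R) :
  (forall i, ess_bounded (F i)) -> ess_bounded (fun z => \sum_(i <- s) F i z).
Proof.
move=> bF; elim: s => [|i s IH].
  rewrite (_ : (fun _ => _) = cst 0); first exact: ess_bounded_cst.
  by apply/funext => z; rewrite big_nil.
rewrite (_ : (fun _ => _) = fun z => F i z + \sum_(j <- s) F j z).
  exact: ess_boundedD.
by apply/funext => z; rewrite big_cons.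
Qed.

Lemma ess_boundedX f n : ess_bounded f -> ess_bounded (fun z => f z ^+ n).
Proof.
move=> bf; elim: n => [|n IH]; first exact: (ess_bounded_cst 1).
rewrite (_ : (fun _ => _) = fun z => f z * f z ^+ n); first exact: ess_boundedM.
by apply/funext => z; rewrite exprS.
Qed.

Lemma ess_bounded_ae f g : measurable_fun setT g ->
  {ae mu, forall z, g z = f z} -> ess_bounded f -> ess_bounded g.
Proof.
move=> mg gf [_ [K fK]]; split=> //; exists K.
by apply: filterS2 gf fK => z ->.
Qed.

Lemma ess_bounded_Lfun f n : ess_bounded f -> f \in Lfun mu n.+1%:R%:E.
Proof.
move=> /[dup] bf [mf _]; apply/andP; split; rewrite inE//=.
rewrite /finite_norm unlock poweR_lty//.
have /ess_bounded_integrable/integrableP[_] := ess_boundedX n.+1 bf.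
apply: le_lt_trans; apply: ge0_le_integral => //.
- by move=> z _; rewrite poweR_ge0.
- rewrite [X in measurable_fun _ X](_ : _ = EFin \o fun z => `|f z| ^+ n.+1).
    by apply/measurable_EFinP/measurable_funX; exact: measurableT_comp.
  by apply/funext => z /=; rewrite powR_mulrn.
- apply: measurableT_comp => //; apply/measurable_EFinP.
  exact: measurable_funX.
- by move=> z _; rewrite /= lee_fin powR_mulrn// normrX.
Qed.

End ess_bounded.

(** * The inner product of L^2 *)

Section L2_facts.
Variables (R : realType) (d : nat).
Local Notation mu := (cube_measure R d).
Implicit Types x y : L2 R d.

Lemma measurable_L2 x : measurable_fun setT (x : 'rV[R]_d -> R).
Proof. exact: measurable_funPT. Qed.

Lemma integrable_L2M x y : mu.-integrable setT (EFin \o (fun z => x z * y z)).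
Proof. exact/Lfun1_integrable/Lfun2_mul_Lfun1/LfunP/LfunP. Qed.

(** Stated for plain functions, since [ip] is also applied to the values of the
    nonlinearity, which are not bundled as elements of L^2. *)
Lemma ip_sym (f g : 'rV[R]_d -> R) : ip f g = ip g f.
Proof. by apply: eq_Rintegral => z _; rewrite mulrC. Qed.

Lemma ipDl x x' y : ip (x + x' : L2 R d) y = ip x y + ip x' y.
Proof.
rewrite -RintegralD//; try exact: integrable_L2M.
by apply: eq_Rintegral => z _; rewrite -mulrDl.
Qed.

Lemma ipZl (a : R) x y : ip (a *: x : L2 R d) y = a * ip x y.
Proof.
rewrite -RintegralZl//; last exact: integrable_L2M.
by apply: eq_Rintegral => z _; rewrite mulrA.
Qed.

Lemma ipNl x y : ip (- x : L2 R d) y = - ip x y.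
Proof. by rewrite -scaleN1r ipZl mulN1r. Qed.

Lemma ipBl x x' y : ip (x - x' : L2 R d) y = ip x y - ip x' y.
Proof. by rewrite ipDl ipNl. Qed.

Lemma ip0l y : ip (0 : L2 R d) y = 0.
Proof. by rewrite -(scale0r (0 : L2 R d)) ipZl mul0r. Qed.

Lemma ip_suml (I : Type) (s : seq I) (x : I -> L2 R d) y :
  ip (\sum_(i <- s) x i : L2 R d) y = \sum_(i <- s) ip (x i) y.
Proof.
elim: s => [|i s IH]; first by rewrite !big_nil ip0l.
by rewrite !big_cons ipDl IH.
Qed.

Lemma L2_sumE (I : Type) (s : seq I) (x : I -> L2 R d) z :
  (\sum_(i <- s) x i : L2 R d) z = \sum_(i <- s) x i z.
Proof. by elim/big_ind2: _ => // ? ? ? ? <- <-. Qed.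

Lemma ip_ae (f g : 'rV[R]_d -> R) (y : L2 R d) :
  measurable_fun setT f -> measurable_fun setT g ->
  f = g %[ae mu] -> ip f y = ip g y.
Proof.
move=> mf mg fg; apply: ae_eq_Rintegral.
- by apply: measurable_funM => //; exact: measurable_L2.
- by apply: measurable_funM => //; exact: measurable_L2.
- by apply: filterS fg => z ->.
Qed.

Lemma normL2_sqr x : normL 2 x ^+ 2 = ip x x.
Proof.
have fN : (normL 2 x)%:E = 'N[mu]_2%:E[EFin \o x]%E.
  exact: (finite_norm_fine x).
have N0 : 0 <= normL 2 x by rewrite fine_ge0// Lnorm_ge0.
have n2 : (2 : R) != 0 by [].
have := poweR_Lnorm mu (EFin \o x) n2.
rewrite -fN poweR_EFin powR_mulrn// => h.
apply/EFin_inj; rewrite h /ip /Rintegral fineK.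
  apply: eq_integral => z _ /=; rewrite powR_mulrn// -normrX ger0_norm//.
  by rewrite sqr_ge0.
by apply: integrable_fin_num => //; exact: integrable_L2M.
Qed.

Lemma normL_ge0 p (f : 'rV[R]_d -> R) : 0 <= normL p f.
Proof. by rewrite fine_ge0// Lnorm_ge0. Qed.

(** The quadratic form a, b |-> <a x + b y, a x + b y> is nonnegative; it is
    evaluated at a = <y, y>, b = - <x, y>, or, when <y, y> = 0, at
    a = - <x, y>, b = <x, x> + 1. *)
Lemma cauchy_schwarz x y : ip x y ^+ 2 <= ip x x * ip y y.
Proof.
have h (a b : R) : 0 <= a ^+ 2 * ip x x + 2 * a * b * ip x y + b ^+ 2 * ip y y.
  have := sqr_ge0 (normL 2 (a *: x + b *: y : L2 R d)); rewrite normL2_sqr.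
  rewrite ipDl !ipZl ip_sym ipDl !ipZl [X in _ + b * X]ip_sym ipDl !ipZl.
  rewrite (ip_sym y x); congr (_ <= _); ring.
have x0 : 0 <= ip x x by rewrite -normL2_sqr sqr_ge0.
have y0 : 0 <= ip y y by rewrite -normL2_sqr sqr_ge0.
have [yy|yy] := eqVneq (ip y y) 0.
  have := h (- ip x y) (ip x x + 1); rewrite yy mulr0 mulr0 addr0.
  have : 0 <= ip x y ^+ 2 by exact: sqr_ge0.
  nra.
have := h (ip y y) (- ip x y).
have {}yy : 0 < ip y y by rewrite lt0r yy.
have -> : ip y y ^+ 2 * ip x x + 2 * ip y y * (- ip x y) * ip x y +
  (- ip x y) ^+ 2 * ip y y = ip y y * (ip x x * ip y y - ip x y ^+ 2) by ring.
by rewrite pmulr_rge0// subr_ge0.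
Qed.

Lemma normr_ip x y : `|ip x y| <= normL 2 x * normL 2 y.
Proof.
rewrite -(@ler_pXn2r _ 2)// ?nnegrE ?mulr_ge0 ?normL_ge0//.
by rewrite exprMn !normL2_sqr real_normK ?num_real// cauchy_schwarz.
Qed.

End L2_facts.

(** * The unit cube and the eigenfunctions *)

Section cube_facts.
Variable R : realType.

Lemma measurable_closed_cube n : measurable (@closed_cube R n).
Proof.
rewrite (_ : @closed_cube R n = \big[setI/setT]_(i < n)
    ((fun y : 'rV[R]_n => y ord0 i) @^-1` `[0, 1])); last first.
  apply/seteqP; split=> y /=.
    move=> h; elim/big_ind : _ => //= i _; have := h i; by rewrite in_itv.
  move=> h i; rewrite (bigD1 i)//= in h; case: h => + _.
  by rewrite /= in_itv.
apply: bigsetI_measurable => i _.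
by rewrite -[X in measurable X]setTI; apply: measurable_coord.
Qed.

(** The measure on row vectors is built one coordinate at a time, so the mass of
    the cube is computed by induction on the dimension. *)
Lemma cube_measure_closed_cube n : cube_measure R n (@closed_cube R n) = 1%E.
Proof.
elim: n => [|n IH].
  rewrite /= diracE mem_set// => -[]//.
change (pushforward (@lebesgue01 R \x cube_measure R n)%E (@cons_rv R n)
  (@closed_cube R n.+1) = 1%E).
rewrite /pushforward (_ : _ @^-1` _ = `[0%R, 1%R] `*` @closed_cube R n).
  rewrite product_measure1E//; last exact: measurable_closed_cube.
  rewrite [X in (_ * X)%E]IH mule1.
  change (@lebesgue_measure R (`[0%R, 1%R] `&` `]0%R, 1%R[) = 1%E).
  rewrite setIidr; last exact: subset_itv_oo_cc.
  by rewrite lebesgue_measure_itv/= lte_fin ltr01 oppr0 adde0.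
apply/seteqP; split=> -[a y] /=.
  move=> h; split.
    have := h ord0; rewrite /cons_rv/= in_itv/=.
    have -> : ord0 = lshift n (ord0 : 'I_1) by exact/val_inj.
    by rewrite (row_mxEl (const_mx a : 'rV[R]_1)) mxE.
  move=> i; have := h (rshift 1 i).
  by rewrite /cons_rv/= (row_mxEr (const_mx a : 'rV[R]_1)).
rewrite in_itv/= => -[a01 hy] i; rewrite /cons_rv/=.
case: (split_ordP (i : 'I_(1 + n))) => j ->.
  by rewrite (row_mxEl (const_mx a : 'rV[R]_1)) mxE.
by rewrite (row_mxEr (const_mx a : 'rV[R]_1)); exact: hy.
Qed.

Lemma ae_closed_cube n : {ae cube_measure R n, forall y, @closed_cube R n y}.
Proof.
exists (~` @closed_cube R n); split=> //.
  by apply: measurableC; exact: measurable_closed_cube.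
rewrite probability_setC; last exact: measurable_closed_cube.
by rewrite [X in (_ - X)%E]cube_measure_closed_cube subee.
Qed.

(** An eigenfunction agrees almost everywhere with a function continuous on the
    compact closed cube, which carries the whole measure. *)
Lemma dirichlet_eigenpair_ess_bounded d (l : R) (x : L2 R d) :
  dirichlet_eigenpair l x -> ess_bounded (cube_measure R d) x.
Proof.
move=> [phi [xphi cphi _ _ _]]; split; first exact: measurable_L2.
have ck : compact (@closed_cube R d).
  rewrite (_ : @closed_cube R d =
      [set v | forall i, `[0%R, 1%R]%classic (v ord0 i)]).
    by apply: (@rV_compact R d (fun=> `[0%R, 1%R]%classic)) => i; exact: segment_compact.
  by apply/seteqP; split => y /= h i; have := h i; rewrite in_itv.
have /compact_bounded[K [_ Kb]] := continuous_compact cphi ck.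
exists (K + 1); apply: filterS2 xphi (ae_closed_cube d) => z xz cz.
by rewrite xz//; apply: (Kb (K + 1)); [rewrite ltrDl|exists z].
Qed.

End cube_facts.

(** * Moments of combinations of bounded functions *)

Section moments.
Context d (T : measurableType d) (R : realType) (mu : probability T R).
Variables (N : nat) (e : 'I_N -> T -> R).
Hypothesis be : forall i, ess_bounded mu (e i).
Implicit Types (h : T -> R) (c : 'I_N -> R) (x : 'I_N -> R -> R).

Definition synthesis c z := \sum_i c i * e i z.

Definition moment k h c := \int[mu]_z (synthesis c z ^+ k * h z).

Lemma ess_bounded_synthesis c : ess_bounded mu (synthesis c).
Proof.
apply: ess_bounded_sum => i.
by apply: ess_boundedM => //; exact: ess_bounded_cst.
Qed.

Lemma integrable_moment k h c : ess_bounded mu h ->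
  mu.-integrable setT (EFin \o (fun z => synthesis c z ^+ k * h z)).
Proof.
move=> bh; apply: ess_bounded_integrable; apply: ess_boundedM => //.
exact/ess_boundedX/ess_bounded_synthesis.
Qed.

(** Peeling off one factor of the power: by this recursion each moment is a
    polynomial in the coefficients.  Measurability, continuity and derivatives
    of moments are then inductions on [k], with the weight [h] generalized. *)
Lemma momentS k h c : ess_bounded mu h ->
  moment k.+1 h c = \sum_j c j * moment k (fun z => e j z * h z) c.
Proof.
move=> bh; under eq_bigr => j _.
  rewrite -RintegralZl//; last by apply: integrable_moment; exact: ess_boundedM.
  over.
rewrite -Rintegral_sum; last first.
  move=> j; apply: ess_bounded_integrable; apply: ess_boundedM.
    exact: ess_bounded_cst.
  apply: ess_boundedM; last exact: ess_boundedM.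
  exact/ess_boundedX/ess_bounded_synthesis.
apply: eq_Rintegral => z _; rewrite exprS -mulrA {1}/synthesis mulr_suml.
by apply: eq_bigr => j _; ring.
Qed.

Lemma moment0 h c : moment 0 h c = \int[mu]_z h z.
Proof. by apply: eq_Rintegral => z _; rewrite expr0 mul1r. Qed.

Lemma measurable_moment d' (T' : measurableType d') (X : 'I_N -> T' -> R) k h :
  ess_bounded mu h -> (forall i, measurable_fun setT (X i)) ->
  measurable_fun setT (fun w => moment k h (X ^~ w)).
Proof.
move=> + mX; elim: k h => [|k IH] h bh.
  by under eq_fun do rewrite moment0; exact: measurable_cst.
under eq_fun do rewrite momentS//.
apply: measurable_sum => j; apply: measurable_funM => //.
by apply: IH; exact: ess_boundedM.
Qed.

Lemma cvg_moment (I : Type) (Fi : set_system I) {FF : Filter Fi}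
    (X : 'I_N -> I -> R) (l : 'I_N -> R) k h :
  ess_bounded mu h -> (forall i, X i t @[t --> Fi] --> l i) ->
  moment k h (X ^~ t) @[t --> Fi] --> moment k h l.
Proof.
move=> + cX; elim: k h => [|k IH] h bh.
  by under eq_fun do rewrite moment0; rewrite moment0; exact: cvg_cst.
under eq_fun do rewrite momentS//.
rewrite momentS//; apply: cvg_sum_ord => j; apply: cvgM => //.
by apply: IH; exact: ess_boundedM.
Qed.

(** Differentiation under the integral sign, obtained from the recursion instead
    of a domination argument. *)
Lemma is_derive_moment x (dx : 'I_N -> R) (s : R) k h :
  ess_bounded mu h -> (forall i, is_derive s 1 (x i) (dx i)) ->
  is_derive s 1 (fun t => moment k h (x ^~ t))
    (k%:R * \sum_i dx i * moment k.-1 (fun z => e i z * h z) (x ^~ s)).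
Proof.
move=> + hx; elim: k h => [|k IH] h bh.
  rewrite mul0r; under eq_fun do rewrite moment0.
  exact: is_derive_cst.
under eq_fun do rewrite momentS//.
have bj j : ess_bounded mu (fun z => e j z * h z) by exact: ess_boundedM.
have := is_derive1_sum (fun j => is_derive1M (hx j) (IH _ (bj j))).
move=> /(@is_derive_eq _ _ _ _ _ _ _ _); apply.
rewrite big_split/= mulrSr mulrDl mul1r addrC; congr (_ + _).
case: k IH => [|k] _.
  by rewrite mul0r big1// => i _; rewrite mul0r mulr0.
under eq_bigr do rewrite mulrCA; rewrite -mulr_sumr; congr (_ * _).
under [LHS]eq_bigr do rewrite mulr_sumr; rewrite exchange_big/=.
apply: eq_bigr => i _; rewrite momentS// mulr_sumr.
apply: eq_bigr => j _; rewrite mulrCA; congr (_ * (_ * _)).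
by apply: eq_Rintegral => z _; ring.
Qed.

Lemma moment_bound (K : R) k h c : 0 <= K ->
  {ae mu, forall z, `|h z| <= K} ->
  (forall i, {ae mu, forall z, `|e i z| <= K}) -> ess_bounded mu h ->
  `|moment k h c| <= K * (K * \sum_i `|c i|) ^+ k.
Proof.
move=> K0 hK eK bh; have bs := ess_bounded_synthesis c.
apply: ae_bounded_Rintegral; first exact: integrable_moment.
  by rewrite mulr_ge0// exprn_ge0// mulr_ge0// sumr_ge0.
have eKa : {ae mu, forall z, forall i, `|e i z| <= K}.
  by apply: filter_forall => i; exact: eK.
apply: filterS2 hK eKa => z hz ez.
rewrite normrM mulrC ler_pM// normrX lerXn2r ?nnegrE//.
  by rewrite mulr_ge0// sumr_ge0.
rewrite mulr_sumr (le_trans (ler_norm_sum _ _ _))// ler_sum// => i _.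
by rewrite normrM mulrC ler_wpM2r.
Qed.

End moments.

(** * The force and its potential in coordinates *)

Section cubic_moments.
Context d (T : measurableType d) (R : realType) (mu : probability T R).
Variables (N : nat) (e : 'I_N -> T -> R).
Hypothesis be : forall i, ess_bounded mu (e i).
Variables c0 c1 c2 c3 : R.
Implicit Types (c : 'I_N -> R) (x : 'I_N -> R -> R) (u h : T -> R).
Local Notation mom := (moment mu e).

Definition cubic_primitive (r : R) :=
  c3 / 4 * r ^+ 4 + c2 / 3 * r ^+ 3 + c1 / 2 * r ^+ 2 + c0 * r.

(** Up to the constant F(0), the value of the potential functional at
    sum_i c_i e_i, and below its gradient, both expanded into moments. *)
Definition galerkin_potential c :=
  c3 / 4 * mom 4 (cst 1) c + c2 / 3 * mom 3 (cst 1) c +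
  c1 / 2 * mom 2 (cst 1) c + c0 * mom 1 (cst 1) c.

Definition galerkin_force i c :=
  c3 * mom 3 (e i) c + c2 * mom 2 (e i) c +
  c1 * mom 1 (e i) c + c0 * mom 0 (e i) c.

Lemma ess_bounded1 : ess_bounded mu (cst 1). Proof. exact: ess_bounded_cst. Qed.

Lemma Rintegral_comb4 (a0 a1 a2 a3 : R) (f0 f1 f2 f3 : T -> R) :
  ess_bounded mu f0 -> ess_bounded mu f1 -> ess_bounded mu f2 ->
  ess_bounded mu f3 ->
  \int[mu]_z (a3 * f3 z + a2 * f2 z + a1 * f1 z + a0 * f0 z) =
  a3 * (\int[mu]_z f3 z) + a2 * (\int[mu]_z f2 z) + a1 * (\int[mu]_z f1 z) +
  a0 * (\int[mu]_z f0 z).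
Proof.
move=> b0 b1 b2 b3.
have bZ (a : R) f : ess_bounded mu f -> ess_bounded mu (fun z => a * f z).
  by move=> bf; apply: ess_boundedM => //; exact: ess_bounded_cst.
rewrite !RintegralD// ?RintegralZl//; apply: ess_bounded_integrable;
  by repeat first [exact: bZ | apply: ess_boundedD | assumption].
Qed.

Lemma galerkin_potentialE c :
  \int[mu]_z cubic_primitive (synthesis e c z) = galerkin_potential c.
Proof.
have bs := ess_bounded_synthesis be c.
rewrite Rintegral_comb4//; try exact: ess_boundedX.
rewrite /galerkin_potential /moment.
by congr (_ * _ + _ * _ + _ * _ + _ * _); apply: eq_Rintegral => z _;
  rewrite mulr1.
Qed.

Lemma galerkin_forceE i c :
  \int[mu]_z (cubic c0 c1 c2 c3 (synthesis e c z) * e i z) =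
  galerkin_force i c.
Proof.
have bs := ess_bounded_synthesis be c.
rewrite /galerkin_force /moment -Rintegral_comb4;
  try by apply: ess_boundedM => //; exact: ess_boundedX.
by apply: eq_Rintegral => z _; rewrite /cubic; ring.
Qed.

(** The force is the gradient of the potential; this makes the deterministic
    part of the system Hamiltonian. *)
Lemma is_derive_galerkin_potential x (dx : 'I_N -> R) (s : R) :
  (forall i, is_derive s 1 (x i) (dx i)) ->
  is_derive s 1 (fun t => galerkin_potential (x ^~ t))
    (\sum_i dx i * galerkin_force i (x ^~ s)).
Proof.
move=> hx; have dm k := is_derive_moment be k ess_bounded1 hx.
have := is_derive1D (is_derive1D (is_derive1D (is_derive1Z (c3 / 4) (dm 4%N))
  (is_derive1Z (c2 / 3) (dm 3%N))) (is_derive1Z (c1 / 2) (dm 2%N)))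
  (is_derive1Z c0 (dm 1%N)).
move=> /(@is_derive_eq _ _ _ _ _ _ _ _); apply.
have m1 i : (fun z => e i z * cst 1 z) = e i.
  by apply/funext => z; rewrite /= mulr1.
rewrite /= !mulr_sumr -!big_split/=; apply: eq_bigr => i _.
by rewrite m1 /galerkin_force; field.
Qed.

Lemma cvg_galerkin_potential (I : Type) (Fi : set_system I) {FF : Filter Fi}
    (X : 'I_N -> I -> R) (l : 'I_N -> R) :
  (forall i, X i t @[t --> Fi] --> l i) ->
  galerkin_potential (X ^~ t) @[t --> Fi] --> galerkin_potential l.
Proof.
move=> h; have cm k := cvg_moment be (k := k) ess_bounded1 h.
by apply: cvgD; [apply: cvgD; [apply: cvgD|]|]; apply: cvgM;
  try exact: cvg_cst; exact: cm.
Qed.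

Lemma cvg_galerkin_force (I : Type) (Fi : set_system I) {FF : Filter Fi}
    (X : 'I_N -> I -> R) (l : 'I_N -> R) i :
  (forall i, X i t @[t --> Fi] --> l i) ->
  galerkin_force i (X ^~ t) @[t --> Fi] --> galerkin_force i l.
Proof.
move=> h; have cm k := cvg_moment be (k := k) (be i) h.
by apply: cvgD; [apply: cvgD; [apply: cvgD|]|]; apply: cvgM;
  try exact: cvg_cst; exact: cm.
Qed.

Lemma measurable_galerkin_potential d' (T' : measurableType d')
    (X : 'I_N -> T' -> R) :
  (forall i, measurable_fun setT (X i)) ->
  measurable_fun setT (fun w => galerkin_potential (X ^~ w)).
Proof.
move=> h; have cm k := measurable_moment be k ess_bounded1 h.
by apply: measurable_funD; [apply: measurable_funD;
  [apply: measurable_funD|]|]; apply: measurable_funM => //; exact: cm.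
Qed.

(** The degree 3 matters: against the quartic growth of the energy it yields the
    exponent 3/4 in [growth]. *)
Lemma galerkin_force_bound : exists2 A : R, 0 <= A & forall i c,
  `|galerkin_force i c| <= A * (1 + \sum_j `|c j|) ^+ 3.
Proof.
have [K K0 eK] : exists2 K : R, 1 <= K &
    forall i, {ae mu, forall z, `|e i z| <= K}.
  have /choice[k hk] i : exists K : R, {ae mu, forall z, `|e i z| <= K}.
    by case: (be i).
  exists (1 + \sum_i `|k i|); first by rewrite lerDl sumr_ge0.
  move=> i; apply: filterS (hk i) => z /le_trans; apply.
  rewrite (le_trans (ler_norm _))// (bigD1 i)//= addrCA lerDl.
  by rewrite addr_ge0// sumr_ge0.
have Kge0 : 0 <= K by exact: le_trans K0.
exists (K ^+ 4 * (`|c3| + `|c2| + `|c1| + `|c0|)).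
  by rewrite mulr_ge0 ?exprn_ge0// !addr_ge0.
move=> i c; set S := \sum_j _.
have S0 : 0 <= S by rewrite sumr_ge0.
have S1 : 1 <= 1 + S by rewrite lerDl.
have mb k : (k <= 3)%N -> `|mom k (e i) c| <= K ^+ 4 * (1 + S) ^+ 3.
  move=> k3; apply: le_trans (moment_bound be _ _ Kge0 (eK i) eK (be i)) _.
  rewrite exprMn mulrA -exprS ler_pM ?exprn_ge0//.
    by rewrite ler_weXn2l.
  rewrite (@le_trans _ _ ((1 + S) ^+ k))//; last by rewrite ler_weXn2l.
  by rewrite lerXn2r ?nnegrE// ?lerDr// addr_ge0.
have tb a k : (k <= 3)%N ->
    `|a * mom k (e i) c| <= `|a| * (K ^+ 4 * (1 + S) ^+ 3).
  by move=> /mb h; rewrite normrM ler_wpM2l.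
have -> : K ^+ 4 * (`|c3| + `|c2| + `|c1| + `|c0|) * (1 + S) ^+ 3 =
    `|c3| * (K ^+ 4 * (1 + S) ^+ 3) + `|c2| * (K ^+ 4 * (1 + S) ^+ 3) +
    `|c1| * (K ^+ 4 * (1 + S) ^+ 3) + `|c0| * (K ^+ 4 * (1 + S) ^+ 3) by ring.
rewrite (le_trans (ler_normD _ _))// lerD ?tb//.
rewrite (le_trans (ler_normD _ _))// lerD ?tb//.
by rewrite (le_trans (ler_normD _ _))// lerD ?tb.
Qed.

End cubic_moments.

(** * The potential functional on bounded functions *)

Section potential_facts.
Variables (R : realType) (d : nat).
Local Notation mu := (cube_measure R d).
Variables (c0 c1 c2 c3 : R) (F : ('rV[R]_d -> R) -> R).
Hypothesis hF : potential (cubic c0 c1 c2 c3) F.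

(** The potential is only known through its directional derivatives.  Along the
    segment from 0 to [u] the functional and the integral of the primitive have
    the same derivative, so their difference is constant. *)
Lemma potential_ess_bounded (u : L4 R d) : ess_bounded mu u ->
  F u = F (0 : L4 R d) + \int[mu]_z cubic_primitive c0 c1 c2 c3 (u z).
Proof.
move=> bu; (* The moments of the single function u give the primitive along s u. *)
pose e (_ : 'I_1) := (u : 'rV[R]_d -> R).
have be i : ess_bounded mu (e i) by [].
pose Q := galerkin_potential mu e c0 c1 c2 c3.
have synE (s : R) z : synthesis e (fun=> s) z = s * u z.
  by rewrite /synthesis big_ord1.
have dF (s : R) : is_derive s 1 (fun s : R => F (s *: u : L4 R d) - Q (fun=> s)) 0.
  have dQ := is_derive_galerkin_potential be c0 c1 c2 c3
    (x := fun=> id) (fun=> is_derive_id s (1 : R)).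
  have dFs : is_derive s 1 (fun s : R => F (s *: u : L4 R d))
      (ip (cubic c0 c1 c2 c3 \o (s *: u : L4 R d)) u).
    apply: is_derive1_translate; have := hF (s *: u : L4 R d) u.
    by apply: is_derive1_fct => h; rewrite -scalerDl.
  have := is_derive1B dFs dQ; move=> /(@is_derive_eq _ _ _ _ _ _ _ _); apply.
  rewrite big_ord1 mul1r -galerkin_forceE//.
  apply/eqP; rewrite subr_eq0; apply/eqP; apply: eq_Rintegral => z _.
  by rewrite synE.
have := is_derive_0_is_cst 1 0 dF; rewrite scale1r scale0r => /eqP.
rewrite subr_eq => /eqP ->; rewrite -addrA; congr (_ + _).
have b1 : ess_bounded mu (cst 1) by exact: ess_bounded_cst.
have -> : Q (fun=> 0) = 0.
  by rewrite /Q /galerkin_potential !momentS// !big_ord1 !mul0r !mulr0 !addr0.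
rewrite oppr0 add0r /Q -galerkin_potentialE//.
by apply: eq_Rintegral => z _; rewrite synE mul1r.
Qed.

Lemma normL4_pow (u : L4 R d) : ess_bounded mu u ->
  normL 4 u ^+ 4 = \int[mu]_z (u z ^+ 4).
Proof.
move=> bu.
have fN : (normL 4 u)%:E = 'N[mu]_4%:E[EFin \o u]%E.
  exact: (finite_norm_fine u).
have n4 : (4 : R) != 0 by [].
have := poweR_Lnorm mu (EFin \o u) n4.
rewrite -fN poweR_EFin powR_mulrn ?normL_ge0// => h.
apply/EFin_inj; rewrite h /Rintegral fineK.
  apply: eq_integral => z _ /=; rewrite powR_mulrn// -normrX ger0_norm//.
  by rewrite exprn_even_ge0.
apply: integrable_fin_num => //; apply: ess_bounded_integrable.
exact: ess_boundedX.
Qed.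

(** The variance of [f] is nonnegative. *)
Lemma sqr_Rintegral (f : 'rV[R]_d -> R) : ess_bounded mu f ->
  (\int[mu]_z f z) ^+ 2 <= \int[mu]_z (f z ^+ 2).
Proof.
move=> bf; set m := Rintegral _ _ _.
have := @Rintegral_ge0 _ _ _ mu setT (fun z => (f z - m) ^+ 2)
  (fun z _ => sqr_ge0 _).
have -> : \int[mu]_z ((f z - m) ^+ 2) =
    \int[mu]_z (0 * f z + 1 * f z ^+ 2 + (- (2 * m)) * f z + m ^+ 2 * cst 1 z).
  by apply: eq_Rintegral => z _; rewrite /=; ring.
rewrite Rintegral_comb4//; [|exact: ess_bounded_cst|exact: ess_boundedX].
rewrite Rintegral_cst//= probability_setT /= -/m => h.
rewrite -subr_ge0; congr (_ <= _) : h; ring.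
Qed.

Variables (e : nat -> L2 R d) (N : nat).
Hypothesis be : forall i, ess_bounded mu (e i).
Hypothesis onb : is_onb e.
Local Notation eN := (fun i : 'I_N => (e i : 'rV[R]_d -> R)).
Local Notation Q := (galerkin_potential mu eN c0 c1 c2 c3).

Lemma ip_synthesis (u : L2 R d) (c : 'I_N -> R) :
  u = synthesis eN c %[ae mu] ->
  (forall i : 'I_N, ip u (e i) = c i) /\
  (forall i, (N <= i)%N -> ip u (e i) = 0).
Proof.
move=> uc.
have ipE i : ip u (e i) = \sum_(j < N) c j * (j == i :> nat)%:R.
  rewrite (ip_ae (g := (\sum_(j < N) c j *: e j : L2 R d)) _ (measurable_L2 u)).
  - by rewrite ip_suml; apply: eq_bigr => j _; rewrite ipZl onb.1.
  - exact: measurable_L2.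
  - by apply: filterS uc => z + ?; move=> -> //; rewrite L2_sumE.
split=> i; rewrite ?ipE.
  rewrite (bigD1 i)//= eqxx mulr1 big1 ?addr0// => j ji.
  by rewrite (_ : (_ == _ :> nat) = false) ?mulr0//; exact/negbTE.
move=> Ni; rewrite big1// => j _.
by rewrite ltn_eqF ?mulr0// (leq_trans (ltn_ord j)).
Qed.

(** A bounded element of L^2 is also an element of L^4, where the potential is
    known. *)
Lemma potential_synthesis (u : L2 R d) (c : 'I_N -> R) :
  u = synthesis eN c %[ae mu] -> F u = F (0 : L4 R d) + Q c.
Proof.
move=> uc; have bs := ess_bounded_synthesis (fun i : 'I_N => be i) c.
have uc' : {ae mu, forall z, u z = synthesis eN c z}.
  by apply: filterS uc => z; apply.
have bu := ess_bounded_ae (measurable_L2 u) uc' bs.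
have uL4 : (u : 'rV[R]_d -> R) \in Lfun mu 4%:R%:E by exact: ess_bounded_Lfun.
pose u4 : L4 R d := Lfun_Sub (lee1n 4) uL4.
have /= -> := potential_ess_bounded (u := u4) bu.
rewrite -galerkin_potentialE//; congr (_ + _).
have mG (g : 'rV[R]_d -> R) : measurable_fun setT g ->
    measurable_fun setT (fun z => cubic_primitive c0 c1 c2 c3 (g z)).
  move=> mg; rewrite /cubic_primitive.
  by apply: measurable_funD; [apply: measurable_funD;
    [apply: measurable_funD|]|]; apply: measurable_funM => //;
    exact: measurable_funX.
apply: ae_eq_Rintegral.
- by apply: mG; exact: measurable_L2.
- by apply: mG; case: bs.
- by apply: filterS uc' => z ->.
Qed.

Variables (a1 b1 : R).
Hypothesis a1_gt0 : 0 < a1.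
Hypothesis F_lb : forall u : L4 R d, a1 * normL 4 u ^+ 4 - b1 <= F u.

(** On a probability space |c_i|^4 = |<u, e_i>|^4 <= ||u||_2^4 <= ||u||_4^4, so
    the growth of F in the L^4 norm controls each coordinate. *)
Lemma potential_lower_bound (c : 'I_N -> R) (i : 'I_N) :
  a1 * c i ^+ 4 - b1 <= F (0 : L4 R d) + Q c.
Proof.
pose u : L2 R d := \sum_(j < N) c j *: e j.
have us : u = synthesis eN c :> ('rV[R]_d -> R).
  by apply/funext => z; rewrite L2_sumE.
have uc : u = synthesis eN c %[ae mu] by rewrite us; exact: ae_eq_refl.
have bu : ess_bounded mu u.
  by rewrite us; exact: (ess_bounded_synthesis (fun i : 'I_N => be i) c).
rewrite -(potential_synthesis uc).
have uL4 : (u : 'rV[R]_d -> R) \in Lfun mu 4%:R%:E by exact: ess_bounded_Lfun.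
pose u4 : L4 R d := Lfun_Sub (lee1n 4) uL4.
apply: le_trans (F_lb u4); rewrite lerD2r ler_pM2l//.
rewrite (normL4_pow (u := u4) bu)/=.
have := sqr_Rintegral (ess_boundedX 2 bu).
under [X in _ <= X -> _]eq_Rintegral do rewrite -exprM.
apply: le_trans; rewrite (exprM (c i) 2 2).
rewrite lerXn2r ?nnegrE ?sqr_ge0//.
  by apply: Rintegral_ge0 => z _; exact: sqr_ge0.
have := cauchy_schwarz u (e i); rewrite (ip_synthesis uc).1 onb.1 eqxx mulr1.
by move=> /le_trans; apply; rewrite le_eqVlt; apply/orP; left; apply/eqP;
  apply: eq_Rintegral => z _; rewrite expr2.
Qed.

End potential_facts.

(** * Riemann-Stieltjes sums on uniform grids *)

Section riemann_stieltjes.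
Variable R : realType.
Implicit Types (b h phi D : R -> R).

(** Heine's theorem, with [r] not restricted to the segment. *)
Lemma continuous_unif_segment b (T : R) : continuous b ->
  forall eps : R, 0 < eps -> exists2 delta : R, 0 < delta &
    forall s r, 0 <= s <= T -> `|s - r| < delta -> `|b s - b r| < eps.
Proof.
move=> cb eps eps0.
have : \forall delta \near (0 : R)^'+, `[0, T]%classic `<=`
    (fun s => forall r, `|s - r| < delta -> `|b s - b r| < eps).
  apply: (compact_near_coveringP _).1; first exact: segment_compact.
  move=> s _.
  have e20 : 0 < eps / 2 by rewrite divr_gt0.
  have /cvgrPdist_lt/(_ _ e20)/nbhs_ballP[del /= del0 hdel] := cb s.
  have d20 : 0 < del / 2 by rewrite divr_gt0.
  exists (ball s (del / 2), [set delta | delta < del / 2]).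
    by split; [exact: nbhsx_ballx|exact: nbhs_right_lt].
  move=> [s' delta] /= [ss' delta2] r s'r.
  have bs' : `|b s - b s'| < eps / 2.
    by apply: hdel; apply: le_ball ss'; rewrite ler_pdivrMr// ler_pMr// ler1n.
  have br : `|b s - b r| < eps / 2.
    apply: hdel; rewrite /ball/= (le_lt_trans (ler_distD s' _ _))//.
    by rewrite [ltRHS]splitr ltrD// (lt_trans s'r).
  rewrite (le_lt_trans (ler_distD (b s) _ _))// [ltRHS]splitr ltrD//.
  by rewrite distrC.
move=> H; near (0 : R)^'+ => delta; exists delta => // s r sT.
suff: `[0, T]%classic `<=`
    (fun s => forall r, `|s - r| < delta -> `|b s - b r| < eps).
  by apply; rewrite /= in_itv.
by near: delta.
Unshelve. all: by end_near. Qed.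

(** The grid cuts [0, T] into n + 1 equal pieces, so it never degenerates. *)
Definition grid (T : R) (n k : nat) : R := T * (k%:R / n.+1%:R).

Lemma grid0 T n : grid T n 0 = 0. Proof. by rewrite /grid mul0r mulr0. Qed.

Lemma gridT T n : grid T n n.+1 = T.
Proof. by rewrite /grid divff// mulr1. Qed.

Lemma grid_ge0 T n k : 0 <= T -> 0 <= grid T n k.
Proof. by move=> T0; rewrite mulr_ge0// divr_ge0. Qed.

Lemma grid_leT T n k : 0 <= T -> (k <= n.+1)%N -> grid T n k <= T.
Proof.
by move=> T0 kn; rewrite ler_piMr// ler_pdivrMr// mul1r ler_nat.
Qed.

Lemma gridB T n k : grid T n k.+1 - grid T n k = T / n.+1%:R.
Proof. by rewrite /grid -mulrBr -mulrBl -natr1 addrAC subrr add0r mul1r. Qed.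

Lemma grid_leS T n k : 0 <= T -> grid T n k <= grid T n k.+1.
Proof. by move=> T0; rewrite -subr_ge0 gridB divr_ge0. Qed.

Lemma grid_step_cvg (T : R) : T / n.+1%:R @[n --> \oo] --> 0.
Proof.
rewrite -[X in _ --> X](mulr0 T); apply: cvgM; first exact: cvg_cst.
exact: cvg_harmonic.
Qed.

(** [D] is a primitive of phi' b.  By the mean value theorem applied to
    D - tag * phi, each increment of [D] differs from the corresponding term of
    the sum by the mesh times K times the oscillation of [b] over one cell.
    The boolean [j] chooses the tag: the left endpoint when it is false, the
    right one when it is true. *)
Lemma riemann_stieltjes_cvg (T K : R) b phi dphi D (j : bool) : 0 <= T ->
  continuous b -> continuous phi -> continuous D ->
  (forall s, s \in `]0, T[ -> is_derive s 1 phi (dphi s)) ->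
  (forall s, s \in `]0, T[ -> is_derive s 1 D (dphi s * b s)) ->
  (forall s, s \in `]0, T[ -> `|dphi s| <= K) ->
  \sum_(k < n.+1) b (grid T n (k + j)) *
    (phi (grid T n k.+1) - phi (grid T n k)) @[n --> \oo] --> D T - D 0.
Proof.
move=> T0 cb cphi cD dphiE dDE dphiK.
have [->|Tn0] := eqVneq T 0.
  rewrite subrr (_ : (fun _ => _) = cst 0); first exact: cvg_cst.
  by apply/funext => n; rewrite big1// => k _; rewrite /grid !mul0r subrr mulr0.
have {Tn0}T0' : 0 < T by rewrite lt0r Tn0.
have K0 : 0 <= K.
  have h : T / 2 \in `]0, T[.
    by rewrite in_itv/= divr_gt0//= ltr_pdivrMr// ltr_pMr// ltr1n.
  exact: le_trans (dphiK _ h).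
apply/cvgrPdist_le => eps eps0.
have e'0 : 0 < eps / (K * T + 1).
  by rewrite divr_gt0// ltr_wpDl// mulr_ge0.
have [del del0 hdel] := continuous_unif_segment T cb e'0.
have /cvgrPdist_lt/(_ _ del0) := grid_step_cvg T.
apply: filterS => n; rewrite sub0r normrN ger0_norm ?divr_ge0// => ndel.
have -> : D T - D 0 = \sum_(k < n.+1) (D (grid T n k.+1) - D (grid T n k)).
  rewrite -(big_mkord xpredT (fun k => D (grid T n k.+1) - D (grid T n k))).
  by rewrite telescope_sumr// gridT grid0.
rewrite -sumrB (le_trans (ler_norm_sum _ _ _))//.
apply: (@le_trans _ _ (\sum_(k < n.+1) K * (eps / (K * T + 1)) * (T / n.+1%:R))).
  apply: ler_sum => k _; set tag := b _.
  have kle : grid T n k <= grid T n k.+1 by exact: grid_leS.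
  have klt : grid T n k < grid T n k.+1.
    by rewrite -subr_gt0 gridB divr_gt0.
  have sub s : s \in `]grid T n k, grid T n k.+1[ -> s \in `]0, T[.
    rewrite !in_itv/= => /andP[ks sk]; rewrite (le_lt_trans _ ks) ?grid_ge0//=.
    by rewrite (lt_le_trans sk)// grid_leT.
  have dg s : s \in `]grid T n k, grid T n k.+1[ ->
      is_derive s 1 (fun s => D s - tag * phi s) (dphi s * b s - tag * dphi s).
    move=> /sub sT; apply: is_derive1B; first exact: dDE.
    exact/is_derive1Z/dphiE.
  have cg : {within `[grid T n k, grid T n k.+1],
      continuous (fun s => D s - tag * phi s)}.
    apply: continuous_subspaceT => s; apply: cvgB; first exact: cD.
    by apply: cvgM; [exact: cvg_cst|exact: cphi].
  have [s sI] := MVT klt dg cg; rewrite gridB => hs.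
  have -> : D (grid T n k.+1) - D (grid T n k) -
      tag * (phi (grid T n k.+1) - phi (grid T n k)) =
      dphi s * (b s - tag) * (T / n.+1%:R).
    rewrite (_ : dphi s * (b s - tag) = dphi s * b s - tag * dphi s); last by ring.
    by rewrite -hs; ring.
  rewrite normrM normrM (ger0_norm (divr_ge0 T0 _))//.
  rewrite ler_wpM2r ?divr_ge0// ler_pM//; first exact/dphiK/sub.
  apply/ltW/hdel; first by have := sub _ sI; rewrite in_itv/= => /andP[/ltW-> /ltW->].
  apply: le_lt_trans ndel; rewrite -(gridB T n k).
  move: sI; rewrite in_itv/= => /andP[/ltW h1 /ltW h2].
  case: (j); rewrite ?addn1 ?addn0.
    by rewrite distrC ger0_norm ?subr_ge0// lerD2l lerN2.
  by rewrite ger0_norm ?subr_ge0// lerD2r.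
rewrite sumr_const card_ord -[X in X <= _]mulr_natr -mulrA divfK//.
rewrite (_ : _ * _ * T = K * T * eps / (K * T + 1)); last by ring.
rewrite ler_pdivrMr; last by rewrite ltr_wpDl// mulr_ge0.
by rewrite mulrDr mulr1 mulrC lerDl ltW.
Qed.

End riemann_stieltjes.

(** * The oscillator with a rough drift *)

Section primitive.
Variable R : realType.
Implicit Types (h : R -> R) (s t : R).
Notation mu := (@lebesgue_measure R).

(** The integral over [0, t], extended by 0 to t < 0; this keeps it continuous on
    the whole line, with derivative [h] on the positive half-line. *)
Definition primitive0 h t := \int[mu]_(s in `[0, t]) h s.

Lemma primitive0_neg h t : t <= 0 -> primitive0 h t = 0.
Proof.
rewrite /primitive0 le_eqVlt => /predU1P[->|t0].
  by rewrite set_itv1 Rintegral_set1.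
by rewrite set_itv_ge ?Rintegral_set0// bnd_simp -ltNge.
Qed.

Lemma primitive0_0 h : primitive0 h 0 = 0.
Proof. exact: primitive0_neg. Qed.

Lemma integrable_segment h t : continuous h ->
  mu.-integrable `[0, t] (EFin \o h).
Proof.
move=> ch; apply: continuous_compact_integrable; first exact: segment_compact.
exact: continuous_subspaceT.
Qed.

Lemma is_derive_primitive0 h t : continuous h -> 0 < t ->
  is_derive t 1 (primitive0 h) (h t).
Proof.
move=> ch t0; have tt : t < t + 1 by rewrite ltrDl.
have [dh <-] := continuous_FTC1_closed tt (integrable_segment (t + 1) ch) t0 (ch t).
by rewrite derive1E; exact: DeriveDef.
Qed.

Lemma continuous_primitive0 h : continuous h -> continuous (primitive0 h).
Proof.
move=> ch t; have [t0|t0|->] := ltgtP t 0.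
- rewrite /continuous_at primitive0_neg ?ltW//.
  apply: cvg_near_cst; near=> s; apply: primitive0_neg.
  by near: s; exact: lt_le_nbhsl.
- by have [/derivable1_diffP/differentiable_continuous] :=
    is_derive_primitive0 ch t0.
- rewrite /continuous_at primitive0_neg//.
  exact: (parameterized_integral_cvg_left ltr01 (integrable_segment 1 ch)).
Unshelve. all: by end_near. Qed.

End primitive.

(** Variation of constants for x' = z + b, z' = - om^2 x - G, x(0) = x0,
    z(0) = y0.  The functions b and G are merely continuous, so the kernels
    cos(om (t - s)) and sin(om (t - s)) are expanded by the addition formulas:
    t then leaves the integrals, and each term is differentiable. *)
Section oscillator.
Variable R : realType.
Variables (om x0 y0 : R) (b G : R -> R).
Hypotheses (om0 : 0 < om) (cb : continuous b) (cG : continuous G).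
Implicit Types (h : R -> R) (s t : R).

Let Ic h := primitive0 (fun s => cos (om * s) * h s).
Let Is h := primitive0 (fun s => sin (om * s) * h s).

Definition osc_pos t :=
  cos (om * t) * (x0 + Ic b t + Is G t / om) +
  sin (om * t) * (y0 / om + Is b t - Ic G t / om).

Definition osc_vel t :=
  om * cos (om * t) * (y0 / om + Is b t - Ic G t / om) -
  om * sin (om * t) * (x0 + Ic b t + Is G t / om).

Lemma continuous_lin t : {for t, continuous (fun s : R => om * s)}.
Proof. by apply: cvgM; [exact: cvg_cst|exact: cvg_id]. Qed.

Lemma continuous_cosom : continuous (fun s => cos (om * s)).
Proof.
move=> t; apply: (continuous_comp (@continuous_lin t)); exact: continuous_cos.
Qed.

Lemma continuous_sinom : continuous (fun s => sin (om * s)).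
Proof.
move=> t; apply: (continuous_comp (@continuous_lin t)); exact: continuous_sin.
Qed.

Lemma is_derive_cosom t :
  is_derive t 1 (fun s => cos (om * s)) (- om * sin (om * t)).
Proof.
have h := is_derive1_comp (is_derive_cos (om * t))
  (is_derive1Z om (is_derive_id t (1 : R))).
by apply: is_derive_eq; rewrite mulr1 mulNr mulrC mulNr.
Qed.

Lemma is_derive_sinom t :
  is_derive t 1 (fun s => sin (om * s)) (om * cos (om * t)).
Proof.
have h := is_derive1_comp (is_derive_sin (om * t))
  (is_derive1Z om (is_derive_id t (1 : R))).
by apply: is_derive_eq; rewrite mulr1 mulrC.
Qed.

Lemma continuous_cosM h : continuous h ->
  continuous (fun s => cos (om * s) * h s).
Proof. by move=> ch t; apply: cvgM; [exact: continuous_cosom|exact: ch]. Qed.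

Lemma continuous_sinM h : continuous h ->
  continuous (fun s => sin (om * s) * h s).
Proof. by move=> ch t; apply: cvgM; [exact: continuous_sinom|exact: ch]. Qed.

Let cIc h : continuous h -> continuous (Ic h).
Proof. by move=> ch; apply/continuous_primitive0/continuous_cosM. Qed.

Let cIs h : continuous h -> continuous (Is h).
Proof. by move=> ch; apply/continuous_primitive0/continuous_sinM. Qed.

Let cP : continuous (fun t => x0 + Ic b t + Is G t / om).
Proof.
move=> t; apply: cvgD; first by apply: cvgD; [exact: cvg_cst|exact: cIc].
by apply: cvgM; [exact: cIs|exact: cvg_cst].
Qed.

Let cQ : continuous (fun t => y0 / om + Is b t - Ic G t / om).
Proof.
move=> t; apply: cvgB; first by apply: cvgD; [exact: cvg_cst|exact: cIs].
by apply: cvgM; [exact: cIc|exact: cvg_cst].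
Qed.

Lemma continuous_osc_pos : continuous osc_pos.
Proof.
move=> t; apply: cvgD; apply: cvgM; [exact: continuous_cosom|exact: cP|
  exact: continuous_sinom|exact: cQ].
Qed.

Lemma continuous_osc_vel : continuous osc_vel.
Proof.
move=> t; apply: cvgB; apply: cvgM; [|exact: cQ| |exact: cP];
  (apply: cvgM; first exact: cvg_cst).
- exact: continuous_cosom.
- exact: continuous_sinom.
Qed.

Lemma osc_pos0 : osc_pos 0 = x0.
Proof.
by rewrite /osc_pos mulr0 cos0 sin0 /Ic /Is !primitive0_0 mul0r !addr0 mul1r
  mul0r addr0.
Qed.

Lemma osc_vel0 : osc_vel 0 = y0.
Proof.
rewrite /osc_vel mulr0 cos0 sin0 /Ic /Is !primitive0_0 mul0r !addr0.
by rewrite subr0 mulr1 mulr0 mul0r subr0 mulrC divfK// gt_eqF.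
Qed.

Lemma is_derive_osc t : 0 < t ->
  is_derive t 1 osc_pos (osc_vel t + b t) /\
  is_derive t 1 osc_vel (- om ^+ 2 * osc_pos t - G t).
Proof.
move=> t0.
have dc h (ch : continuous h) :=
  is_derive_primitive0 (continuous_cosM ch) t0.
have ds h (ch : continuous h) :=
  is_derive_primitive0 (continuous_sinM ch) t0.
have dP : is_derive t 1 (fun t => x0 + Ic b t + Is G t / om)
    (0 + cos (om * t) * b t + om^-1 * (sin (om * t) * G t)).
  have h := is_derive1D (is_derive1D (is_derive_cst x0 t (1 : R)) (dc _ cb))
    (is_derive1Z om^-1 (ds _ cG)).
  by apply: is_derive1_fct h => s; rewrite [om^-1 * _]mulrC.
have dQ : is_derive t 1 (fun t => y0 / om + Is b t - Ic G t / om)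
    (0 + sin (om * t) * b t - om^-1 * (cos (om * t) * G t)).
  have h := is_derive1B (is_derive1D (is_derive_cst (y0 / om) t (1 : R))
    (ds _ cb)) (is_derive1Z om^-1 (dc _ cG)).
  by apply: is_derive1_fct h => s; rewrite [om^-1 * _]mulrC.
have omn0 : om != 0 by rewrite gt_eqF.
have cs : cos (om * t) ^+ 2 = 1 - sin (om * t) ^+ 2.
  by rewrite -(cos2Dsin2 (om * t)) addrK.
split.
  have := is_derive1D (is_derive1M (is_derive_cosom t) dP)
    (is_derive1M (is_derive_sinom t) dQ).
  move=> /(@is_derive_eq _ _ _ _ _ _ _ _); apply.
  rewrite /osc_vel.
  rewrite [LHS](_ : _ = (- om * sin (om * t)) * (x0 + Ic b t + Is G t / om) +
    om * cos (om * t) * (y0 / om + Is b t - Ic G t / om) +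
    (cos (om * t) ^+ 2 + sin (om * t) ^+ 2) * b t); last by field.
  by rewrite cs; ring.
have := is_derive1B (is_derive1M (is_derive1Z om (is_derive_cosom t)) dQ)
  (is_derive1M (is_derive1Z om (is_derive_sinom t)) dP).
move=> /(@is_derive_eq _ _ _ _ _ _ _ _); apply.
rewrite /osc_pos.
rewrite [LHS](_ : _ = - om ^+ 2 * (cos (om * t) * (x0 + Ic b t + Is G t / om) +
    sin (om * t) * (y0 / om + Is b t - Ic G t / om)) -
    (cos (om * t) ^+ 2 + sin (om * t) ^+ 2) * G t); last by field.
by rewrite cs; ring.
Qed.

End oscillator.

(** * Stochastic convolutions along a fixed path *)

Section left_point_sums.
Variable R : realType.

Lemma left_sum_by_parts (phi b : nat -> R) n :
  \sum_(k < n) phi k * (b k.+1 - b k) =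
  phi n * b n - phi 0%N * b 0%N - \sum_(k < n) b k.+1 * (phi k.+1 - phi k).
Proof.
elim: n => [|n IH]; first by rewrite !big_ord0 subrr subr0.
by rewrite !big_ord_recr/= IH; ring.
Qed.

(** Abel summation moves the differences from the rough [b] to the smooth [phi],
    at the cost of moving the tags to the right endpoints. *)
Lemma left_sum_cvg (T K : R) (b phi dphi D : R -> R) : 0 <= T ->
  continuous b -> continuous phi -> continuous D -> b 0 = 0 ->
  (forall s, s \in `]0, T[ -> is_derive s 1 phi (dphi s)) ->
  (forall s, s \in `]0, T[ -> is_derive s 1 D (dphi s * b s)) ->
  (forall s, s \in `]0, T[ -> `|dphi s| <= K) ->
  \sum_(k < n.+1) phi (grid T n k) * (b (grid T n k.+1) - b (grid T n k))
    @[n --> \oo] --> phi T * b T - (D T - D 0).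
Proof.
move=> T0 cb cphi cD b0 dphiE dDE dphiK.
have := riemann_stieltjes_cvg true T0 cb cphi cD dphiE dDE dphiK.
move=> /(cvgB (cvg_cst (phi T * b T))); apply: cvg_trans; apply: near_eq_cvg.
apply: nearW => n; rewrite (left_sum_by_parts (fun k => phi (grid T n k))
  (fun k => b (grid T n k))) gridT grid0 b0 mulr0 subr0.
by congr (_ - _); apply: eq_bigr => k _; rewrite addn1.
Qed.

End left_point_sums.

Section oscillator_forcing.
Variable R : realType.
Variables (om : R) (b G : R -> R).
Hypotheses (om0 : 0 < om) (cb : continuous b) (cG : continuous G).
Notation Ic h := (primitive0 (fun s => cos (om * s) * h s)).
Notation Is h := (primitive0 (fun s => sin (om * s) * h s)).

Lemma sin_om_sub t s : sin (om * (t - s)) =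
  sin (om * t) * cos (om * s) - cos (om * t) * sin (om * s).
Proof. by rewrite mulrBr sinB. Qed.

Lemma cos_om_sub t s : cos (om * (t - s)) =
  cos (om * t) * cos (om * s) + sin (om * t) * sin (om * s).
Proof. by rewrite mulrBr cosB. Qed.

Let Rint_comb (a c t : R) :
  \int[lebesgue_measure]_(s in `[0, t])
    (a * (cos (om * s) * G s) + c * (sin (om * s) * G s)) =
  a * Ic G t + c * Is G t.
Proof.
have iZ (k : R) h : continuous h ->
    lebesgue_measure.-integrable `[0, t] (EFin \o (fun s => k * h s)).
  by move=> ch; apply: integrable_segment => s; apply: cvgM;
    [exact: cvg_cst|exact: ch].
have cc := continuous_cosM (om := om) cG; have cs := continuous_sinM (om := om) cG.
rewrite RintegralD//; [|exact: iZ|exact: iZ].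
by rewrite !RintegralZl//; exact: integrable_segment.
Qed.

Lemma duhamel_pos t :
  \int[lebesgue_measure]_(s in `[0, t]) (sin (om * (t - s)) / om * - G s) =
  (cos (om * t) * Is G t - sin (om * t) * Ic G t) / om.
Proof.
transitivity (- (sin (om * t) / om) * Ic G t + cos (om * t) / om * Is G t).
  rewrite -Rint_comb; apply: eq_Rintegral => s _.
  by rewrite sin_om_sub; ring.
by ring.
Qed.

Lemma duhamel_vel t :
  \int[lebesgue_measure]_(s in `[0, t]) (cos (om * (t - s)) * - G s) =
  - (cos (om * t) * Ic G t + sin (om * t) * Is G t).
Proof.
transitivity (- cos (om * t) * Ic G t + - sin (om * t) * Is G t); last by ring.
rewrite -Rint_comb; apply: eq_Rintegral => s _.
by rewrite cos_om_sub; ring.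
Qed.

Lemma is_derive_shift_om (f : R -> R) (df t s : R) :
  is_derive (om * (t - s)) 1 f df ->
  is_derive s 1 (fun s => f (om * (t - s))) (- om * df).
Proof.
move=> hf.
have h : is_derive s 1 (fun s : R => om * (t - s)) (- om).
  have := is_derive1Z om (is_derive1B (is_derive_cst t s (1 : R))
    (is_derive_id s (1 : R))).
  by move=> /(@is_derive_eq _ _ _ _ _ _ _ _); apply; rewrite sub0r mulrN1.
have := @is_derive1_comp _ f (fun s => om * (t - s)) s df (- om) hf h.
by rewrite mulrC.
Qed.

Lemma continuous_shift_om (f : R -> R) (t : R) : continuous f ->
  continuous (fun s => f (om * (t - s))).
Proof.
move=> cf s; apply: (@continuous_comp _ _ _ (fun s => om * (t - s)) f).
  apply: cvgM; first exact: cvg_cst.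
  by apply: cvgB; [exact: cvg_cst|exact: cvg_id].
exact: cf.
Qed.

Let cIc : continuous (Ic b).
Proof. by apply/continuous_primitive0/continuous_cosM. Qed.

Let cIs : continuous (Is b).
Proof. by apply/continuous_primitive0/continuous_sinM. Qed.

Let dIc (s : R) : 0 < s -> is_derive s 1 (Ic b) (cos (om * s) * b s).
Proof. by apply: is_derive_primitive0; exact: continuous_cosM. Qed.

Let dIs (s : R) : 0 < s -> is_derive s 1 (Is b) (sin (om * s) * b s).
Proof. by apply: is_derive_primitive0; exact: continuous_sinM. Qed.

Let cD (a c : R) : continuous (fun s => a * Ic b s + c * Is b s).
Proof.
by move=> s; apply: cvgD; apply: cvgM; [exact: cvg_cst|exact: cIc|
  exact: cvg_cst|exact: cIs].
Qed.

(** Integrating by parts, the integral of sin(om (t - s)) / om against db is that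
    of cos(om (t - s)) b(s) ds; the boundary terms vanish at s = t because of
    the sine, and at s = 0 because b(0) = 0. *)
Lemma wiener_sum_pos t : 0 <= t -> b 0 = 0 ->
  \sum_(k < n.+1) sin (om * (t - grid t n k)) / om *
    (b (grid t n k.+1) - b (grid t n k)) @[n --> \oo] -->
  cos (om * t) * Ic b t + sin (om * t) * Is b t.
Proof.
move=> t0 b0.
have := @left_sum_cvg _ t 1 b (fun s => sin (om * (t - s)) / om)
  (fun s => - cos (om * (t - s)))
  (fun s => - cos (om * t) * Ic b s + - sin (om * t) * Is b s).
rewrite /= subrr mulr0 sin0 !mul0r !primitive0_0 !mulr0 addr0 subr0 sub0r.
rewrite !mulNr opprD !opprK; apply => //.
- move=> s; apply: cvgM; last exact: cvg_cst.
  by apply: continuous_shift_om; exact: continuous_sin.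
- move=> s _; apply: is_derive_eq.
  by rewrite /GRing.scale/=; field; rewrite gt_eqF.
- move=> s; rewrite in_itv/= => /andP[s0 _].
  have h := is_derive1D (is_derive1Z (- cos (om * t)) (dIc s0))
    (is_derive1Z (- sin (om * t)) (dIs s0)).
  by apply: is_derive_eq; rewrite cos_om_sub; ring.
- by move=> s _; rewrite normrN cos_max.
Qed.

(** Here the cosine contributes the boundary term b(t); it is the part of the
    velocity that z = v - b removes. *)
Lemma wiener_sum_vel t : 0 <= t -> b 0 = 0 ->
  \sum_(k < n.+1) cos (om * (t - grid t n k)) *
    (b (grid t n k.+1) - b (grid t n k)) @[n --> \oo] -->
  b t + om * (cos (om * t) * Is b t - sin (om * t) * Ic b t).
Proof.
move=> t0 b0.
have := @left_sum_cvg _ t om b (fun s => cos (om * (t - s)))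
  (fun s => om * sin (om * (t - s)))
  (fun s => om * sin (om * t) * Ic b s + - (om * cos (om * t)) * Is b s).
rewrite /= subrr mulr0 cos0 mul1r !primitive0_0 !mulr0 addr0 subr0.
rewrite (_ : b t - _ = b t + om * (cos (om * t) * Is b t - sin (om * t) * Ic b t));
  last by ring.
apply => //.
- by apply: continuous_shift_om; exact: continuous_cos.
- move=> s _.
  have := is_derive_shift_om (is_derive_cos (om * (t - s))).
  by move=> h; apply: is_derive_eq; rewrite mulrNN.
- move=> s; rewrite in_itv/= => /andP[s0 _].
  have h := is_derive1D (is_derive1Z (om * sin (om * t)) (dIc s0))
    (is_derive1Z (- (om * cos (om * t))) (dIs s0)).
  by apply: is_derive_eq; rewrite sin_om_sub; ring.
- move=> s _; rewrite normrM gtr0_norm// ler_piMr ?sin_max// ltW//.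
Qed.

End oscillator_forcing.

(** * Energy balance and growth of a driven path *)

(** Abstract form of the Galerkin system along one path: [Phi] is a potential
    with gradient [force], and [b] is a continuous forcing without derivative. *)
Section energy_balance.
Variables (R : realType) (N : nat).
Variables (lam : 'I_N -> R) (Phi : ('I_N -> R) -> R).
Variable force : 'I_N -> ('I_N -> R) -> R.
Hypothesis lam_ge0 : forall i, 0 <= lam i.
Hypothesis is_derive_Phi : forall (x : 'I_N -> R -> R) (dx : 'I_N -> R) (s : R),
  (forall i, is_derive s 1 (x i) (dx i)) ->
  is_derive s 1 (fun t => Phi (x ^~ t)) (\sum_i dx i * force i (x ^~ s)).
Hypothesis continuous_Phi : forall x : 'I_N -> R -> R,
  (forall i, continuous (x i)) -> continuous (fun t => Phi (x ^~ t)).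
Hypothesis continuous_force : forall (x : 'I_N -> R -> R) i,
  (forall i, continuous (x i)) -> continuous (fun t => force i (x ^~ t)).

Definition hamiltonian (x z : 'I_N -> R) : R :=
  \sum_i (2^-1 * (lam i * x i ^+ 2) + 2^-1 * z i ^+ 2) + Phi x.

(** The velocity is z + b: the forcing is absorbed in the first equation, so that
    both unknowns are differentiable. *)
Definition driven_path (x z b : 'I_N -> R -> R) : Prop :=
  [/\ forall i, [/\ continuous (x i), continuous (z i) & continuous (b i)],
      forall i, b i 0 = 0 &
      forall i (t : R), 0 < t ->
        is_derive t 1 (x i) (z i t + b i t) /\
        is_derive t 1 (z i) (- lam i * x i t - force i (x ^~ t))].

Section path.
Variables x z b : 'I_N -> R -> R.
Hypothesis hp : driven_path x z b.
Let cx i : continuous (x i). Proof. by case: hp => /(_ i)[]. Qed.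
Let cz i : continuous (z i). Proof. by case: hp => /(_ i)[]. Qed.
Let cb i : continuous (b i). Proof. by case: hp => /(_ i)[]. Qed.

Let H (t : R) := hamiltonian (x ^~ t) (z ^~ t).

Lemma continuous_hamiltonian : continuous H.
Proof.
move=> t; apply: cvgD; last exact: continuous_Phi.
apply: cvg_sum_ord => i; apply: cvgD; apply: cvgM; try exact: cvg_cst.
  by apply: cvgM; [exact: cvg_cst|apply: cvgM; exact: cx].
by apply: cvgM; exact: cz.
Qed.

(** Without forcing the energy is conserved; the term b in x' = z + b leaves the
    pairing of b with the gradient in x, which is - z'. *)
Lemma is_derive_hamiltonian (t : R) : 0 < t ->
  is_derive t 1 H (\sum_i (lam i * x i t + force i (x ^~ t)) * b i t).
Proof.
move=> t0; have [_ _ ode] := hp.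
have dx i := (ode i t t0).1; have dz i := (ode i t t0).2.
have h := is_derive1D (is_derive1_sum (fun i => is_derive1D
   (is_derive1Z 2^-1 (is_derive1Z (lam i) (is_derive1X 2 (dx i))))
   (is_derive1Z 2^-1 (is_derive1X 2 (dz i)))))
   (is_derive_Phi dx).
apply: (is_derive_eq h).
by rewrite -big_split/=; apply: eq_bigr => i _; rewrite !expr1; field.
Qed.

Lemma bounded_on_segment (h : R -> R) (T : R) : continuous h ->
  exists K, forall s, s \in `]0, T[ -> `|h s| <= K.
Proof.
move=> ch.
have /compact_bounded[K [_ hK]] :
    compact (h @` `[0, T]%classic).
  by apply: continuous_compact; [exact: continuous_subspaceT|exact: segment_compact].
exists (K + 1) => s; rewrite in_itv/= => /andP[s0 sT].
by apply: (hK (K + 1)); [rewrite ltrDl|exists s => //=; rewrite in_itv/= !ltW].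
Qed.

(** Since H' = - sum_i z_i' b_i and each z_i is differentiable, integration by
    parts gives the Riemann-Stieltjes integral of z_i against b_i. *)
Lemma energy_balance t : 0 <= t ->
  \sum_i \sum_(k < n.+1) z i (grid t n k) *
    (b i (grid t n k.+1) - b i (grid t n k)) @[n --> \oo] -->
  \sum_i z i t * b i t + (H t - H 0).
Proof.
move=> t0; have [_ b0 ode] := hp.
pose dz i s := - lam i * x i s - force i (x ^~ s).
have cdz i : continuous (dz i).
  move=> s; apply: cvgB; last exact: continuous_force.
  by apply: cvgM; [exact: cvg_cst|exact: cx].
have cdzb i : continuous (fun s => dz i s * b i s).
  by move=> s; apply: cvgM; [exact: cdz|exact: cb].
pose D i := primitive0 (fun s => dz i s * b i s).
have dD i (s : R) : 0 < s -> is_derive s 1 (D i) (dz i s * b i s).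
  exact: is_derive_primitive0.
have cD i : continuous (D i) by exact: continuous_primitive0.
have HD : H t - H 0 = - \sum_i D i t.
  (* The equation holds for positive times, so t = 0 is separate. *)
  move: t0; rewrite le_eqVlt => /predU1P[<-|t0].
    by rewrite subrr big1 ?oppr0// => i _; exact: primitive0_0.
  have dHD (s : R) : s \in `]0, t[ -> is_derive s 1 (fun s => H s + \sum_i D i s) 0.
    rewrite in_itv/= => /andP[s0 _].
    have h := is_derive1D (is_derive_hamiltonian s0)
      (is_derive1_sum (fun i => dD i s s0)).
    apply: (is_derive_eq h); rewrite -big_split/= big1// => i _.
    by rewrite /dz; ring.
  have cHD : {within `[0, t], continuous (fun s => H s + \sum_i D i s)}.
    apply: continuous_subspaceT => s; apply: cvgD; first exact: continuous_hamiltonian.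
    by apply: cvg_sum_ord => i; exact: cD.
  have [s _] := MVT t0 dHD cHD; rewrite mul0r => /eqP.
  rewrite [\sum_i D i 0]big1 => [|i _]; last exact: primitive0_0.
  by rewrite addr0 addrAC addr_eq0 => /eqP.
rewrite HD -sumrN -big_split/=; apply: cvg_sum_ord => i.
have [K hK] := bounded_on_segment t (cdz i).
rewrite (_ : _ - _ = z i t * b i t - (D i t - D i 0)); last first.
  by rewrite /D primitive0_0 subr0.
apply: (@left_sum_cvg _ t K (b i) (z i) (dz i) (D i)) => // s;
  rewrite in_itv/= => /andP[s0 _].
- by have [] := ode i s s0.
- exact: dD.
Qed.

End path.

Variables A a1 b1 : R.
Hypotheses (A0 : 0 <= A) (a10 : 0 < a1).
Hypothesis force_bound : forall i c,
  `|force i c| <= A * (1 + \sum_j `|c j|) ^+ 3.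
Hypothesis Phi_lower : forall c i, a1 * c i ^+ 4 - b1 <= Phi c.

Lemma hamiltonian_lower c y i : a1 * c i ^+ 4 + 2^-1 * y i ^+ 2 <= hamiltonian c y + b1.
Proof.
rewrite /hamiltonian (bigD1 i)//=.
have h1 := Phi_lower c i.
have q j : 0 <= lam j * c j ^+ 2 by rewrite mulr_ge0// sqr_ge0.
have h2 : 0 <= \sum_(j < N | j != i) (2^-1 * (lam j * c j ^+ 2) + 2^-1 * y j ^+ 2).
  apply: sumr_ge0 => j _; have := q j; have := sqr_ge0 (y j); lra.
have := q i; move: h1 h2; set S := \sum_(j < N | _) _ => h1 h2 h3.
lra.
Qed.

(** In [growth], [rho] is the fourth root of the energy, and
    kap = 1 + 1 / a1 is such that |c_j| <= kap rho for every coordinate. *)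
Definition growth_constant : R :=
  let kap := 1 + a1^-1 in (\sum_i lam i) * kap + A * (1 + N%:R * kap) ^+ 3.

Lemma growth_constant_ge0 : 0 <= growth_constant.
Proof.
have k0 : 0 <= 1 + a1^-1 by rewrite addr_ge0// invr_ge0 ltW.
rewrite addr_ge0// mulr_ge0// ?sumr_ge0// exprn_ge0// addr_ge0//.
by rewrite mulr_ge0.
Qed.

(** The coordinates are of order rho and the force is cubic, so the gradient is of
    order rho^3, one order below the energy. *)
Lemma growth (i : 'I_N) (rho : R) c y : 1 <= rho ->
  hamiltonian c y + b1 + 1 = rho ^+ 4 ->
  `|lam i * c i + force i c| <= growth_constant * rho ^+ 3.
Proof.
move=> rho1 hrho; set kap := 1 + a1^-1.
have rho0 : 0 <= rho by exact: le_trans rho1.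
have kap1 : 1 <= kap by rewrite lerDl invr_ge0 ltW.
have kap0 : 0 <= kap by exact: le_trans kap1.
have ck j : `|c j| <= kap * rho.
  rewrite -(@ler_pXn2r _ 4)// ?nnegrE ?mulr_ge0//.
  rewrite -normrX ger0_norm ?exprn_even_ge0//.
  have h1 : a1 * c j ^+ 4 <= rho ^+ 4.
    have := hamiltonian_lower c y j; have := sqr_ge0 (y j); lra.
  have h2 : c j ^+ 4 <= a1^-1 * rho ^+ 4 by rewrite ler_pdivlMl.
  apply: le_trans h2 _; rewrite exprMn ler_wpM2r ?exprn_ge0//.
  rewrite (@le_trans _ _ kap)//; first by rewrite lerDr.
  by rewrite -[leLHS]expr1 ler_weXn2l.
have r3 : rho <= rho ^+ 3 by rewrite -[leLHS]expr1 ler_weXn2l.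
rewrite (le_trans (ler_normD _ _))// /growth_constant -/kap mulrDl lerD//.
  rewrite normrM (ger0_norm (lam_ge0 i)) -mulrA ler_pM//.
    by rewrite (bigD1 i)//= lerDl sumr_ge0.
  by rewrite (le_trans (ck i))// ler_wpM2l.
rewrite (le_trans (force_bound i c))// -mulrA ler_wpM2l// -exprMn.
rewrite lerXn2r ?nnegrE ?mulr_ge0 ?addr_ge0 ?mulr_ge0 ?sumr_ge0//.
rewrite mulrDl mul1r lerD// -mulrA.
rewrite (le_trans (ler_sum _ (fun j _ => ck j)))//.
by rewrite sumr_const card_ord mulr_natl.
Qed.

(** For E = H + b1 + 1 and rho = E^(1/4), rho' = E' / (4 rho^3) is at most
    C sum_i |b_i|; this is integrated by the mean value theorem.  The offset
    b1 + 1 makes E >= 1, which allows roots and replaces rho(0) by E(0). *)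
Lemma hamiltonian_bound (x z b : 'I_N -> R -> R) (t : R) : (0 < N)%N ->
  driven_path x z b -> 0 <= t ->
  hamiltonian (x ^~ t) (z ^~ t) + b1 + 1 <=
  (hamiltonian (x ^~ 0) (z ^~ 0) + b1 + 1 +
   growth_constant * primitive0 (fun s => \sum_i `|b i s|) t) ^+ 4.
Proof.
move=> N0 hp t0; have cH := continuous_hamiltonian hp.
have dH := is_derive_hamiltonian hp.
pose i0 : 'I_N := Ordinal N0.
pose E s := hamiltonian (x ^~ s) (z ^~ s) + b1 + 1.
have E1 s : 1 <= E s.
  have := hamiltonian_lower (x ^~ s) (z ^~ s) i0.
  have : 0 <= a1 * x i0 s ^+ 4 by rewrite mulr_ge0 ?exprn_even_ge0// ltW.
  have := sqr_ge0 (z i0 s); rewrite /E; lra.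
have E0 s : 0 < E s by exact: lt_le_trans (E1 s).
pose rho s := expR (4^-1 * ln (E s)).
have rho4 s : rho s ^+ 4 = E s.
  by rewrite /rho -expRM_natl mulrA divff// mul1r lnK// posrE.
have rho1 s : 1 <= rho s by rewrite -expR0 ler_expR mulr_ge0// ln_ge0.
have rho0 s : 0 < rho s by rewrite expR_gt0.
pose B (s : R) : R := \sum_i `|b i s|.
have cB : continuous B.
  move=> s; apply: cvg_sum_ord => i; apply: cvg_norm.
  by case: hp => /(_ i)[_ _ cb] _ _; exact: cb.
have cE : continuous E.
  by move=> s; do 2 (apply: cvgD; last exact: cvg_cst); exact: cH.
have dE (s : R) : 0 < s -> is_derive s 1 E
    (\sum_i (lam i * x i s + force i (x ^~ s)) * b i s).
  move=> s0; have h := is_derive1D (is_derive1D (dH s s0)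
    (is_derive_cst b1 s (1 : R))) (is_derive_cst (1 : R) s (1 : R)).
  by apply: (is_derive_eq h); rewrite !addr0.
set C := growth_constant.
have hB : rho t - C * primitive0 B t <= rho 0 - C * primitive0 B 0.
  move: t0; rewrite le_eqVlt => /predU1P[<-//|t0].
  pose dr (s : R) : R := 4^-1 * ((E s)^-1 * (\sum_i (lam i * x i s + force i (x ^~ s)) * b i s)).
  have dF (s : R) : s \in `]0, t[ -> is_derive s 1 (fun s => rho s - C * primitive0 B s)
      (rho s * dr s - C * B s).
    rewrite in_itv/= => /andP[s0 _].
    apply: is_derive1B; last exact/is_derive1Z/is_derive_primitive0.
    have h1 := is_derive1_comp (is_derive1_ln (E0 s)) (dE s s0).
    have h2 := is_derive1Z 4^-1 h1.
    exact: (is_derive1_comp (is_derive_expR _) h2).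
  have cF : {within `[0, t], continuous (fun s => rho s - C * primitive0 B s)}.
    apply: continuous_subspaceT => s; apply: cvgB; last first.
      by apply: cvgM; [exact: cvg_cst|exact: continuous_primitive0].
    apply: (@continuous_comp _ _ _ (fun s => 4^-1 * ln (E s)) expR);
      last exact: continuous_expR.
    apply: cvgM; first exact: cvg_cst.
    by apply: (@continuous_comp _ _ _ E (@ln R)); [exact: cE|exact: continuous_ln].
  have [s sI] := MVT t0 dF cF => hs.
  rewrite -subr_le0 hs; apply: mulr_le0_ge0; last by rewrite subr_ge0 ltW.
  rewrite subr_le0.
  rewrite /dr mulrCA mulrA.
  have sb : \sum_i (lam i * x i s + force i (x ^~ s)) * b i s <=
      C * rho s ^+ 3 * B s.
    rewrite /B mulr_sumr ler_sum// => i _.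
    rewrite (le_trans (ler_norm _))// normrM ler_wpM2r//.
    by apply: growth => //; exact/esym/rho4.
  apply: (@le_trans _ _ (4^-1 * rho s * ((E s)^-1 * (C * rho s ^+ 3 * B s)))).
    have r0 := ltW (rho0 s).
    by rewrite ler_wpM2l ?mulr_ge0// ler_wpM2l// ltW// invr_gt0.
  rewrite -rho4 [leLHS](_ : _ = 4^-1 * (C * B s)); last first.
    by field; rewrite gt_eqF.
  rewrite ler_piMl ?invf_le1 ?ler1n// mulr_ge0 ?growth_constant_ge0//.
  by rewrite sumr_ge0.
move: hB; rewrite primitive0_0 mulr0 subr0 lerBlDr => hB.
have hR : rho t <= E 0 + C * primitive0 B t.
  apply: le_trans hB _; rewrite lerD2r -(rho4 0) -[leLHS]expr1.
  by rewrite ler_weXn2l.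
rewrite -/(E t) -/(E 0) -(rho4 t) -/B -/C lerXn2r// nnegrE; first exact: ltW.
exact: le_trans (ltW (rho0 t)) hR.
Qed.

End energy_balance.

(** * Moments of centered Gaussian variables *)

Section gaussian_mgf.
Variable R : realType.
Local Notation mu := (@lebesgue_measure R).

(** The density of [normal_prob] and its Radon-Nikodym derivative agree almost
    everywhere. *)
Lemma ge0_integral_normal_prob (m s : R) (f : R -> \bar R) :
  measurable_fun setT f -> (forall x, 0 <= f x)%E ->
  (\int[normal_prob m s]_x f x = \int[mu]_x (f x * (normal_pdf m s x)%:E))%E.
Proof.
move=> mf f0; have dom := normal_prob_dominates m s.
rewrite -(Radon_Nikodym_SigmaFinite.change_of_variables dom)//.
apply: ae_eq_integral => //.
- apply: emeasurable_funM => //.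
  exact: (measurable_int _ (Radon_Nikodym_SigmaFinite.f_integrable dom)).
- apply: emeasurable_funM => //; apply/measurable_EFinP.
  exact: measurable_normal_pdf.
- apply: ae_eqe_mul2l; apply: integral_ae_eq => //.
  + exact: Radon_Nikodym_SigmaFinite.f_integrable.
  + by apply/measurable_EFinP; exact: measurable_normal_pdf.
  + by move=> E _ mE; rewrite -Radon_Nikodym_SigmaFinite.f_integral.
Qed.

(** Completing the square in the exponent. *)
Lemma normal_pdf_tilt (s a x : R) : s != 0 ->
  expR (a * x) * normal_pdf 0 s x =
  expR (2^-1 * (a ^+ 2 * s ^+ 2)) * normal_pdf (a * s ^+ 2) s x.
Proof.
move=> s0; rewrite !normal_pdfE// /normal_fun ![expR _ * (_ * _)]mulrCA.
rewrite -!expRD; congr (_ * expR _).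
by rewrite -mulr_natl; field.
Qed.

Lemma measurable_expRM (a : R) : measurable_fun setT (fun x : R => expR (a * x)).
Proof. exact: (measurableT_comp (@measurable_expR R) (mulrl_measurable a)). Qed.

Lemma normal_mgf (s a : R) : s != 0 ->
  (\int[normal_prob 0 s]_x (expR (a * x))%:E =
   (expR (2^-1 * (a ^+ 2 * s ^+ 2)))%:E)%E.
Proof.
move=> s0; rewrite ge0_integral_normal_prob; last 2 first.
- by apply/measurable_EFinP; exact: measurable_expRM.
- by move=> x; rewrite lee_fin expR_ge0.
under eq_integral do rewrite -EFinM normal_pdf_tilt// EFinM.
rewrite ge0_integralZl//.
- by rewrite integral_normal_pdf mule1.
- by apply/measurable_EFinP; exact: measurable_normal_pdf.
- by move=> x _; rewrite lee_fin normal_pdf_ge0.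
Qed.

End gaussian_mgf.

(** The moments of a Gaussian variable Y are read off E exp(a Y) as a tends to 0.
    The inequalities below compare 2 cosh with its Taylor polynomials; they make
    these limits explicit, with errors that are integrable. *)
Section cosh_inequalities.
Variable R : realType.
Implicit Types (y a : R).

Lemma nonneg_of_derive (f df : R -> R) :
  (forall s : R, is_derive s 1 f (df s)) -> (forall s, 0 <= s -> 0 <= df s) ->
  0 <= f 0 -> forall y, 0 <= y -> 0 <= f y.
Proof.
move=> fE df0 f0 y; rewrite le_eqVlt => /predU1P[<-//|y0].
have cf : {within `[0, y], continuous f}.
  apply: continuous_subspaceT => s.
  by apply/differentiable_continuous/derivable1_diffP; have [] := fE s.
have [s + hs] := MVT y0 (fun s _ => fE s) cf.
rewrite in_itv/= => /andP[/ltW s0 _].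
rewrite -(subrK (f 0) (f y)) hs addr_ge0// mulr_ge0 ?df0// subr0 ltW//.
Qed.

(** Twice the hyperbolic cosine and sine, which avoids halves. *)
Definition dcosh y : R := expR y + expR (- y).
Definition dsinh y : R := expR y - expR (- y).

Lemma dcosh_ge0 y : 0 <= dcosh y.
Proof. by rewrite addr_ge0// expR_ge0. Qed.

Lemma dcoshN y : dcosh (- y) = dcosh y.
Proof. by rewrite /dcosh opprK addrC. Qed.

Lemma is_derive_expRN y : is_derive y 1 (fun s => expR (- s)) (- expR (- y)).
Proof.
have h := is_derive1_comp (is_derive_expR (- y)) (is_deriveN (is_derive_id y (1:R))).
by apply: is_derive_eq; rewrite mulrN1.
Qed.

Lemma is_derive_dcosh y : is_derive y 1 dcosh (dsinh y).
Proof. exact: is_derive1D (is_derive_expR y) (is_derive_expRN y). Qed.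

Lemma is_derive_dsinh y : is_derive y 1 dsinh (dcosh y).
Proof.
have h := is_derive1B (is_derive_expR y) (is_derive_expRN y).
by apply: (is_derive_eq h); rewrite opprK.
Qed.

Lemma dcosh0 : dcosh 0 = 2. Proof. by rewrite /dcosh oppr0 expR0. Qed.
Lemma dsinh0 : dsinh 0 = 0. Proof. by rewrite /dsinh oppr0 subrr. Qed.

Lemma dcosh_ge2 y : 2 <= dcosh y.
Proof.
have -> : dcosh y = (expR (2^-1 * y) - expR (- (2^-1 * y))) ^+ 2 + 2.
  rewrite sqrrB -!expRM_natl -expRD subrr expR0 mulrN !mulVKf// /dcosh.
  by ring.
by rewrite lerDr sqr_ge0.
Qed.

Let idd y : is_derive y 1 (fun s : R => s) 1. Proof. exact: is_derive_id. Qed.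

Lemma dsinh_ge y : 0 <= y -> 2 * y <= dsinh y.
Proof.
move=> y0; rewrite -subr_ge0.
apply: (nonneg_of_derive (f := fun s => dsinh s - 2 * s)
  (df := fun s => dcosh s - 2 * 1)) y0 => [s|s _|].
- exact: is_derive1B (is_derive_dsinh s) (is_derive1Z 2 (idd s)).
- by rewrite mulr1 subr_ge0 dcosh_ge2.
- by rewrite dsinh0 mulr0 subr0.
Qed.

Let dcosh_lower_pos y : 0 <= y -> 2 + y ^+ 2 <= dcosh y.
Proof.
move=> y0; rewrite -subr_ge0.
apply: (nonneg_of_derive (f := fun s => dcosh s - (2 + s ^+ 2))
  (df := fun s => dsinh s - 2 * s)) y0 => [s|s s0|].
- have h := is_derive1B (is_derive_dcosh s)
    (is_derive1D (is_derive_cst (2 : R) s (1 : R)) (is_derive1X 2 (idd s))).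
  by apply: (is_derive_eq h); rewrite add0r mulr1 expr1.
- by rewrite subr_ge0 dsinh_ge.
- by rewrite dcosh0 expr0n/= addr0 subrr.
Qed.

Let dsinh_upper1 y : 0 <= y -> dsinh y <= y * dcosh y.
Proof.
move=> y0; rewrite -subr_ge0.
apply: (nonneg_of_derive (f := fun s => s * dcosh s - dsinh s)
  (df := fun s => s * dsinh s)) y0 => [s|s s0|].
- have h := is_derive1B (is_derive1M (idd s) (is_derive_dcosh s)) (is_derive_dsinh s).
  by apply: (is_derive_eq h); ring.
- by rewrite mulr_ge0// (le_trans _ (dsinh_ge s0))// mulr_ge0.
- by rewrite mul0r dsinh0 subrr.
Qed.

Let dcosh_upper2 y : 0 <= y -> dcosh y - 2 <= y ^+ 2 * dcosh y.
Proof.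
move=> y0; apply: (@le_trans _ _ (y * dsinh y)); last first.
  by rewrite expr2 -mulrA ler_wpM2l// dsinh_upper1.
rewrite -subr_ge0.
apply: (nonneg_of_derive (f := fun s => s * dsinh s - (dcosh s - 2))
  (df := fun s => s * dcosh s)) y0 => [s|s s0|].
- have h := is_derive1B (is_derive1M (idd s) (is_derive_dsinh s))
    (is_derive1B (is_derive_dcosh s) (is_derive_cst (2 : R) s (1 : R))).
  by apply: (is_derive_eq h); ring.
- by rewrite mulr_ge0// dcosh_ge0.
- by rewrite mul0r dcosh0 subrr subrr.
Qed.

Let dsinh_upper3 y : 0 <= y -> dsinh y - 2 * y <= y ^+ 3 * dcosh y.
Proof.
move=> y0; rewrite -subr_ge0.
apply: (nonneg_of_derive (f := fun s => s ^+ 3 * dcosh s - (dsinh s - 2 * s))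
  (df := fun s => 3 * s ^+ 2 * dcosh s + s ^+ 3 * dsinh s - (dcosh s - 2)))
  y0 => [s|s s0|].
- have h := is_derive1B (is_derive1M (is_derive1X 3 (idd s)) (is_derive_dcosh s))
    (is_derive1B (is_derive_dsinh s) (is_derive1Z 2 (idd s))).
  by apply: (is_derive_eq h); rewrite /=; ring.
- have h1 := dcosh_upper2 s0.
  have h2 : 0 <= s ^+ 3 * dsinh s.
    by rewrite mulr_ge0 ?exprn_ge0// (le_trans _ (dsinh_ge s0))// mulr_ge0.
  have h3 : 0 <= s ^+ 2 * dcosh s by rewrite mulr_ge0 ?sqr_ge0// dcosh_ge0.
  lra.
- by rewrite expr0n/= mul0r dsinh0 mulr0 !subrr.
Qed.

Let dcosh_upper_pos y : 0 <= y -> dcosh y <= 2 + y ^+ 2 + y ^+ 4 * dcosh y.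
Proof.
move=> y0; rewrite -subr_ge0.
apply: (nonneg_of_derive (f := fun s => 2 + s ^+ 2 + s ^+ 4 * dcosh s - dcosh s)
  (df := fun s => 2 * s + (4 * s ^+ 3 * dcosh s + s ^+ 4 * dsinh s) - dsinh s))
  y0 => [s|s s0|].
- have h := is_derive1B (is_derive1D (is_derive1D (is_derive_cst (2 : R) s (1 : R))
    (is_derive1X 2 (idd s))) (is_derive1M (is_derive1X 4 (idd s)) (is_derive_dcosh s)))
    (is_derive_dcosh s).
  by apply: (is_derive_eq h); rewrite /=; ring.
- have h1 := dsinh_upper3 s0.
  have h2 : 0 <= s ^+ 4 * dsinh s.
    by rewrite mulr_ge0 ?exprn_ge0// (le_trans _ (dsinh_ge s0))// mulr_ge0.
  have h3 : 0 <= s ^+ 3 * dcosh s by rewrite mulr_ge0 ?exprn_ge0// dcosh_ge0.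
  lra.
- by rewrite !expr0n/= mul0r dcosh0 !addr0 subrr.
Qed.

Lemma dcosh_lower y : 2 + y ^+ 2 <= dcosh y.
Proof.
have [y0|y0] := leP 0 y; first exact: dcosh_lower_pos.
by rewrite -dcoshN -sqrrN dcosh_lower_pos// oppr_ge0 ltW.
Qed.

(** Taylor's formula with remainder, obtained by four successive comparisons of
    derivatives. *)
Lemma dcosh_upper y : dcosh y <= 2 + y ^+ 2 + y ^+ 4 * dcosh y.
Proof.
have [y0|y0] := leP 0 y; first exact: dcosh_upper_pos.
have : 0 <= - y by rewrite oppr_ge0 ltW.
by move=> /dcosh_upper_pos; rewrite dcoshN sqrrN (_ : (- y) ^+ 4 = y ^+ 4)//; ring.
Qed.

Lemma pow4_le_dcosh y : y ^+ 4 <= 24 * dcosh y.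
Proof.
have h s : 0 <= s -> s ^+ 4 <= 24 * dcosh s.
  move=> s0; have := expR_ge1Dxn 3 s0; rewrite (_ : 4`! = 24)%N// => h.
  have := expR_ge0 (- s); have := h; rewrite /dcosh; lra.
have [y0|y0] := leP 0 y; first exact: h.
have : 0 <= - y by rewrite oppr_ge0 ltW.
by move=> /h; rewrite dcoshN (_ : (- y) ^+ 4 = y ^+ 4)//; ring.
Qed.

Lemma dcosh_mono a y : `|a| <= 1 -> dcosh (a * y) <= 2 * dcosh y.
Proof.
move=> a1.
have h s : `|s| <= `|y| -> expR s <= dcosh y.
  move=> sy; have sy' : s <= `|y| by exact: le_trans (ler_norm _) sy.
  apply: (@le_trans _ _ (expR `|y|)); first by rewrite ler_expR.
  rewrite /dcosh; case: ger0P => _; first by rewrite lerDl expR_ge0.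
  by rewrite lerDr expR_ge0.
have ay : `|a * y| <= `|y| by rewrite normrM ler_piMl.
by rewrite {1}/dcosh mulr_natl mulr2n lerD// h// ?normrN.
Qed.

Lemma expR_sub1_le y : expR y - 1 <= y * expR y.
Proof.
have := ler_wpM2r (expR_ge0 y) (expR_ge1Dx (- y)).
rewrite -expRD addNr expR0 mulrDl mul1r mulNr; lra.
Qed.

End cosh_inequalities.

(** The degenerate law (v = 0) and the density case only differ in the proof of
    [gaussian_mgf]; everything else follows from that formula. *)
Section gaussian_moments.
Context d (Omega : measurableType d) (R : realType) (P : probability Omega R).
Variables (Y : Omega -> R) (v : R).
Hypotheses (mY : measurable_fun setT Y) (v0 : 0 <= v).
Hypothesis Ylaw : forall B : set (measurableTypeR R), measurable B ->
  P [set w | B (Y w)] = centered_gaussian v B.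

Lemma gaussian_mgf (a : R) :
  (\int[P]_w (expR (a * Y w))%:E = (expR (2^-1 * (a ^+ 2 * v)))%:E)%E.
Proof.
pose f (x : measurableTypeR R) := (expR (a * x))%:E.
have mf : measurable_fun setT f.
  by apply/measurable_EFinP; exact: measurable_expRM.
have f0 x : (0 <= f x)%E by rewrite lee_fin expR_ge0.
transitivity (\int[pushforward P (Y : Omega -> measurableTypeR R)]_x f x)%E.
  by rewrite ge0_integral_pushforward.
have [vE|vn0] := eqVneq v 0.
  rewrite (@eq_measure_integral _ _ _ _ (\d_ (0 : measurableTypeR R))).
    rewrite integral_dirac// diracT mul1e /f mulr0 vE.
    by rewrite !mulr0.
  move=> A mA _; have := Ylaw mA.
  by rewrite /centered_gaussian vE eqxx.
have s0 : Num.sqrt v != 0 by rewrite sqrtr_eq0 -ltNge lt0r vn0.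
rewrite (@eq_measure_integral _ _ _ _ (normal_prob 0 (Num.sqrt v))).
  by rewrite normal_mgf// sqr_sqrtr.
move=> A mA _; have := Ylaw mA.
by rewrite /centered_gaussian (negbTE vn0).
Qed.

Local Notation I f := (P.-integrable setT (EFin \o f)).

Let mexp (a : R) : measurable_fun setT (fun w => expR (a * Y w)).
Proof. exact: (measurableT_comp (measurable_expRM a)). Qed.

Let iexp (a : R) : I (fun w => expR (a * Y w)).
Proof.
apply/integrableP; split; first exact/measurable_EFinP/mexp.
under eq_integral do rewrite /= ger0_norm ?expR_ge0//.
by rewrite gaussian_mgf ltry.
Qed.

Let Eexp (a : R) : \int[P]_w expR (a * Y w) = expR (2^-1 * (a ^+ 2 * v)).
Proof. by rewrite /Rintegral gaussian_mgf. Qed.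

Let idcosh (a : R) : I (fun w => dcosh (a * Y w)).
Proof.
rewrite (_ : EFin \o _ = (EFin \o (fun w => expR (a * Y w))) \+
  (EFin \o (fun w => expR (- a * Y w))))%E.
  by apply: integrableD => //; exact: iexp.
by apply/funext => w; rewrite /dcosh /= mulNr EFinD.
Qed.

Let Edcosh (a : R) : \int[P]_w dcosh (a * Y w) = 2 * expR (2^-1 * (a ^+ 2 * v)).
Proof.
transitivity (\int[P]_w (expR (a * Y w) + expR (- a * Y w))).
  by apply: eq_Rintegral => w _; rewrite mulNr.
rewrite RintegralD//.
by rewrite !Eexp sqrrN; ring.
Qed.

Let le_integrable_R (f g : Omega -> R) : measurable_fun setT f ->
  (forall w, `|f w| <= g w) -> I g -> I f.
Proof.
move=> mf fg; apply: le_integrable => //; first exact/measurable_EFinP.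
by move=> w _ /=; rewrite lee_fin (le_trans (fg w))// ler_norm.
Qed.

Let idc1 : I (fun w => dcosh (Y w)).
Proof. by have := idcosh 1; under eq_fun do rewrite mul1r. Qed.

Let icst (c : R) : I (cst c).
Proof. exact: finite_measure_integrable_cst. Qed.

Let iZ (c : R) f : I f -> I (fun w => c * f w).
Proof. by move=> h; exact: (integrableZl measurableT c h). Qed.

Lemma gaussian_integrable4 : I (fun w => Y w ^+ 4).
Proof.
apply: (@le_integrable_R _ (fun w => 24 * dcosh (Y w))).
- exact: measurable_funX.
- by move=> w; rewrite ger0_norm ?exprn_even_ge0// pow4_le_dcosh.
- exact: iZ.
Qed.

Lemma gaussian_fourth_moment : \int[P]_w (Y w ^+ 4) <= 48 * expR (2^-1 * v).
Proof.
apply: (@le_trans _ _ (\int[P]_w (24 * dcosh (Y w)))).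
  apply: le_Rintegral => //; first exact: gaussian_integrable4.
    exact: iZ.
  by move=> w _; exact: pow4_le_dcosh.
rewrite RintegralZl//; have := Edcosh 1; under eq_Rintegral do rewrite mul1r.
by move=> ->; rewrite expr1n mul1r mulrA -natrM.
Qed.

Lemma gaussian_integrable2 : I (fun w => Y w ^+ 2).
Proof.
apply: (@le_integrable_R _ (fun w => dcosh (Y w))) => //.
- exact: measurable_funX.
- by move=> w; rewrite ger0_norm ?sqr_ge0// (le_trans _ (dcosh_lower _))// lerDr.
Qed.

Lemma gaussian_integrable1 : I Y.
Proof.
apply: (@le_integrable_R _ (fun w => dcosh (Y w))) => // w.
apply: le_trans (dcosh_lower _); have := sqr_ge0 (`|Y w| - 1).
by rewrite sqrrB1 real_normK ?num_real//; have := normr_ge0 (Y w); lra.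
Qed.

Let small_le0 (m C : R) : 0 <= C -> (forall a, 0 < a -> a <= 1 -> m <= a * C) ->
  m <= 0.
Proof.
move=> C0 h; rewrite leNgt; apply/negP => m0.
pose a := Num.min 1 (m / (2 * (C + 1))).
have a0 : 0 < a by rewrite lt_min ltr01 divr_gt0// mulr_gt0// ltr_wpDl.
have a1 : a <= 1 by rewrite ge_min lexx.
have := h a a0 a1.
have : a * (2 * (C + 1)) <= m.
  by rewrite -ler_pdivlMr ?mulr_gt0 ?ltr_wpDl// ge_min lexx orbT.
nra.
Qed.

Let Ecst (c : R) : \int[P]_w c = c.
Proof. by rewrite Rintegral_cst//= probability_setT mulr1. Qed.

Let exp_small (a : R) : 0 <= a -> a <= 1 ->
  expR (2^-1 * (a ^+ 2 * v)) - 1 <= a ^+ 2 * (2^-1 * v * expR (2^-1 * v)).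
Proof.
move=> a0 a1; apply: (le_trans (expR_sub1_le _)).
set E := expR _; rewrite (_ : _ * E = a ^+ 2 * (2^-1 * v * E)); last by ring.
rewrite ler_wpM2l ?sqr_ge0// ler_wpM2l ?mulr_ge0 ?invr_ge0//.
by rewrite ler_expR ler_wpM2l ?invr_ge0// ler_piMl// exprn_ile1.
Qed.

(** From 1 + a Y <= exp(a Y): a E Y <= exp(a^2 v / 2) - 1 = O(a^2), for both signs
    of a. *)
Lemma gaussian_mean : \int[P]_w Y w = 0.
Proof.
set m := Rintegral _ _ _.
have h (a : R) : a * m <= expR (2^-1 * (a ^+ 2 * v)) - 1.
  rewrite -Eexp -RintegralZl//; last exact: gaussian_integrable1.
  rewrite -[X in _ - X]Ecst -RintegralB//; last exact: icst.
  apply: le_Rintegral => //.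
  - exact/iZ/gaussian_integrable1.
  - rewrite (_ : EFin \o _ = (EFin \o (fun w => expR (a * Y w))) \-
      (EFin \o cst 1%R))%E.
      by apply: integrableB.
    by apply/funext => w /=; rewrite EFinB.
  - by move=> w _; rewrite lerBrDl expR_ge1Dx.
have C0 : 0 <= 2^-1 * v * expR (2^-1 * v).
  by rewrite mulr_ge0 ?expR_ge0// mulr_ge0 ?invr_ge0.
have m1 : m <= 0.
  apply: (small_le0 C0) => a a0 a1; rewrite -(ler_pM2l a0).
  apply: (le_trans (h a)); rewrite [leRHS]mulrA -expr2; exact: exp_small (ltW a0) a1.
have m2 : - m <= 0.
  apply: (small_le0 C0) => a a0 a1; rewrite -(ler_pM2l a0).
  have := h (- a); rewrite sqrrN mulNr mulrN => /le_trans; apply.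
  by rewrite [leRHS]mulrA -expr2; exact: exp_small (ltW a0) a1.
by apply/eqP; rewrite eq_le m1/= -oppr_le0.
Qed.

(** From 2 + a^2 Y^2 <= 2 cosh(a Y) <= 2 + a^2 Y^2 + O(a^4), whose middle term has
    mean 2 exp(a^2 v / 2): divide by a^2 and let a tend to 0. *)
Lemma gaussian_variance : \int[P]_w (Y w ^+ 2) = v.
Proof.
set q := Rintegral _ _ _; have iq := gaussian_integrable2.
have iaq (a : R) : I (fun w => 2 + a ^+ 2 * Y w ^+ 2).
  rewrite (_ : EFin \o _ = (EFin \o cst 2%R) \+
      (EFin \o (fun w => (a ^+ 2 * Y w ^+ 2)%R)))%E//.
  by apply: integrableD => //; exact: iZ.
have Eaq (a : R) : \int[P]_w (2 + a ^+ 2 * Y w ^+ 2) = 2 + a ^+ 2 * q.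
  by rewrite RintegralD// ?Ecst ?RintegralZl//; [exact: icst|exact: iZ].
have up (a : R) : 2 + a ^+ 2 * q <= 2 * expR (2^-1 * (a ^+ 2 * v)).
  rewrite -Edcosh -Eaq; apply: le_Rintegral => //.
  by move=> w _; rewrite -exprMn dcosh_lower.
(* For |a| <= 1, Y^4 dcosh(a Y) is at most 24 dcosh(Y) times 2 dcosh(Y), and
   dcosh(Y)^2 = dcosh(2 Y) + 2. *)
have icc : I (fun w => 96 * (dcosh (2 * Y w) + 2)).
  apply: iZ; rewrite (_ : EFin \o _ = (EFin \o (fun w => dcosh (2 * Y w))) \+
    (EFin \o cst 2%R))%E//.
  by apply: integrableD.
have lo (a : R) : 0 <= a -> a <= 1 -> 2 * expR (2^-1 * (a ^+ 2 * v)) <=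
    2 + a ^+ 2 * q + a ^+ 4 * \int[P]_w (96 * (dcosh (2 * Y w) + 2)).
  move=> a0 a1; rewrite -Edcosh -Eaq -RintegralZl// -RintegralD//; last exact: iZ.
  apply: le_Rintegral => //.
    rewrite (_ : EFin \o _ = (EFin \o (fun w => (2 + a ^+ 2 * Y w ^+ 2)%R)) \+
      (EFin \o (fun w => a ^+ 4 * (96 * (dcosh (2 * Y w) + 2)))%R))%E//.
    by apply: integrableD => //; exact: iZ.
  move=> w _; apply: (le_trans (dcosh_upper _)).
  rewrite exprMn lerD2l exprMn -mulrA ler_wpM2l ?exprn_ge0//.
  have an : `|a| <= 1 by rewrite ger0_norm.
  have cc : dcosh (Y w) * dcosh (Y w) = dcosh (2 * Y w) + 2.
    rewrite /dcosh -mulrN !expRM_natl; set E := expR (Y w); set E' := expR (- Y w).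
    have EE : E * E' = 1 by rewrite -expRD subrr expR0.
    rewrite (_ : _ * _ = E ^+ 2 + E' ^+ 2 + 2 * (E * E')); last by ring.
    by rewrite EE mulr1.
  apply: (@le_trans _ _ ((24 * dcosh (Y w)) * (2 * dcosh (Y w)))).
    by rewrite ler_pM ?exprn_even_ge0 ?dcosh_ge0// ?pow4_le_dcosh// dcosh_mono.
  rewrite (_ : _ * _ = 48 * (dcosh (Y w) * dcosh (Y w))); last by ring.
  rewrite cc ler_wpM2r//; last by rewrite ler_nat.
  by rewrite addr_ge0// dcosh_ge0.
set K := Rintegral _ _ _ in lo.
have K0 : 0 <= K.
  by apply: Rintegral_ge0 => w _; rewrite mulr_ge0// addr_ge0// dcosh_ge0.
have C0 : 0 <= v * expR (2^-1 * v) * v.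
  by rewrite !mulr_ge0 ?expR_ge0.
have e1 : expR (2^-1 * v) >= 0 by exact: expR_ge0.
have q1 : q - v <= 0.
  apply: (small_le0 C0) => a a0 a1; have a2 : 0 < a ^+ 2 by rewrite exprn_gt0.
  have := up a; have := expR_sub1_le (2^-1 * (a ^+ 2 * v)).
  set E := expR (2^-1 * (a ^+ 2 * v)) => E1 E2.
  have E3 := exp_small (ltW a0) a1; rewrite -/E in E3.
  have aa : a ^+ 2 <= a by rewrite expr2 ler_piMl// ltW.
  have : a ^+ 2 * q <= a ^+ 2 * (v * E) by lra.
  rewrite ler_pM2l// => qE; rewrite lerBlDl (le_trans qE)//.
  have : v * E <= v * (1 + a ^+ 2 * (2^-1 * v * expR (2^-1 * v))).
    by rewrite ler_wpM2l// -lerBlDl.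
  move/le_trans; apply; rewrite mulrDr mulr1 lerD2l mulrCA.
  have -> : a * (v * expR (2^-1 * v) * v) = a * (v * (v * expR (2^-1 * v))) by ring.
  rewrite ler_pM ?sqr_ge0// ?mulr_ge0// ?invr_ge0//.
  by rewrite ler_wpM2l// ler_wpM2r ?expR_ge0// ler_piMl// invf_le1// ler1n.
have q2 : v - q <= 0.
  apply: (small_le0 K0) => a a0 a1; have a2 : 0 < a ^+ 2 by rewrite exprn_gt0.
  have := lo a (ltW a0) a1; have := expR_ge1Dx (2^-1 * (a ^+ 2 * v)).
  set E := expR (2^-1 * (a ^+ 2 * v)) => E1 E2.
  have : a ^+ 2 * v <= a ^+ 2 * (q + a ^+ 2 * K).
    by rewrite mulrDr mulrA -exprD; lra.
  rewrite ler_pM2l// => /le_trans; rewrite lerBlDl; apply.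
  by rewrite lerD2l ler_wpM2r// expr2 ler_piMl// ltW.
by apply/eqP; rewrite eq_le -subr_le0 q1/= -subr_le0.
Qed.

End gaussian_moments.

(** * Independence and martingale transforms *)

Section independence.
Context d (Omega : measurableType d) (R : realType) (P : probability Omega R).
Implicit Types (X Y f g : Omega -> R) (G : set (set Omega)).
Local Notation I f := (P.-integrable setT (EFin \o f)).

(** The joint law of independent variables is the product of their laws, by
    uniqueness of product measures; then Fubini's theorem applies. *)
Lemma independent_integral X Y :
  measurable_fun setT X -> measurable_fun setT Y ->
  (forall A B : set (measurableTypeR R), measurable A -> measurable B ->
    P (X @^-1` A `&` Y @^-1` B) = (P (X @^-1` A) * P (Y @^-1` B))%E) ->
  I X -> I Y ->
  I (fun w => X w * Y w) /\
  \int[P]_w (X w * Y w) = (\int[P]_w X w) * (\int[P]_w Y w).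
Proof.
move=> mX mY XY iX iY.
have mX' : measurable_fun setT (X : Omega -> measurableTypeR R) := mX.
have mY' : measurable_fun setT (Y : Omega -> measurableTypeR R) := mY.
pose X' : {mfun Omega >-> measurableTypeR R} :=
  HB.pack (X : Omega -> measurableTypeR R) (isMeasurableFun.Build _ _ _ _ _ mX').
pose Y' : {mfun Omega >-> measurableTypeR R} :=
  HB.pack (Y : Omega -> measurableTypeR R) (isMeasurableFun.Build _ _ _ _ _ mY').
pose mu1 := distribution P X'; pose mu2 := distribution P Y'.
have mXY : measurable_fun setT (fun w => (X' w, Y' w)).
  exact: measurable_fun_pair.
pose XY' : {mfun Omega >-> (measurableTypeR R * measurableTypeR R)%type} :=
  HB.pack (fun w => (X' w, Y' w)) (isMeasurableFun.Build _ _ _ _ _ mXY).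
have muE A : measurable A -> distribution P XY' A = (mu1 \x mu2)%E A.
  move=> mA; apply/esym.
  apply: (product_measure_unique (m1 := mu1) (m2 := mu2) (m' := distribution P XY')) => //.
have mmul : measurable_fun setT
    (fun z : measurableTypeR R * measurableTypeR R => (z.1 * z.2 : R)%:E).
  apply/measurable_EFinP; apply: measurable_funM; [exact: measurable_fst|exact: measurable_snd].
have tr (h : R -> \bar R) : measurable_fun setT h -> (forall x, 0 <= h x)%E ->
    (\int[mu1]_x h x = \int[P]_w h (X w))%E * (\int[mu2]_x h x = \int[P]_w h (Y w))%E.
  by move=> mh h0; split; exact: ge0_integral_distribution.
have mabs : measurable_fun setT (fun x : R => `|x%:E|%E).
  by apply: measurableT_comp => //; exact/measurable_EFinP.
have i1 : mu1.-integrable setT (fun x : measurableTypeR R => (x : R)%:E).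
  apply/integrableP; split; first exact/measurable_EFinP.
  by rewrite (tr _ mabs _).1//; case/integrableP : iX.
have i2 : mu2.-integrable setT (fun x : measurableTypeR R => (x : R)%:E).
  apply/integrableP; split; first exact/measurable_EFinP.
  by rewrite (tr _ mabs _).2//; case/integrableP : iY.
have i12 : (mu1 \x mu2)%E.-integrable setT
    (fun z : measurableTypeR R * measurableTypeR R => (z.1 * z.2 : R)%:E).
  apply/integrable12ltyP => //=.
  under eq_integral => x _.
    under eq_integral do rewrite normrM EFinM.
    rewrite ge0_integralZl//; over.
  rewrite ge0_integralZr//.
  - apply: lte_mul_pinfty => //.
    + exact: integral_ge0.
    + by rewrite ge0_fin_numE ?integral_ge0//; case/integrableP : i1.
    + by case/integrableP : i2.
  - exact: integral_ge0.
have iXY : I (fun w => X w * Y w).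
  apply/integrableP; split; first by apply/measurable_EFinP; exact: measurable_funM.
  have [_] := integrableP _ _ _ i12.
  rewrite -(eq_measure_integral _ (fun A mA _ => muE A mA)).
  by rewrite ge0_integral_distribution//; exact: measurableT_comp.
split => //; rewrite /Rintegral.
transitivity (fine (\int[(mu1 \x mu2)%E]_z (z.1 * z.2)%:E)).
  rewrite -(eq_measure_integral _ (fun A mA _ => muE A mA)).
  by rewrite integral_distribution.
rewrite -integral12_prod_meas1// /fubini_F /=.
under eq_integral => x _.
  under eq_integral do rewrite EFinM.
  rewrite integralZl//; over.
rewrite /=.
have E1 : (\int[mu1]_x (x : R)%:E = \int[P]_w (X w)%:E)%E.
  by rewrite (@integral_distribution _ _ _ _ _ P X').
have E2 : (\int[mu2]_x (x : R)%:E = \int[P]_w (Y w)%:E)%E.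
  by rewrite (@integral_distribution _ _ _ _ _ P Y').
have f2 : (\int[mu2]_x (x : R)%:E)%E \is a fin_num by exact: integrable_fin_num.
rewrite -(fineK f2) integralZr// fineM//; last exact: integrable_fin_num.
by rewrite E1 E2.
Qed.

End independence.

Section martingale_transform.
Context d (Omega : measurableType d) (R : realType) (P : probability Omega R).
Implicit Types (X Y f g : Omega -> R) (G : set (set Omega)).
Local Notation I f := (P.-integrable setT (EFin \o f)).

(** The filtration consists of families of sets, not of measurable types, so
    measurability with respect to its members is phrased by preimages. *)
Definition measurable_wrt G f := forall B : set (measurableTypeR R),
  measurable B -> G (f @^-1` B).

Definition sub_sigma_field G := sigma_algebra setT G /\ G `<=` measurable.

Lemma measurable_wrtP G f : sigma_algebra setT G ->
  measurable_wrt G f <->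
  measurable_fun setT (f : g_sigma_algebraType G -> measurableTypeR R).
Proof.
move=> sG; have GE := sigma_algebra_id sG; split => [mf _ B mB|mf B mB].
  by rewrite setTI; apply: sub_sigma_algebra; exact: mf.
by rewrite -GE -[X in <<s G >> X]setTI; exact: mf.
Qed.

Lemma measurable_wrtW G f : sub_sigma_field G -> measurable_wrt G f ->
  measurable_fun setT f.
Proof. by move=> [_ sG] mf _ B mB; rewrite setTI; exact/sG/mf. Qed.

Lemma measurable_wrtS G G' f : G `<=` G' -> measurable_wrt G f ->
  measurable_wrt G' f.
Proof. by move=> GG' mf B mB; exact/GG'/mf. Qed.

Lemma measurable_wrtM G f g : sigma_algebra setT G ->
  measurable_wrt G f -> measurable_wrt G g ->
  measurable_wrt G (fun w => f w * g w).
Proof.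
move=> sG /(measurable_wrtP _ sG) mf /(measurable_wrtP _ sG) mg.
by apply/(measurable_wrtP _ sG); exact: measurable_funM.
Qed.

Lemma measurable_wrtD G f g : sigma_algebra setT G ->
  measurable_wrt G f -> measurable_wrt G g ->
  measurable_wrt G (fun w => f w + g w).
Proof.
move=> sG /(measurable_wrtP _ sG) mf /(measurable_wrtP _ sG) mg.
by apply/(measurable_wrtP _ sG); exact: measurable_funD.
Qed.

Lemma measurable_wrt_cst G (c : R) : sigma_algebra setT G ->
  measurable_wrt G (cst c).
Proof. by move=> sG; apply/(measurable_wrtP _ sG); exact: measurable_cst. Qed.

Definition independent_of G Y := forall A (B : set (measurableTypeR R)),
  G A -> measurable B -> P (A `&` Y @^-1` B) = (P A * P (Y @^-1` B))%E.

Lemma independent_of_integral G X Y : sub_sigma_field G ->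
  measurable_wrt G X -> measurable_fun setT Y -> independent_of G Y ->
  I X -> I Y ->
  I (fun w => X w * Y w) /\
  \int[P]_w (X w * Y w) = (\int[P]_w X w) * (\int[P]_w Y w).
Proof.
move=> sG mX mY GY iX iY; apply: independent_integral => //.
  exact: measurable_wrtW mX.
by move=> A B mA mB; apply: GY => //; exact: mX.
Qed.

Lemma independent_ofX G Y n : independent_of G Y ->
  independent_of G (fun w => Y w ^+ n).
Proof.
move=> GY A B GA mB; apply: (GY A ((fun x : R => x ^+ n) @^-1` B)) => //.
rewrite -[X in measurable X]setTI.
have mX : measurable_fun setT (fun x : R => x ^+ n).
  exact/measurable_funX/measurable_id.
exact: mX.
Qed.

Lemma integrable_dominated f g : measurable_fun setT f ->
  (forall w, `|f w| <= g w) -> I g -> I f.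
Proof.
move=> mf fg; apply: le_integrable => //; first exact/measurable_EFinP.
by move=> w _ /=; rewrite lee_fin (le_trans (fg w))// ler_norm.
Qed.

Lemma integrable_add f g : I f -> I g -> I (fun w => f w + g w).
Proof. by move=> hf hg; exact: (integrableD measurableT hf hg). Qed.

Lemma integrable_scale (c : R) f : I f -> I (fun w => c * f w).
Proof. by move=> h; exact: (integrableZl measurableT c h). Qed.

Lemma integrable_const (c : R) : I (cst c).
Proof. exact: finite_measure_integrable_cst. Qed.

Lemma Rintegral_const (c : R) : \int[P]_w c = c.
Proof. by rewrite Rintegral_cst//= probability_setT mulr1. Qed.

Lemma integrable_L2_mul f g : measurable_fun setT f -> measurable_fun setT g ->
  I (fun w => f w ^+ 2) -> I (fun w => g w ^+ 2) -> I (fun w => f w * g w).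
Proof.
move=> mf mg if2 ig2.
apply: (@integrable_dominated _ (fun w => f w ^+ 2 + g w ^+ 2)).
- exact: measurable_funM.
- move=> w; rewrite ler_norml; have := sqr_ge0 (f w + g w).
  have := sqr_ge0 (f w - g w); rewrite sqrrB sqrrD => h1 h2.
  have := sqr_ge0 (f w); have := sqr_ge0 (g w) => h3 h4.
  by apply/andP; split; lra.
- exact: integrable_add.
Qed.

Lemma integrable_L2_L1 f : measurable_fun setT f ->
  I (fun w => f w ^+ 2) -> I f.
Proof.
move=> mf if2; apply: (@integrable_dominated _ (fun w => cst 1 w + f w ^+ 2)) => //.
  move=> w /=; have := sqr_ge0 (`|f w| - 1); rewrite sqrrB1 real_normK ?num_real//.
  by have := normr_ge0 (f w); lra.
by apply: integrable_add => //; exact: integrable_const.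
Qed.

Variables (n : nat) (G : nat -> set (set Omega)) (z D : nat -> Omega -> R).
Variables (C : R) (q : nat -> R).
Hypothesis sG : forall k, sub_sigma_field (G k).
Hypothesis GS : forall k, G k `<=` G k.+1.
Hypothesis mz : forall k, measurable_wrt (G k) (z k).
Hypothesis mD : forall k, measurable_wrt (G k.+1) (D k).
Hypothesis GD : forall k, independent_of (G k) (D k).
Hypothesis iz : forall k, (k < n)%N -> I (fun w => z k w ^+ 2).
Hypothesis Ez : forall k, (k < n)%N -> \int[P]_w (z k w ^+ 2) <= C.
Hypothesis iD : forall k, I (fun w => D k w ^+ 2).
Hypothesis ED : forall k, \int[P]_w D k w = 0.
Hypothesis ED2 : forall k, \int[P]_w (D k w ^+ 2) = q k.

Let M m w := \sum_(k < m) z k w * D k w.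

Let q_ge0 k : 0 <= q k.
Proof. by rewrite -ED2; apply: Rintegral_ge0 => w _; exact: sqr_ge0. Qed.

(** The mean of M_(k+1) - M_k = z_k D_k factorizes by independence and vanishes.
    In the square of M_k + z_k D_k the cross term 2 M_k z_k D_k vanishes for the
    same reason, and the mean of z_k^2 D_k^2 is at most C q_k. *)
Lemma martingale_transform m : (m <= n)%N ->
  [/\ measurable_wrt (G m) (M m), I (fun w => M m w ^+ 2),
      \int[P]_w M m w = 0 &
      \int[P]_w (M m w ^+ 2) <= C * \sum_(k < m) q k].
Proof.
elim: m => [_|m IH mn].
  have M0 : M 0 = cst 0 by apply/funext => w; rewrite /M big_ord0.
  rewrite M0; split.
  - exact: measurable_wrt_cst (sG 0%N).1.
  - by under eq_fun do rewrite expr0n/=; exact: integrable_const.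
  - exact: Rintegral_const.
  - by rewrite big_ord0 mulr0; under eq_Rintegral do rewrite expr0n/=;
      rewrite Rintegral_const.
have [mM iM2 EM EM2] := IH (ltnW mn).
have sGm := sG m; have mDm := measurable_wrtW (sG m.+1) (mD m).
have mMm := measurable_wrtW sGm mM; have mzm := measurable_wrtW sGm (mz m).
have izm := iz mn; have iD1 := integrable_L2_L1 mDm (iD m).
have mMz := measurable_wrtM sGm.1 mM (mz m).
have [iMzD EMzD] := independent_of_integral sGm mMz mDm (@GD m)
  (integrable_L2_mul mMm mzm iM2 izm) iD1.
have [izD EzD] := independent_of_integral sGm (mz m) mDm (@GD m)
  (integrable_L2_L1 mzm izm) iD1.
have mz2 : measurable_wrt (G m) (fun w => z m w ^+ 2).
  by have := measurable_wrtM sGm.1 (mz m) (mz m).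
have [iz2D2 Ez2D2] := independent_of_integral sGm mz2
  (measurable_funX 2 mDm) (@independent_ofX _ _ 2 (@GD m)) izm (iD m).
have ME w : M m.+1 w = M m w + z m w * D m w by rewrite /M big_ord_recr.
have M2E w : M m.+1 w ^+ 2 =
    M m w ^+ 2 + (2 * (M m w * z m w * D m w) + z m w ^+ 2 * D m w ^+ 2).
  by rewrite ME; ring.
split.
- rewrite (_ : M m.+1 = fun w => M m w + z m w * D m w); last exact/funext.
  apply: measurable_wrtD; first exact: (sG _).1.
    exact: measurable_wrtS mM.
  by apply: measurable_wrtM; [exact: (sG _).1|exact: measurable_wrtS (mz m)|].
- under eq_fun do rewrite M2E.
  by apply: integrable_add => //; apply: integrable_add => //; exact: integrable_scale.
- under eq_Rintegral do rewrite ME.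
  by rewrite RintegralD// ?EM ?EzD ?ED ?mulr0 ?addr0//; exact: integrable_L2_L1.
- under eq_Rintegral do rewrite M2E.
  have i2 := integrable_scale 2 iMzD.
  rewrite RintegralD//; last exact: integrable_add.
  rewrite RintegralD// RintegralZl// EMzD ED mulr0 mulr0 add0r Ez2D2 ED2.
  by rewrite big_ord_recr/= mulrDr lerD// ler_wpM2r// Ez.
Qed.

End martingale_transform.

(** * Almost sure limits of sequences bounded in L^2 *)

Section zero_mean_limit.
Context d (Omega : measurableType d) (R : realType) (P : probability Omega R).
Local Notation I f := (P.-integrable setT (EFin \o f)).

Lemma measurable_limn_einf_EFin (f : nat -> Omega -> R) :
  (forall n, measurable_fun setT (f n)) ->
  measurable_fun setT (fun w => limn_einf (fun n => (f n w)%:E)).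
Proof.
move=> mf; rewrite (_ : (fun _ => _) =
    -%E \o fun w => limn_esup (fun n => (- (f n w)%:E)%E)).
  apply: measurableT_comp => //; apply: measurable_fun_limn_esup => n.
  by apply: measurableT_comp => //; exact/measurable_EFinP.
apply/funext => w /=.
by have := limn_esupN (fun n => (f n w)%:E) => /= ->; rewrite oppeK.
Qed.

Lemma limn_einf_EFin_ge0 (f : nat -> R) : (forall n, 0 <= f n) ->
  (0 <= limn_einf (fun n => (f n)%:E))%E.
Proof.
move=> f0; rewrite limn_einf_lim; apply: lime_ge; first exact: is_cvg_einfs.
apply: nearW => n; apply: le_ereal_inf_tmp => _ [k _ <-].
by rewrite lee_fin.
Qed.

(** Fatou's lemma for real functions whose almost sure limit is only known to
    dominate [g]. *)
Lemma fatou_bound (f : nat -> Omega -> R) (g : Omega -> R) (C : R) :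
  (forall n, measurable_fun setT (f n)) -> measurable_fun setT g ->
  (forall n w, 0 <= f n w) -> (forall w, 0 <= g w) ->
  {ae P, forall w, exists2 l, (f ^~ w) x @[x --> \oo] --> l & g w <= l} ->
  (forall n, (\int[P]_w (f n w)%:E <= C%:E)%E) ->
  (\int[P]_w (g w)%:E <= C%:E)%E.
Proof.
move=> mf mg f0 g0 fg fC.
have mE n : measurable_fun setT (fun w => (f n w)%:E) by exact/measurable_EFinP.
apply: (@le_trans _ _ (\int[P]_w limn_einf (fun n => (f n w)%:E))%E).
  apply: ae_ge0_le_integral => //.
  - by move=> w _; rewrite lee_fin.
  - exact/measurable_EFinP.
  - by move=> w _; apply: limn_einf_EFin_ge0.
  - exact: measurable_limn_einf_EFin.
  - apply: filterS fg => w [l fl gl] _.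
    have -> : limn_einf (fun n => (f n w)%:E) = l%:E.
      have fl' : (fun n => (f n w)%:E) x @[x --> \oo] --> l%:E.
        by apply: cvg_EFin; [exact: nearW|exact: fl].
      by have [] := cvg_limn_einf_sup fl'.
    by rewrite lee_fin.
apply: (le_trans (@fatou _ _ _ P setT measurableT (fun n w => (f n w)%:E) mE
  (fun n w _ => f0 n w))).
rewrite limn_einf_lim; apply: lime_le => //; first exact: is_cvg_einfs.
apply: nearW => n; apply: le_trans (fC n); apply: ereal_inf_lbound.
by exists n => //=.
Qed.

(** By Fatou, the lower limit of (S_n - J)^2 has integral 0, so it vanishes almost
    everywhere. *)
Lemma L2_limit_unique (S : nat -> Omega -> R) (J : Omega -> R) :
  (forall n, measurable_fun setT (S n)) -> measurable_fun setT J ->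
  (forall eps : R, 0 < eps -> \forall n \near \oo,
    (\int[P]_w ((S n w - J w) ^+ 2)%:E <= eps%:E)%E) ->
  {ae P, forall w, forall l, (S ^~ w) x @[x --> \oo] --> l -> l = J w}.
Proof.
move=> mS mJ SJ; pose f n w := (S n w - J w) ^+ 2.
have f0 n w : 0 <= f n w by exact: sqr_ge0.
have mf n : measurable_fun setT (f n).
  by apply: measurable_funX; exact: measurable_funB.
have mE n : measurable_fun setT (fun w => (f n w)%:E) by exact/measurable_EFinP.
have int0 : (\int[P]_w limn_einf (fun n => (f n w)%:E) = 0)%E.
  apply/eqP; rewrite eq_le; apply/andP; split; last first.
    by apply: integral_ge0 => w _; exact: limn_einf_EFin_ge0.
  apply: (le_trans (@fatou _ _ _ P setT measurableT (fun n w => (f n w)%:E) mE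
    (fun n w _ => f0 n w))).
  apply/lee_addgt0Pr => eps eps0; rewrite add0e.
  rewrite limn_einf_lim; apply: lime_le; first exact: is_cvg_einfs.
  apply: filterS (SJ eps eps0) => n; apply: le_trans.
  by apply: ereal_inf_lbound; exists n => //=.
have : ae_eq P setT (fun w => limn_einf (fun n => (f n w)%:E)) (cst 0%E).
  apply/ae_eq_integral_abs => //; first exact: measurable_limn_einf_EFin.
  rewrite -int0; apply: eq_integral => w _.
  by rewrite gee0_abs// limn_einf_EFin_ge0.
apply: filterS => w /(_ Logic.I) lw l Sl.
have fl : (fun n => (f n w)%:E) x @[x --> \oo] --> ((l - J w) ^+ 2)%:E.
  apply: cvg_EFin; first exact: nearW.
  have h : (fun n => S n w - J w) x @[x --> \oo] --> l - J w.
    by apply: cvgB => //; exact: cvg_cst.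
  exact: (cvgM h h).
have [hl _] := cvg_limn_einf_sup fl; move: hl; rewrite lw => -[/esym/eqP].
by rewrite sqrf_eq0 subr_eq0 => /eqP.
Qed.

(** Boundedness in L^2 provides the uniform integrability.  It is exploited
    through the nonnegative variable
    c(X) = sg X + eps X^2 + 1 / (4 eps), sg = +-1: Fatou gives
    E c(L) <= eps C + 1 / (4 eps), that is sg E L <= eps C. *)
Lemma zero_mean_limit (M : nat -> Omega -> R) (L : Omega -> R) (C : R) :
  (forall n, measurable_fun setT (M n)) -> measurable_fun setT L ->
  {ae P, forall w, (M ^~ w) x @[x --> \oo] --> L w} ->
  (forall n, I (fun w => M n w ^+ 2)) ->
  (forall n, \int[P]_w M n w = 0) ->
  (forall n, \int[P]_w (M n w ^+ 2) <= C) ->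
  I L /\ \int[P]_w L w = 0.
Proof.
move=> mM mL ML iM2 EM EM2.
have mL2 : measurable_fun setT (fun w => L w ^+ 2) by exact: measurable_funX.
have iL2 : I (fun w => L w ^+ 2).
  apply/integrableP; split; first exact/measurable_EFinP.
  under eq_integral do rewrite /= ger0_norm ?sqr_ge0//.
  apply: (@le_lt_trans _ _ C%:E); last exact: ltry.
  apply: (@fatou_bound (fun n w => M n w ^+ 2)) => //.
  - by move=> n; exact: measurable_funX.
  - by move=> n w; exact: sqr_ge0.
  - by move=> w; exact: sqr_ge0.
  - apply: filterS ML => w Mw; exists (L w ^+ 2) => //.
    exact: (cvgM Mw Mw).
  - move=> n; have := EM2 n; rewrite -lee_fin /Rintegral fineK//.
    by apply: integrable_fin_num => //; exact: iM2.
have iL : I L by exact: integrable_L2_L1.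
have key (sg eps : R) : sg ^+ 2 = 1 -> 0 < eps ->
    sg * \int[P]_w L w <= eps * C.
  move=> sg1 e0.
  pose c (X : Omega -> R) w := sg * X w + (eps * X w ^+ 2 + (4 * eps)^-1).
  have c0 X w : 0 <= c X w.
    rewrite (_ : c X w = eps * (X w + sg / (2 * eps)) ^+ 2).
      by rewrite mulr_ge0 ?sqr_ge0// ltW.
    rewrite /c (_ : (4 * eps)^-1 = sg ^+ 2 / (4 * eps)); last by rewrite sg1 mul1r.
    by field; rewrite gt_eqF.
  have mc X : measurable_fun setT X -> measurable_fun setT (c X).
    move=> mX; apply: measurable_funD; first exact: measurable_funM.
    by apply: measurable_funD => //; apply: measurable_funM => //; exact: measurable_funX.
  have ic X : I X -> I (fun w => X w ^+ 2) -> I (c X).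
    move=> iX iX2; apply: integrable_add; first exact: integrable_scale.
    by apply: integrable_add; [exact: integrable_scale|exact: integrable_const].
  have Ec X : I X -> I (fun w => X w ^+ 2) -> \int[P]_w c X w =
      sg * (\int[P]_w X w) + (eps * (\int[P]_w (X w ^+ 2)) + (4 * eps)^-1).
    move=> iX iX2.
    have i1 := integrable_scale sg iX; have i2 := integrable_scale eps iX2.
    have i3 := integrable_const P (4 * eps)^-1.
    rewrite RintegralD//; last exact: integrable_add.
    by rewrite RintegralD// !RintegralZl// Rintegral_const.
  have : (\int[P]_w (c L w)%:E <= (eps * C + (4 * eps)^-1)%:E)%E.
    apply: (@fatou_bound (fun n => c (M n))) => //.
    - by move=> n; exact: mc.
    - exact: mc.
    - apply: filterS ML => w Mw; exists (c L w) => //.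
      apply: cvgD; first by apply: cvgM => //; exact: cvg_cst.
      apply: cvgD; last exact: cvg_cst.
      by apply: cvgM; [exact: cvg_cst|exact: (cvgM Mw Mw)].
    - move=> n; have iMn : I (M n) by exact: integrable_L2_L1.
      have := Ec _ iMn (iM2 n); rewrite EM mulr0 add0r /Rintegral => En.
      rewrite -(@fineK _ (\int[P]_w (c (M n) w)%:E)%E); last first.
        by apply: integrable_fin_num => //; exact: ic.
      by rewrite lee_fin En lerD2r ler_wpM2l ?EM2// ltW.
  rewrite -(@fineK _ (\int[P]_w (c L w)%:E)%E); last first.
    by apply: integrable_fin_num => //; exact: ic.
  have EL := Ec L iL iL2; rewrite {1}/Rintegral in EL; rewrite lee_fin EL.
  have : 0 <= eps * \int[P]_w (L w ^+ 2).
    by rewrite mulr_ge0 ?(ltW e0)//; apply: Rintegral_ge0 => w _; exact: sqr_ge0.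
  lra.
split=> //; set m := Rintegral _ _ _ in key *.
have C0 : 0 <= C.
  by apply: le_trans (EM2 0%N); apply: Rintegral_ge0 => w _; exact: sqr_ge0.
have small (r : R) : (forall eps, 0 < eps -> r <= eps * C) -> r <= 0.
  move=> h; apply/ler_addgt0Pr => del del0; rewrite add0r.
  have C1 : 0 < C + 1 by rewrite ltr_wpDl.
  apply: (le_trans (h (del / (C + 1)) _)); first by rewrite divr_gt0.
  by rewrite mulrAC ler_pdivrMr// ler_wpM2l ?lerDl// ltW.
apply/eqP; rewrite eq_le; apply/andP; split.
  by apply: small => eps e0; rewrite -[m]mul1r; apply: key => //; rewrite expr1n.
rewrite -oppr_le0; apply: small => eps e0; rewrite -mulN1r; apply: key => //.
by rewrite sqrrN expr1n.
Qed.

End zero_mean_limit.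

(** * Scalar coordinates of the Wiener process *)

(** Monotonicity without measurability, from the definition of the integral as a
    supremum over simple functions: the squared L^2 norms in the definition of
    the stochastic integral come without a measurability proof. *)
Lemma ge0_le_integralW d (T : measurableType d) (R : realType)
    (mu : {measure set T -> \bar R}) (f g : T -> \bar R) :
  (forall x, 0 <= f x)%E -> (forall x, f x <= g x)%E ->
  (\int[mu]_x f x <= \int[mu]_x g x)%E.
Proof.
move=> f0 fg; have g0 x : (0 <= g x)%E by exact: le_trans (fg x).
rewrite !ge0_integralTE//; apply: le_ereal_sup => _ [h hf <-].
by exists h => // x; exact: le_trans (hf x) (fg x).
Qed.

Section L2_random_variables.
Variables (R : realType) (d : nat).
Variables (dO : measure_display) (Omega : measurableType dO).
Variables (P : probability Omega R).
Local Notation mu := (cube_measure R d).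
Implicit Types (xi : Omega -> L2 R d) (G : set (set Omega)) (h x : L2 R d).

Lemma sigma_algebra_sigma_of xi : sigma_algebra setT (sigma_of xi).
Proof. exact: smallest_sigma_algebra. Qed.

Lemma measurable_wrt_normL xi G x : sigma_algebra setT G ->
  sigma_of xi `<=` G ->
  measurable_wrt G (fun w => normL 2 (xi w - x : L2 R d)).
Proof.
move=> sG xiG; apply/measurable_wrtP => //.
move=> mT; apply: (measurability _ (RGenInftyO.measurableE R)) => //.
move=> _ [_ [r ->] <-]; rewrite setTI; apply: sub_sigma_algebra.
apply: xiG; apply: sub_sigma_algebra; exists x, r.
by apply/seteqP; split => w /=; rewrite in_itv.
Qed.

Lemma measurable_wrt_scale G (f : Omega -> R) (c : R) : sigma_algebra setT G ->
  measurable_wrt G f -> measurable_wrt G (fun w => c * f w).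
Proof.
by move=> sG mf; apply: measurable_wrtM => //; exact: measurable_wrt_cst.
Qed.

(** Expressing [ip] by norms of differences makes it measurable for the
    sigma-algebra generated by balls. *)
Lemma polarization x h : ip x h =
  4^-1 * normL 2 (x - (- h) : L2 R d) ^+ 2 - 4^-1 * normL 2 (x - h : L2 R d) ^+ 2.
Proof.
rewrite !normL2_sqr !ipBl !ipNl ![ip _ (_ - _ : L2 R d)]ip_sym !ipBl !ipNl.
by rewrite (ip_sym h x); field.
Qed.

Lemma measurable_wrt_ip xi G h : sigma_algebra setT G -> sigma_of xi `<=` G ->
  measurable_wrt G (fun w => ip (xi w) h).
Proof.
move=> sG xiG; have m x := measurable_wrt_normL x sG xiG.
under eq_fun do rewrite polarization -[X in _ - X]mul1r -mulNr.
by apply: measurable_wrtD => //; apply: measurable_wrt_scale => //;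
  [|apply: measurable_wrt_scale => //]; apply: measurable_wrtM.
Qed.

Section wiener.
Variables (Fil : R -> set (set Omega)) (Q : L2 R d -> L2 R d).
Variable W : R -> Omega -> L2 R d.
Hypotheses (hFil : filtration Fil) (hW : Q_wiener P Fil Q W).
Hypothesis Qge0 : forall h, 0 <= ip (Q h) h.

Lemma sub_sigma_field_Fil t : 0 <= t -> sub_sigma_field (Fil t).
Proof. by move=> t0; exact: hFil.1. Qed.

Lemma adapted_ip (X : R -> Omega -> L2 R d) t h : adapted Fil X -> 0 <= t ->
  measurable_wrt (Fil t) (fun w => ip (X t w) h).
Proof.
move=> aX t0; apply: measurable_wrt_ip; first exact: (sub_sigma_field_Fil t0).1.
exact: aX.
Qed.

Variables (s t : R) (h : L2 R d).
Hypotheses (s0 : 0 <= s) (st : s <= t).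
Let t0 : 0 <= t. Proof. exact: le_trans st. Qed.
Let D w := ip (W t w) h - ip (W s w) h.
Let v := (t - s) * ip (Q h) h.

Let DE : D = fun w => ip (W t w - W s w : L2 R d) h.
Proof. by apply/funext => w; rewrite ipBl. Qed.

Lemma wiener_increment_measurable : measurable_wrt (Fil t) D.
Proof.
have [_ _ aW _ _] := hW; rewrite /D.
under eq_fun do rewrite -mulN1r.
apply: measurable_wrtD; first exact: (sub_sigma_field_Fil t0).1.
  exact: adapted_ip.
apply: measurable_wrt_scale; first exact: (sub_sigma_field_Fil t0).1.
apply: (@measurable_wrtS _ _ _ (Fil s)); first exact: hFil.2.
exact: adapted_ip.
Qed.

Lemma wiener_increment_independent : independent_of P (Fil s) D.
Proof.
have [_ _ _ ind _] := hW; move=> A B FA mB; apply: (ind s t) => //.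
pose xi w : L2 R d := W t w - W s w.
have DxiE : (fun w => ip (xi w) h) = D := esym DE.
have : sigma_of xi ((fun w => ip (xi w) h) @^-1` B); last by rewrite DxiE.
by apply: (measurable_wrt_ip h (sigma_algebra_sigma_of xi) (@subset_refl _ _)).
Qed.

Let mD : measurable_fun setT D.
Proof.
exact: measurable_wrtW (sub_sigma_field_Fil t0) wiener_increment_measurable.
Qed.

Let v0 : 0 <= v. Proof. by rewrite mulr_ge0// subr_ge0. Qed.

Let lawD (B : set (measurableTypeR R)) : measurable B ->
  P [set w | B (D w)] = centered_gaussian v B.
Proof.
move=> mB; have [_ _ _ _ law] := hW.
by rewrite -(law s t s0 st h B mB) DE.
Qed.

Lemma wiener_increment_moments :
  [/\ P.-integrable setT (EFin \o D), \int[P]_w D w = 0,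
      P.-integrable setT (EFin \o (fun w => D w ^+ 2)),
      \int[P]_w (D w ^+ 2) = v &
      P.-integrable setT (EFin \o (fun w => D w ^+ 4)) /\
      \int[P]_w (D w ^+ 4) <= 48 * expR (2^-1 * v)].
Proof.
split.
- exact: gaussian_integrable1 mD v0 lawD.
- exact: gaussian_mean mD v0 lawD.
- exact: gaussian_integrable2 mD v0 lawD.
- exact: gaussian_variance mD v0 lawD.
- split; first exact: gaussian_integrable4 mD v0 lawD.
  exact: gaussian_fourth_moment mD v0 lawD.
Qed.

End wiener.

(** Paths are continuous on the half-line; composing with the maximum with 0
    extends them continuously to the whole line. *)
Lemma continuous_path_ip (x : R -> L2 R d) h : continuous_path x ->
  continuous (fun s : R => ip (x (Num.max s 0)) h).
Proof.
move=> cx t; set t' := Num.max t 0.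
have t'0 : 0 <= t' by rewrite le_max lexx orbT.
apply/cvgrPdist_le => eps eps0.
have n0 : 0 < normL 2 h + 1 by rewrite ltr_wpDl// normL_ge0.
have e'0 : 0 < eps / (normL 2 h + 1) by rewrite divr_gt0.
have := cx _ t'0; move=> /cvgrPdist_le/(_ _ e'0) H.
have cm : Num.max s 0 @[s --> t] --> within `[0, +oo[%classic (nbhs t').
  have c1 : Num.max s 0 @[s --> t] --> t'.
    exact: (@continuous_max _ _ id (cst 0) t cvg_id (cvg_cst _)).
  move=> A /c1; apply: (@filterS _ (nbhs t) _ (fun s => _) (fun s => A (Num.max s 0))) => s; apply.
  by rewrite /= in_itv/= andbT le_max lexx orbT.
have := cm _ H; apply: (@filterS _ (nbhs t) _ (fun s => _) (fun s => _)) => s /=; rewrite sub0r normrN.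
rewrite (ger0_norm (normL_ge0 _ _)) => hs; rewrite distrC -ipBl.
apply: (le_trans (normr_ip _ _)).
apply: (@le_trans _ _ (eps / (normL 2 h + 1) * normL 2 h)).
  by rewrite ler_wpM2r// normL_ge0.
by rewrite mulrAC ler_pdivrMr// ler_wpM2l ?lerDl// ltW.
Qed.

End L2_random_variables.

(** * Coordinates of the mild solution *)

(** Fractions are dense.  The mild formulation holds almost surely for each fixed
    time, so it transfers to all times at once only through a countable dense
    set. *)
Lemma eq_continuous_fractions (R : realType) (f g : R -> R) :
  continuous f -> continuous g ->
  (forall m k : nat, f (m%:R / k.+1%:R) = g (m%:R / k.+1%:R)) ->
  forall t, 0 <= t -> f t = g t.
Proof.
move=> cf cg fg t t0.
pose r (k : nat) : R := (Num.truncn (t * k.+1%:R))%:R / k.+1%:R.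
have rt : r k @[k --> \oo] --> t.
  apply/cvgrPdist_le => eps eps0.
  have /cvgrPdist_lt/(_ _ eps0) := @cvg_harmonic R.
  apply: filterS => k; rewrite sub0r normrN /= ger0_norm ?invr_ge0// => hk.
  have k0 : 0 < k.+1%:R :> R by [].
  have tk : 0 <= t * k.+1%:R by rewrite mulr_ge0.
  have /andP[h1 h2] := truncn_itv tk.
  rewrite (_ : t - r k = (t * k.+1%:R - (Num.truncn (t * k.+1%:R))%:R) / k.+1%:R).
    rewrite ger0_norm; last by rewrite divr_ge0// subr_ge0.
    apply: le_trans (ltW hk); rewrite ler_pdivrMr// mulVf//.
    by rewrite lerBlDr addrC natr1 ltW.
  by rewrite mulrBl mulfK.
have cr (h : R -> R) : continuous h -> h (r k) @[k --> \oo] --> h t.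
  by move=> ch; apply: (cvg_comp _ _ rt (ch t)).
have fr := cr f cf; have gr := cr g cg.
have frg : (fun k => f (r k)) = (fun k => g (r k)) by apply/funext => k; exact: fg.
by rewrite frg in fr; exact: (cvg_unique _ fr gr).
Qed.

Section galerkin_coordinates.
Variables (R : realType) (d : nat) (lam : nat -> R) (e : nat -> L2 R d).
Local Notation mu := (cube_measure R d).
Hypothesis lam_gt0 : forall i, 0 < lam i.
Hypothesis be : forall i, ess_bounded mu (e i).
Hypothesis onb : is_onb e.
Variable N : nat.
Variables c0 c1 c2 c3 : R.
Local Notation eN := (fun i : 'I_N => (e i : 'rV[R]_d -> R)).
Local Notation force := (galerkin_force mu eN c0 c1 c2 c3).
Local Notation coord x := (fun i : 'I_N => ip x (e i)).

Lemma ip_fcalcN g x (i : 'I_N) :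
  ip (fcalcN lam e N g x) (e i) = g (lam i) * ip x (e i).
Proof.
rewrite ip_suml (bigD1 i)//= ipZl onb.1 eqxx mulr1 big1 ?addr0// => j ji.
by rewrite ipZl onb.1 (_ : (_ == _ :> nat) = false) ?mulr0//; exact/negbTE.
Qed.

Lemma ip_projN x (i : 'I_N) : ip (projN lam e N x) (e i) = ip x (e i).
Proof. by rewrite ip_fcalcN mul1r. Qed.

Lemma ip_intN t G (i : 'I_N) : ip (intN e N t G) (e i) =
  \int[lebesgue_measure]_(s in `[0, t]) ip (G s) (e i).
Proof.
rewrite ip_suml (bigD1 i)//= ipZl onb.1 eqxx mulr1 big1 ?addr0// => j ji.
by rewrite ipZl onb.1 (_ : (_ == _ :> nat) = false) ?mulr0//; exact/negbTE.
Qed.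

Lemma in_UN_synthesis (u : L2 R d) : in_UN e N u ->
  u = synthesis eN (coord u) %[ae mu] /\ (forall i, (N <= i)%N -> ip u (e i) = 0).
Proof.
move=> [c uc]; have us : u = synthesis eN c %[ae mu].
  by apply: filterS uc => z h _; rewrite h// L2_sumE.
have [h1 h2] := ip_synthesis onb us; split => //.
by rewrite (_ : coord u = c)//; apply/funext => i; exact: h1.
Qed.

Lemma force_coord (u : L2 R d) (i : 'I_N) : in_UN e N u ->
  ip (cubic c0 c1 c2 c3 \o u) (e i) = force i (coord u).
Proof.
move=> /in_UN_synthesis[us _].
rewrite -(galerkin_forceE (fun i : 'I_N => be i)).
have mf (g : 'rV[R]_d -> R) : measurable_fun setT g ->
    measurable_fun setT (fun z => cubic c0 c1 c2 c3 (g z)).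
  move=> mg; rewrite /cubic.
  by apply: measurable_funD => //; apply: measurable_funD;
    [apply: measurable_funD|]; apply: measurable_funM => //;
    exact: measurable_funX.
apply: ip_ae.
- by apply: mf; exact: measurable_L2.
- by apply: mf; case: (ess_bounded_synthesis (fun i : 'I_N => be i) (coord u)).
- by apply: filterS us => z h _ /=; rewrite h.
Qed.

Section mild.
Variables (dO : measure_display) (Omega : measurableType dO).
Variables (P : probability Omega R) (Fil : R -> set (set Omega)).
Hypothesis hFil : filtration Fil.
Variables (Q : L2 R d -> L2 R d) (W : R -> Omega -> L2 R d).
Hypothesis hW : Q_wiener P Fil Q W.

Lemma grid_mesh (t delta : R) : 0 <= t -> 0 < delta -> \forall n \near \oo,
  forall k, (k < n.+1)%N ->
    grid t n k <= grid t n k.+1 /\ grid t n k.+1 - grid t n k < delta.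
Proof.
move=> t0 d0; have /cvgrPdist_lt/(_ _ d0) := grid_step_cvg t.
apply: filterS => n; rewrite sub0r normrN ger0_norm ?divr_ge0// => h k _.
by rewrite gridB grid_leS.
Qed.

(** Left-point sums along the uniform grids converge to [I] in mean square, so any
    limit they have along a path is the value of [I]. *)
Lemma wiener_integral_coord (t : R) (Phi : R -> L2 R d -> L2 R d)
    (I : Omega -> L2 R d) (phi : R -> R) (i : 'I_N) : 0 <= t ->
  wiener_integral P W Phi t I ->
  (forall s x, ip (Phi s x) (e i) = phi s * ip x (e i)) ->
  {ae P, forall w, forall l, \sum_(k < n.+1) phi (grid t n k) *
     (ip (W (grid t n k.+1) w) (e i) - ip (W (grid t n k) w) (e i))
       @[n --> \oo] --> l -> l = ip (I w) (e i)}.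
Proof.
move=> t0 [mI lim] Phiphi.
have mW s : 0 <= s -> measurable_fun setT (fun w => ip (W s w) (e i)).
  move=> s0; have [_ _ aW _ _] := hW.
  exact: (measurable_wrtW (sub_sigma_field_Fil hFil s0) (adapted_ip hFil (e i) aW s0)).
apply: L2_limit_unique.
- move=> n; apply: measurable_sum => k; apply: measurable_funM => //.
  by apply: measurable_funB; apply: mW; exact: grid_ge0.
- have sm : sigma_algebra setT (@measurable _ Omega).
    exact: sigma_algebra_measurable.
  by move=> _ B mB; rewrite setTI; exact: (measurable_wrt_ip (e i) sm mI).
move=> eps eps0; have [delta del0 hdel] := lim eps eps0.
apply: filterS (grid_mesh t0 del0) => n hn.
have := hdel n.+1 (grid t n) (grid0 t n) (gridT t n) hn.
apply: le_trans; rewrite expectation.unlock.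
apply: (@ge0_le_integralW _ _ _ P) => w.
  by rewrite lee_fin sqr_ge0.
rewrite lee_fin normL2_sqr.
rewrite (_ : _ - _ = ip (\sum_(k < n.+1) Phi (grid t n k)
    (W (grid t n k.+1) w - W (grid t n k) w) - I w : L2 R d) (e i)); last first.
  rewrite ipBl ip_suml; congr (_ - _); apply: eq_bigr => k _.
  by rewrite Phiphi ipBl.
by apply: (le_trans (cauchy_schwarz _ _)); rewrite onb.1 eqxx mulr1.
Qed.

Variables (u0 v0 : L2 R d) (u v : R -> Omega -> L2 R d).
Hypothesis hX :
  galerkin_mild_solution P Fil lam e N (cubic c0 c1 c2 c3) W u0 v0 u v.

Let om (i : 'I_N) := Num.sqrt (lam i).
Let om_gt0 i : 0 < om i. Proof. by rewrite sqrtr_gt0. Qed.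

Let b w (i : 'I_N) (s : R) := ip (W (Num.max s 0) w) (e i).
Let x w (i : 'I_N) (s : R) := ip (u (Num.max s 0) w) (e i).
Let G w (i : 'I_N) (s : R) := force i (x w ^~ s).

Definition good_path w := [/\ W 0 w = cst 0 %[ae mu], continuous_path (W ^~ w),
  continuous_path (u ^~ w) & continuous_path (v ^~ w)].

Lemma ae_good_path : {ae P, forall w, good_path w}.
Proof.
have [W0 cW _ _ _] := hW; have [_ _ cuv _] := hX.
by apply: filterS3 W0 cW cuv => w h1 h2 [h3 h4]; split.
Qed.

Let cb w i : good_path w -> continuous (b w i).
Proof. by move=> [_ cW _ _]; exact: (@continuous_path_ip _ _ (W ^~ w)). Qed.

Let cx w i : good_path w -> continuous (x w i).
Proof. by move=> [_ _ cu _]; exact: (@continuous_path_ip _ _ (u ^~ w)). Qed.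

Let cG w i : good_path w -> continuous (G w i).
Proof.
move=> gw s; apply: (cvg_galerkin_force (fun i : 'I_N => be i)) => j.
exact: cx.
Qed.

Let b0 w i : good_path w -> b w i 0 = 0.
Proof.
move=> [W0 _ _ _]; rewrite /b maxxx.
rewrite (ip_ae (g := (0 : L2 R d)) _ (measurable_L2 _)) ?ip0l//.
Qed.

Let x0 (i : 'I_N) := ip u0 (e i).
Let y0 (i : 'I_N) := ip v0 (e i).

(** The i-th coordinate of the mild formula is the solution formula of the
    oscillator of frequency om_i = sqrt lam_i: the deterministic convolution is
    computed by [duhamel_pos] and [duhamel_vel], the stochastic one by
    [wiener_sum_pos] and [wiener_sum_vel]. *)
Lemma mild_coord (t : R) : 0 <= t -> {ae P, forall w, good_path w ->
  forall i : 'I_N,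
    ip (u t w) (e i) = osc_pos (om i) (x0 i) (y0 i) (b w i) (G w i) t /\
    ip (v t w) (e i) =
      osc_vel (om i) (x0 i) (y0 i) (b w i) (G w i) t + b w i t}.
Proof.
move=> t0; have [hUN _ _ /(_ t t0)[I [J [hI hJ eqIJ]]]] := hX.
have phiI (i : 'I_N) s y : ip (groupN lam e N (t - s) (0, projN lam e N y)).1 (e i) =
    sin (om i * (t - s)) / om i * ip y (e i).
  by rewrite ipDl !ip_fcalcN ip0l mulr0 add0r mul1r.
have phiJ (i : 'I_N) s y : ip (groupN lam e N (t - s) (0, projN lam e N y)).2 (e i) =
    cos (om i * (t - s)) * ip y (e i).
  by rewrite ipDl !ip_fcalcN ip0l mulr0 add0r mul1r.
have aeI : {ae P, forall w, forall (i : 'I_N) l, \sum_(k < n.+1) sin (om i * (t - grid t n k)) / om i *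
     (ip (W (grid t n k.+1) w) (e i) - ip (W (grid t n k) w) (e i))
       @[n --> \oo] --> l -> l = ip (I w) (e i)}.
  apply: filter_forall => i.
  exact: (wiener_integral_coord t0 hI (phi := fun s => sin (om i * (t - s)) / om i)).
have aeJ : {ae P, forall w, forall (i : 'I_N) l, \sum_(k < n.+1) cos (om i * (t - grid t n k)) *
     (ip (W (grid t n k.+1) w) (e i) - ip (W (grid t n k) w) (e i))
       @[n --> \oo] --> l -> l = ip (J w) (e i)}.
  apply: filter_forall => i.
  exact: (wiener_integral_coord t0 hJ (phi := fun s => cos (om i * (t - s)))).
apply: filterS3 eqIJ aeI aeJ => w [uE vE] wI wJ gw i.
have omi := om_gt0 i.
have maxid s : 0 <= s -> Num.max s 0 = s by move=> s0; rewrite max_l.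
have sumE (phi : R -> R) :
    (fun n => \sum_(k < n.+1) phi (grid t n k) *
      (ip (W (grid t n k.+1) w) (e i) - ip (W (grid t n k) w) (e i))) =
    (fun n => \sum_(k < n.+1) phi (grid t n k) *
      (b w i (grid t n k.+1) - b w i (grid t n k))).
  apply/funext => n; apply: eq_bigr => k _.
  by rewrite /b !maxid// grid_ge0.
have Iw := wiener_sum_pos omi (@cb w i gw) t0 (@b0 w i gw).
have Jw := wiener_sum_vel omi (@cb w i gw) t0 (@b0 w i gw).
have {}Iw : cos (om i * t) * primitive0 (fun s => cos (om i * s) * b w i s) t +
    sin (om i * t) * primitive0 (fun s => sin (om i * s) * b w i s) t = ip (I w) (e i).
  by apply: wI; rewrite (sumE (fun s => sin (om i * (t - s)) / om i)).
have {}Jw : b w i t + om i *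
    (cos (om i * t) * primitive0 (fun s => sin (om i * s) * b w i s) t -
     sin (om i * t) * primitive0 (fun s => cos (om i * s) * b w i s) t) = ip (J w) (e i).
  by apply: wJ; rewrite (sumE (fun s => cos (om i * (t - s)))).
have projf s : 0 <= s ->
    ip (- projN lam e N (cubic c0 c1 c2 c3 \o u s w) : L2 R d) (e i) = - G w i s.
  move=> s0; rewrite ipNl ip_fcalcN mul1r force_coord; last exact: (hUN s w s0).1.
  by rewrite /G /x maxid.
have D1 : ip (intN e N t (fun s => (groupN lam e N (t - s)
      (0, - projN lam e N (cubic c0 c1 c2 c3 \o u s w))).1)) (e i) =
    (cos (om i * t) * primitive0 (fun s => sin (om i * s) * G w i s) t -
     sin (om i * t) * primitive0 (fun s => cos (om i * s) * G w i s) t) / om i.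
  rewrite -duhamel_pos//; last exact: cG.
  rewrite ip_intN; apply: eq_Rintegral => s; rewrite inE/= in_itv/= => /andP[s0 _].
  by rewrite ipDl !ip_fcalcN ip0l mulr0 add0r projf.
have D2 : ip (intN e N t (fun s => (groupN lam e N (t - s)
      (0, - projN lam e N (cubic c0 c1 c2 c3 \o u s w))).2)) (e i) =
    - (cos (om i * t) * primitive0 (fun s => cos (om i * s) * G w i s) t +
     sin (om i * t) * primitive0 (fun s => sin (om i * s) * G w i s) t).
  rewrite -duhamel_vel//; last exact: cG.
  rewrite ip_intN; apply: eq_Rintegral => s; rewrite inE/= in_itv/= => /andP[s0 _].
  by rewrite ipDl !ip_fcalcN ip0l mulr0 add0r projf.
have F1 : ip (groupN lam e N t (projN lam e N u0, projN lam e N v0)).1 (e i) =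
    cos (om i * t) * x0 i + sin (om i * t) / om i * y0 i.
  by rewrite ipDl; congr (_ + _); rewrite ip_fcalcN ip_projN.
have F2 : ip (groupN lam e N t (projN lam e N u0, projN lam e N v0)).2 (e i) =
    - om i * sin (om i * t) * x0 i + cos (om i * t) * y0 i.
  by rewrite ipDl; congr (_ + _); rewrite ip_fcalcN ip_projN.
split.
  rewrite (ip_ae _ (measurable_L2 _) (measurable_L2 _) uE) ipDl.
  by rewrite ipDl F1 D1 -Iw /osc_pos; ring.
rewrite (ip_ae _ (measurable_L2 _) (measurable_L2 _) vE) ipDl.
by rewrite ipDl F2 D2 -Jw /osc_vel; field; rewrite gt_eqF.
Qed.

(** Beyond [mild_coord], the exceptional event no longer depends on the time. *)
Lemma mild_driven_path : {ae P, forall w, exists X Z : 'I_N -> R -> R,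
  driven_path (fun i : 'I_N => lam i) force X Z (b w) /\
  forall i s, 0 <= s ->
   [/\ X i s = ip (u s w) (e i), Z i s = ip (v s w) (e i) - ip (W s w) (e i),
       X i 0 = ip u0 (e i), Z i 0 = ip v0 (e i) & b w i s = ip (W s w) (e i)]}.
Proof.
have q0 (m k : nat) : 0 <= (m%:R / k.+1%:R : R) by rewrite divr_ge0.
have rat : {ae P, forall w, forall m k : nat, good_path w -> forall i : 'I_N,
    ip (u (m%:R / k.+1%:R) w) (e i) =
      osc_pos (om i) (x0 i) (y0 i) (b w i) (G w i) (m%:R / k.+1%:R) /\
    ip (v (m%:R / k.+1%:R) w) (e i) =
      osc_vel (om i) (x0 i) (y0 i) (b w i) (G w i) (m%:R / k.+1%:R) +
      b w i (m%:R / k.+1%:R)}.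
  by apply/ae_foralln => m; apply/ae_foralln => k; exact: mild_coord.
apply: filterS2 ae_good_path rat => w gw hw.
have maxid s : 0 <= s -> Num.max s 0 = s by move=> s0; rewrite max_l.
pose X i := osc_pos (om i) (x0 i) (y0 i) (b w i) (G w i).
pose Z i := osc_vel (om i) (x0 i) (y0 i) (b w i) (G w i).
have cX i : continuous (X i).
  by apply: continuous_osc_pos; [exact: cb|exact: cG].
have cZ i : continuous (Z i).
  by apply: continuous_osc_vel; [exact: cb|exact: cG].
have XE i s : 0 <= s -> X i s = x w i s.
  apply: eq_continuous_fractions => //; first exact: cx.
  by move=> m k; rewrite /x maxid// (hw m k gw i).1.
have cv i : continuous (fun s : R => ip (v (Num.max s 0) w) (e i)).
  by case: gw => _ _ _ cv; exact: (@continuous_path_ip _ _ (v ^~ w)).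
have ZE i s : 0 <= s -> Z i s + b w i s = ip (v (Num.max s 0) w) (e i).
  apply: (@eq_continuous_fractions _ (fun s => Z i s + b w i s)
    (fun s => ip (v (Num.max s 0) w) (e i))) => //.
    by move=> r; apply: cvgD; [exact: cZ|exact: cb].
  by move=> m k; rewrite maxid// (hw m k gw i).2.
exists X, Z; split; last first.
  move=> i s s0; rewrite XE// /x maxid//; split => //.
  - have := ZE i s s0; rewrite maxid// => <-.
    by rewrite /b maxid// addrK.
  - by rewrite /X osc_pos0.
  - by rewrite /Z osc_vel0.
  - by rewrite /b maxid.
split.
- by move=> i; split => //; exact: cb.
- by move=> i; exact: b0.
move=> i t t0; have [dX dZ] := is_derive_osc (x0 i) (y0 i) (om_gt0 i) (@cb w i gw) (@cG w i gw) t0.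
split => //; apply: (is_derive_eq dZ).
rewrite sqr_sqrtr ?ltW// mulNr; congr (_ - _).
rewrite /G; congr force; apply/funext => j.
by rewrite XE// ltW.
Qed.

End mild.
End galerkin_coordinates.

(** * Energy and trace on the Galerkin space *)

Section power_means.
Variables (R : realType) (T : finType).
Implicit Types (a : T -> R).

Lemma sqr_sum_le a : (\sum_i a i) ^+ 2 <= #|T|%:R * \sum_i a i ^+ 2.
Proof.
have [T0|T0] := posnP #|T|.
  rewrite (_ : \sum_i a i = 0) ?expr0n/= ?T0 ?mul0r// big1// => i _.
  by have := card0_eq T0 i; rewrite inE.
set n : R := #|T|%:R; have n0 : 0 < n by rewrite ltr0n.
set m := \sum_i a i.
have h i : (m / n) * (2 * a i - m / n) <= a i ^+ 2.
  by rewrite -subr_ge0 (_ : _ - _ = (a i - m / n) ^+ 2) ?sqr_ge0//; ring.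
have := ler_sum (index_enum T) (fun i (_ : true) => h i).
rewrite -mulr_sumr sumrB sumr_const -mulr_sumr -/m => H.
rewrite -ler_pdivrMl//; apply: le_trans H.
rewrite -[(m / n) *+ _]mulr_natr -/n divfK ?gt_eqF//.
by rewrite le_eqVlt; apply/orP; left; apply/eqP; field; rewrite gt_eqF.
Qed.

Lemma pow4_sum_le a : (forall i, 0 <= a i) ->
  (\sum_i a i) ^+ 4 <= #|T|%:R ^+ 3 * \sum_i a i ^+ 4.
Proof.
move=> a0.
have h1 := sqr_sum_le a.
have h2 := sqr_sum_le (fun i => a i ^+ 2).
have e4 : \sum_i (a i ^+ 2) ^+ 2 = \sum_i a i ^+ 4.
  by apply: eq_bigr => i _; rewrite -exprM.
rewrite e4 in h2.
rewrite (exprM _ 2 2) (@le_trans _ _ ((#|T|%:R * \sum_i a i ^+ 2) ^+ 2))//.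
  rewrite lerXn2r// nnegrE ?sqr_ge0// mulr_ge0// sumr_ge0// => i _.
  exact: sqr_ge0.
rewrite exprMn (exprSr _ 2) -mulrA ler_wpM2l// sqr_ge0//.
Qed.

End power_means.

Lemma nneseries_finite_support (R : realType) (f : nat -> \bar R) (N : nat) :
  (forall i, (N <= i)%N -> f i = 0%E) ->
  (\sum_(i <oo) f i = \sum_(i < N) f i)%E.
Proof.
move=> f0; apply: lim_near_cst => //.
exists N => // n /= Nn; rewrite (big_cat_nat _ Nn)//= big_mkord.
rewrite [X in (_ + X)%E]big_nat [X in (_ + X)%E]big1 ?adde0// => i /andP[Ni _].
exact: f0.
Qed.

Section galerkin_energy.
Variables (R : realType) (d : nat) (lam : nat -> R) (e : nat -> L2 R d).
Local Notation mu := (cube_measure R d).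
Hypothesis lam_gt0 : forall i, 0 < lam i.
Hypothesis be : forall i, ess_bounded mu (e i).
Hypothesis onb : is_onb e.
Variable N : nat.
Variables c0 c1 c2 c3 : R.
Variable F : ('rV[R]_d -> R) -> R.
Hypothesis hF : potential (cubic c0 c1 c2 c3) F.
Local Notation eN := (fun i : 'I_N => (e i : 'rV[R]_d -> R)).
Local Notation force := (galerkin_force mu eN c0 c1 c2 c3).
Local Notation coord x := (fun i : 'I_N => ip x (e i)).

Definition galerkin_hamiltonian : ('I_N -> R) -> ('I_N -> R) -> R :=
  hamiltonian (fun i : 'I_N => lam i)
    (fun c => F (0 : L4 R d) + galerkin_potential mu eN c0 c1 c2 c3 c).

Lemma in_UN_projN x : in_UN e N (projN lam e N x).
Proof.
exists (fun i : 'I_N => 1 * ip x (e i)); exact: ae_eq_refl.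
Qed.

Lemma in_UN_normL2 (x : L2 R d) : in_UN e N x ->
  normL 2 x ^+ 2 = \sum_(i < N) ip x (e i) ^+ 2.
Proof.
move=> /(in_UN_synthesis onb)[xs _]; rewrite normL2_sqr.
rewrite {1}(_ : ip x x = ip (\sum_(i < N) ip x (e i) *: e i : L2 R d) x).
  by rewrite ip_suml; apply: eq_bigr => i _; rewrite ipZl ip_sym expr2.
apply: ip_ae; [exact: measurable_L2|exact: measurable_L2|].
by apply: filterS xs => z h _; rewrite h// L2_sumE.
Qed.

Lemma in_UN_dotH1 (x : L2 R d) : in_UN e N x ->
  fine (dotH_norm2 lam e 1 x) = \sum_(i < N) lam i * ip x (e i) ^+ 2.
Proof.
move=> /(in_UN_synthesis onb)[_ x0]; rewrite /dotH_norm2.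
rewrite (nneseries_finite_support (N := N)); last first.
  by move=> i Ni; rewrite x0// expr0n/= mulr0.
by rewrite sumEFin; apply: eq_bigr => i _; rewrite powRr1// ltW.
Qed.

Lemma energyE C1 (x y : L2 R d) : in_UN e N x -> in_UN e N y ->
  energy lam e F C1 x y = galerkin_hamiltonian (coord x) (coord y) + C1.
Proof.
move=> xU yU; rewrite /energy in_UN_dotH1// in_UN_normL2//.
have [xs _] := in_UN_synthesis onb xU.
rewrite (potential_synthesis hF be xs) /galerkin_hamiltonian /hamiltonian.
by rewrite big_split/= -!mulr_sumr addrA.
Qed.

Section trace_formula.
Variables (Q Qh : L2 R d -> L2 R d).
Hypothesis hQh : is_sqrt_op Q Qh.

(** <Q h, h> = <Q^(1/2) Q^(1/2) h, h> = ||Q^(1/2) h||^2. *)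
Lemma Q_ge0 h : 0 <= ip (Q h) h.
Proof.
have [_ sym _ sq] := hQh.
rewrite -(ip_ae h (measurable_L2 _) (measurable_L2 _) (sq h)) sym.
by rewrite -normL2_sqr sqr_ge0.
Qed.

Lemma ip_projN_sym (x y : L2 R d) :
  ip (projN lam e N x) y = ip x (projN lam e N y).
Proof.
rewrite ip_suml [RHS]ip_sym ip_suml; apply: eq_bigr => i _.
by rewrite !ipZl !mul1r mulrC (ip_sym (e i) y) (ip_sym (e i) x).
Qed.

(** [adjoint] is a choice among the adjoints of P_N Q^(1/2), so one has to be
    exhibited: Q^(1/2) P_N.  The diagonal terms with i >= N vanish, and for i < N
    <P_N Q^(1/2) S e_i, e_i> = <S e_i, Q^(1/2) e_i>
      = <Q^(1/2) e_i, Q^(1/2) e_i> = <Q e_i, e_i>. *)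
Lemma trace_projN_sqrt :
  trace e ((fun x => projN lam e N (Qh x)) \o
           adjoint (fun x => projN lam e N (Qh x))) =
  (\sum_(i < N) ip (Q (e i)) (e i))%:E.
Proof.
have [_ sym _ sq] := hQh.
set T := fun x => projN lam e N (Qh x); set S := adjoint T.
have adj : forall x y : L2 R d, ip (T x) y = ip x (S y).
  rewrite /S /adjoint; case: xgetP => [S' _ //|noadj].
  case: (noadj (fun y => Qh (projN lam e N y))) => x y.
  by rewrite /T ip_projN_sym sym.
rewrite /trace (nneseries_finite_support (N := N)); last first.
  move=> i Ni /=; congr EFin; rewrite /T ip_suml big1// => j _.
  by rewrite ipZl onb.1 ltn_eqF ?mulr0// (leq_trans (ltn_ord j)).
rewrite sumEFin; congr EFin; apply: eq_bigr => i _ /=.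
rewrite /T ip_projN// sym ip_sym -adj /T ip_projN//.
exact: (ip_ae _ (measurable_L2 _) (measurable_L2 _) (sq (e i))).
Qed.

End trace_formula.
End galerkin_energy.

(** * The mean energy *)

Section energy_evolution.
Variables (R : realType) (d : nat) (lam : nat -> R) (e : nat -> L2 R d).
Local Notation mu := (cube_measure R d).
Hypothesis lam_gt0 : forall i, 0 < lam i.
Hypothesis be : forall i, ess_bounded mu (e i).
Hypothesis onb : is_onb e.
Variable N : nat.
Hypothesis N_gt0 : (0 < N)%N.
Variables c0 c1 c2 c3 : R.
Variable F : ('rV[R]_d -> R) -> R.
Hypothesis hF : potential (cubic c0 c1 c2 c3) F.
Variables a1 b1 : R.
Hypothesis a1_gt0 : 0 < a1.
Hypothesis F_lb : forall u : L4 R d, a1 * normL 4 u ^+ 4 - b1 <= F u.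
Local Notation eN := (fun i : 'I_N => (e i : 'rV[R]_d -> R)).
Local Notation force := (galerkin_force mu eN c0 c1 c2 c3).
Local Notation coord x := (fun i : 'I_N => ip x (e i)).
Local Notation ham := (galerkin_hamiltonian lam e c0 c1 c2 c3 F (N := N)).

Variables (dO : measure_display) (Omega : measurableType dO).
Variables (P : probability Omega R) (Fil : R -> set (set Omega)).
Hypothesis hFil : filtration Fil.
Variables (Q : L2 R d -> L2 R d) (W : R -> Omega -> L2 R d).
Hypothesis hW : Q_wiener P Fil Q W.
Hypothesis Qge0 : forall h, 0 <= ip (Q h) h.
Variables (u0 v0 : L2 R d) (u v : R -> Omega -> L2 R d).
Hypothesis hX :
  galerkin_mild_solution P Fil lam e N (cubic c0 c1 c2 c3) W u0 v0 u v.

Local Notation I f := (P.-integrable setT (EFin \o f)).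
Let Phi c := F (0 : L4 R d) + galerkin_potential mu eN c0 c1 c2 c3 c.
Let X (i : 'I_N) s w := ip (u s w) (e i).
Let B (i : 'I_N) s w := ip (W s w) (e i).
Let Z (i : 'I_N) s w := ip (v s w) (e i) - B i s w.
Let q (i : 'I_N) := ip (Q (e i)) (e i).

Let dPhi (x : 'I_N -> R -> R) (dx : 'I_N -> R) (s : R) :
  (forall i, is_derive s 1 (x i) (dx i)) ->
  is_derive s 1 (fun t => Phi (x ^~ t)) (\sum_i dx i * force i (x ^~ s)).
Proof.
move=> hx; have h := is_derive1D (is_derive_cst (F (0 : L4 R d)) s (1 : R))
  (is_derive_galerkin_potential (fun i : 'I_N => be i) c0 c1 c2 c3 hx).
by apply: (is_derive_eq h); rewrite add0r.
Qed.

Let cPhi (x : 'I_N -> R -> R) : (forall i, continuous (x i)) ->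
  continuous (fun t => Phi (x ^~ t)).
Proof.
move=> cx t; apply: cvgD; first exact: cvg_cst.
by apply: (cvg_galerkin_potential (fun i : 'I_N => be i)) => i; exact: cx.
Qed.

Let cforce (x : 'I_N -> R -> R) i : (forall i, continuous (x i)) ->
  continuous (fun t => force i (x ^~ t)).
Proof.
move=> cx t; apply: (cvg_galerkin_force (fun i : 'I_N => be i)) => j.
exact: cx.
Qed.

Let Phi_lb c (i : 'I_N) : a1 * c i ^+ 4 - b1 <= Phi c.
Proof. exact: potential_lower_bound. Qed.

Let lam_ge0 (i : 'I_N) : 0 <= lam i. Proof. exact: ltW. Qed.

Let ham_lb c y i : a1 * c i ^+ 4 + 2^-1 * y i ^+ 2 <= ham c y + b1.
Proof. exact: hamiltonian_lower. Qed.

Let r0 := ham (coord u0) (coord v0) + b1 + 1.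

Let r0_ge0 : 0 <= r0.
Proof.
have := ham_lb (coord u0) (coord v0) (Ordinal N_gt0).
have h1 := sqr_ge0 (ip v0 (e (Ordinal N_gt0))).
have h2 : 0 <= a1 * ip u0 (e (Ordinal N_gt0)) ^+ 4.
  by rewrite mulr_ge0 ?exprn_even_ge0// ltW.
by rewrite /r0; lra.
Qed.

Let mB i s : 0 <= s -> measurable_wrt (Fil s) (B i s).
Proof. by move=> s0; have [_ _ aW _ _] := hW; exact: adapted_ip. Qed.

Let mX i s : 0 <= s -> measurable_wrt (Fil s) (X i s).
Proof. by move=> s0; have [_ [au _] _ _] := hX; exact: adapted_ip. Qed.

Let mV i s : 0 <= s -> measurable_wrt (Fil s) (fun w => ip (v s w) (e (i : 'I_N))).
Proof. by move=> s0; have [_ [_ av] _ _] := hX; exact: adapted_ip. Qed.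

Let mZ i s : 0 <= s -> measurable_wrt (Fil s) (Z i s).
Proof.
move=> s0; have sF := (sub_sigma_field_Fil hFil s0).1.
rewrite /Z; under eq_fun do rewrite -mulN1r.
apply: measurable_wrtD => //; first exact: mV.
by apply: measurable_wrt_scale => //; exact: mB.
Qed.

Let mB' i s : 0 <= s -> measurable_fun setT (B i s).
Proof. by move=> s0; exact: (measurable_wrtW (sub_sigma_field_Fil hFil s0) (@mB i s s0)). Qed.
Let mX' i s : 0 <= s -> measurable_fun setT (X i s).
Proof. by move=> s0; exact: (measurable_wrtW (sub_sigma_field_Fil hFil s0) (@mX i s s0)). Qed.
Let mZ' i s : 0 <= s -> measurable_fun setT (Z i s).
Proof. by move=> s0; exact: (measurable_wrtW (sub_sigma_field_Fil hFil s0) (@mZ i s s0)). Qed.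

Variable t : R.
Hypothesis t_ge0 : 0 <= t.

Let B0 i : {ae P, forall w, B i 0 w = 0}.
Proof.
have [W0 _ _ _ _] := hW; apply: filterS W0 => w h.
by rewrite /B (ip_ae (g := (0 : L2 R d)) _ (measurable_L2 _)) ?ip0l//.
Qed.

Let K4 := \sum_(i < N) 48 * expR (2^-1 * (t * q i)).

Lemma noise_fourth_moment i s : 0 <= s <= t ->
  (\int[P]_w (B i s w ^+ 4)%:E <= K4%:E)%E.
Proof.
move=> /andP[s0 st].
have [_ _ _ _ [i4 E4]] := wiener_increment_moments hFil hW Qge0 (e i) (lexx 0) s0.
rewrite (_ : (\int[P]_w (B i s w ^+ 4)%:E =
  \int[P]_w ((ip (W s w) (e i) - ip (W 0 w) (e i)) ^+ 4)%:E)%E); last first.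
  apply: ae_eq_integral => //.
  - by apply/measurable_EFinP; apply: measurable_funX; exact: mB'.
  - apply/measurable_EFinP; apply: measurable_funX.
    by apply: measurable_funB; exact: mB'.
  - by apply: filterS (B0 i) => w; rewrite /B => -> _; rewrite subr0.
rewrite -(@fineK _ (\int[P]_w _)%E); last exact: integrable_fin_num.
rewrite lee_fin (le_trans E4)// /K4 (bigD1 i)//= subr0.
apply: (@le_trans _ _ (48 * expR (2^-1 * (t * q i)))).
  by rewrite ler_wpM2l// ler_expR ler_wpM2l ?invr_ge0// ler_wpM2r// Qge0.
by rewrite lerDl sumr_ge0// => j _; rewrite mulr_ge0// expR_ge0.
Qed.

Lemma noise_second_moment i : I (fun w => B i t w ^+ 2) /\
  \int[P]_w (B i t w ^+ 2) = t * q i.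
Proof.
have [_ _ i2 E2 _] := wiener_increment_moments hFil hW Qge0 (e i) (lexx 0) t_ge0.
have BE : {ae P, forall w, B i t w ^+ 2 = (ip (W t w) (e i) - ip (W 0 w) (e i)) ^+ 2}.
  by apply: filterS (B0 i) => w; rewrite /B => ->; rewrite subr0.
have m1 : measurable_fun setT (fun w => B i t w ^+ 2).
  by apply: measurable_funX; exact: mB'.
have m2 : measurable_fun setT (fun w => (ip (W t w) (e i) - ip (W 0 w) (e i)) ^+ 2).
  by apply: measurable_funX; apply: measurable_funB; exact: mB'.
split; last by rewrite (ae_eq_Rintegral m1 m2 BE) E2 subr0.
exact: (ae_eq_integrable m1 m2 BE).
Qed.

(** [hamiltonian_bound] controls z_i(s)^2 by a fourth power of the integral of
    sum_j |b_j|.  That integral is a limit of Riemann sums S_n, so Fatou reduces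
    the claim to a bound on E (r0 + g S_n)^4 uniform in n; by power means it
    follows from the fourth moments of the b_j at single times. *)
Lemma velocity_second_moment : exists2 C : R, 0 <= C & forall i s, 0 <= s <= t ->
  I (fun w => Z i s w ^+ 2) /\ \int[P]_w (Z i s w ^+ 2) <= C.
Proof.
have [A A0 fb] := galerkin_force_bound (fun i : 'I_N => be i) c0 c1 c2 c3.
pose g := growth_constant (fun i : 'I_N => lam i) A a1.
have g0 : 0 <= g by exact: growth_constant_ge0.
have K40 : 0 <= K4 by apply: sumr_ge0 => i _; rewrite mulr_ge0// expR_ge0.
(* From 2 (r0 + g S)^4 <= 16 r0^4 + 16 g^4 S^4; the mean of S^4 is at most
   (t N)^4 K4. *)
pose C := 16 * r0 ^+ 4 + 16 * g ^+ 4 * (t * N%:R) ^+ 4 * K4.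
have C0 : 0 <= C.
  by rewrite /C addr_ge0// !mulr_ge0// exprn_ge0// mulr_ge0.
exists C => // i s /andP[s0 st].
have mZ2 : measurable_fun setT (fun w => Z i s w ^+ 2).
  by apply: measurable_funX; exact: mZ'.
pose S n w := \sum_(k < n.+1) (\sum_j `|B j (grid s n k) w|) * (grid s n k.+1 - grid s n k).
pose f n w := 2 * (r0 + g * S n w) ^+ 4.
have mS n : measurable_fun setT (S n).
  apply: measurable_sum => k; apply: measurable_funM => //.
  apply: measurable_sum => j; apply: measurableT_comp => //.
  by apply: mB'; exact: grid_ge0.
have S0 n w : 0 <= S n w.
  apply: sumr_ge0 => k _; rewrite mulr_ge0 ?subr_ge0 ?grid_leS//.
  by rewrite sumr_ge0.
have bound : (\int[P]_w (Z i s w ^+ 2)%:E <= C%:E)%E.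
  apply: (@fatou_bound _ _ _ P f) => //.
  - move=> n; apply: measurable_funM => //; apply: measurable_funX.
    by apply: measurable_funD => //; exact: measurable_funM.
  - by move=> n w; rewrite mulr_ge0// exprn_ge0// addr_ge0// mulr_ge0.
  - by move=> w; exact: sqr_ge0.
  - have := mild_driven_path lam_gt0 be onb hFil hW hX.
    apply: filterS => w [x [z [path coords]]].
    set b := fun (i : 'I_N) (s : R) => ip (W (Num.max s 0) w) (e i) in path coords.
    pose beta (r : R) := \sum_j `|b j r|.
    have cbeta : continuous beta.
      move=> r; apply: cvg_sum_ord => j; apply: cvg_norm.
      by case: path => /(_ j)[_ _ cb] _ _; exact: cb.
    exists (2 * (r0 + g * primitive0 beta s) ^+ 4); last first.
      have hb := hamiltonian_bound lam_ge0 dPhi cPhi A0 a1_gt0 fb Phi_lb N_gt0 path s0.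
      have [_ zE x0E z0E _] := coords i s s0.
      pose Hs := hamiltonian (fun i : 'I_N => lam i) Phi (x ^~ s) (z ^~ s).
      have h2 : a1 * x i s ^+ 4 + 2^-1 * z i s ^+ 2 <= Hs + b1.
        exact: (hamiltonian_lower lam_ge0 Phi_lb (x ^~ s) (z ^~ s) i).
      have x4 : 0 <= a1 * x i s ^+ 4 by rewrite mulr_ge0 ?exprn_even_ge0// ltW.
      have r0E : hamiltonian (fun i : 'I_N => lam i) Phi (x^~ 0) (z^~ 0) + b1 + 1 = r0.
        rewrite /r0 /ham; congr (hamiltonian _ _ _ _ + _ + _); apply/funext => j.
          by have [_ _ -> _ _] := coords j 0 (lexx 0).
        by have [_ _ _ -> _] := coords j 0 (lexx 0).
      have h1 : Hs + b1 + 1 <= (r0 + g * primitive0 beta s) ^+ 4 by rewrite -r0E.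
      rewrite /Z /B -zE; move: h1 h2 x4.
      move: (_ ^+ 4) (a1 * _) (z i s ^+ 2) => Y4 X4 z2; lra.
    apply: cvgM; first exact: cvg_cst.
    have SE : (fun n => S n w) = (fun n => \sum_(k < n.+1) beta (grid s n (k + false)) *
        (id (grid s n k.+1) - id (grid s n k))).
      apply/funext => n; apply: eq_bigr => k _; congr (_ * _).
      rewrite addn0 /beta; apply: eq_bigr => j _.
      have [_ _ _ _ h] := coords j (grid s n k) (grid_ge0 _ _ s0).
      by rewrite /B -h.
    have cS : S n w @[n --> \oo] --> primitive0 beta s.
      rewrite SE -[X in _ --> X]subr0 -[X in _ --> _ - X](primitive0_0 beta).
      apply: (@riemann_stieltjes_cvg _ s 1 beta id (fun=> 1) (primitive0 beta)) => //.
      - by move=> r; exact: cvg_id.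
      - exact: continuous_primitive0.
      - move=> r; rewrite in_itv/= => /andP[rp _].
        by have h := is_derive_primitive0 cbeta rp; apply: (is_derive_eq h); rewrite mul1r.
      - by move=> r _; rewrite normr1.
    apply: cvg_pow; apply: cvgD; first exact: cvg_cst.
    by apply: cvgM; [exact: cvg_cst|exact: cS].
  move=> n.
  pose cc := 16 * g ^+ 4 * ((s / n.+1%:R) ^+ 4 * (n.+1%:R * N%:R) ^+ 3).
  have cc0 : 0 <= cc.
    by rewrite !mulr_ge0// exprn_ge0// ?mulr_ge0// divr_ge0.
  pose B4 (p : 'I_n.+1 * 'I_N) w := B p.2 (grid s n p.1) w ^+ 4.
  have B40 p w : 0 <= B4 p w by rewrite exprn_even_ge0.
  have mB4 p : measurable_fun setT (B4 p).
    by apply: measurable_funX; apply: mB'; exact: grid_ge0.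
  have fle w : f n w <= 16 * r0 ^+ 4 + cc * \sum_p B4 p w.
    have SE : S n w = s / n.+1%:R * \sum_(p : 'I_n.+1 * 'I_N) `|B p.2 (grid s n p.1) w|.
      rewrite -(pair_bigA _ (fun (k : 'I_n.+1) (j : 'I_N) => `|B j (grid s n k) w|))/=.
      by rewrite mulr_sumr; apply: eq_bigr => k _; rewrite gridB mulrC.
    have pm := pow4_sum_le (fun p : 'I_n.+1 * 'I_N => normr_ge0 (B p.2 (grid s n p.1) w)).
    rewrite card_prod !card_ord natrM in pm.
    have e4 : \sum_(p : 'I_n.+1 * 'I_N) `|B p.2 (grid s n p.1) w| ^+ 4 = \sum_p B4 p w.
      by apply: eq_bigr => p _; rewrite -normrX ger0_norm// exprn_even_ge0.
    rewrite e4 in pm.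
    have S4 : S n w ^+ 4 <= (s / n.+1%:R) ^+ 4 * ((n.+1%:R * N%:R) ^+ 3 * \sum_p B4 p w).
      by rewrite SE exprMn ler_wpM2l// exprn_ge0// divr_ge0.
    have ab (a c : R) : 0 <= a -> 0 <= c -> (a + c) ^+ 4 <= 8 * a ^+ 4 + 8 * c ^+ 4.
      move=> a0 c0'; have h2 : (a + c) ^+ 2 <= 2 * (a ^+ 2 + c ^+ 2).
        by have := sqr_ge0 (a - c); rewrite sqrrB sqrrD; lra.
      rewrite (exprM _ 2 2) (@le_trans _ _ ((2 * (a ^+ 2 + c ^+ 2)) ^+ 2))//.
        by rewrite lerXn2r// nnegrE ?sqr_ge0// mulr_ge0// addr_ge0// sqr_ge0.
      have := sqr_ge0 (a ^+ 2 - c ^+ 2).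
      rewrite -subr_ge0 => h; rewrite -subr_ge0.
      rewrite (_ : _ - _ = 4 * (a ^+ 2 - c ^+ 2) ^+ 2); last by ring.
      by rewrite mulr_ge0// sqr_ge0.
    have := ab r0 (g * S n w) r0_ge0 (mulr_ge0 g0 (S0 n w)).
    rewrite exprMn => h; rewrite /f.
    have g4 : 0 <= g ^+ 4 by rewrite exprn_ge0.
    have := ler_wpM2l g4 S4.
    set Tn := (X in _ <= X) => hT.
    rewrite (_ : cc * _ = 16 * Tn); last first.
      rewrite /cc /Tn; move: ((s / _) ^+ 4) ((_ * N%:R) ^+ 3) (\sum_p B4 p w).
      by move=> x1 x2 x3; ring.
    move: h hT; move: (_ ^+ 4) (g ^+ 4 * _) (r0 ^+ 4) Tn => U V r4 Tn; lra.
  apply: (@le_trans _ _ (\int[P]_w ((16 * r0 ^+ 4)%:E + cc%:E * \sum_p (B4 p w)%:E))%E).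
    apply: ge0_le_integralW => w.
      by rewrite lee_fin mulr_ge0// exprn_ge0// addr_ge0// mulr_ge0.
    by rewrite sumEFin -EFinM -EFinD lee_fin.
  have ms : measurable_fun setT (fun w => (\sum_p (B4 p w)%:E)%E).
    by apply: emeasurable_sum => p; exact/measurable_EFinP.
  have s0' w : (0 <= \sum_p (B4 p w)%:E)%E.
    by apply: sume_ge0 => p _; rewrite lee_fin.
  rewrite ge0_integralD//; last 3 first.
  - by move=> w _; rewrite lee_fin mulr_ge0// exprn_ge0.
  - by move=> w _; rewrite mule_ge0// lee_fin.
  - by apply: emeasurable_funM => //; exact: measurable_cst.
  rewrite integral_cst//= probability_setT mule1 ge0_integralZl//.
  rewrite ge0_integral_sum//; last first.
  - by move=> p w _; rewrite lee_fin.
  - by move=> p; exact/measurable_EFinP.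
  apply: (@le_trans _ _ ((16 * r0 ^+ 4)%:E + cc%:E * \sum_(p : 'I_n.+1 * 'I_N) K4%:E)%E).
    rewrite leeD2l// lee_wpmul2l ?lee_fin//; apply: lee_sum => p _.
    by apply: noise_fourth_moment; rewrite grid_ge0//= (le_trans (grid_leT _ _))// ltnW.
  rewrite sumEFin -EFinM -EFinD lee_fin /C lerD2l.
  rewrite sumr_const card_prod !card_ord -[K4 *+ _]mulr_natr natrM /cc.
  rewrite (_ : _ * (K4 * _) = 16 * g ^+ 4 * (s * N%:R) ^+ 4 * K4).
    rewrite ler_wpM2r// ler_wpM2l ?mulr_ge0 ?exprn_ge0//.
    rewrite lerXn2r ?nnegrE ?mulr_ge0//.
    by rewrite ler_wpM2r.
  have : n.+1%:R != 0 :> R by rewrite pnatr_eq0.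
  by move: (n.+1%:R : R) => m m0; field.
have iZ2 : I (fun w => Z i s w ^+ 2).
  apply/integrableP; split; first exact/measurable_EFinP.
  under eq_integral do rewrite /= ger0_norm ?sqr_ge0//.
  by apply: (le_lt_trans bound); exact: ltry.
split => //; rewrite -lee_fin /Rintegral fineK//.
by apply: integrable_fin_num => //; exact: iZ2.
Qed.

Let M n w := \sum_i \sum_(k < n.+1) Z i (grid t n k) w *
  (B i (grid t n k.+1) w - B i (grid t n k) w).

Lemma left_sums_moments : exists C : R, forall n,
  [/\ measurable_fun setT (M n), I (fun w => M n w ^+ 2),
      \int[P]_w M n w = 0 & \int[P]_w (M n w ^+ 2) <= C].
Proof.
have [C C0 hC] := velocity_second_moment.
exists (N%:R * \sum_(i < N) C * (t * q i)) => n.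
have g0 k : 0 <= grid t n k by exact: grid_ge0.
have gS k : grid t n k <= grid t n k.+1 by exact: grid_leS.
pose Mi (i : 'I_N) w := \sum_(k < n.+1) Z i (grid t n k) w *
  (B i (grid t n k.+1) w - B i (grid t n k) w).
have mart (i : 'I_N) : [/\ measurable_fun setT (Mi i), I (fun w => Mi i w ^+ 2),
    \int[P]_w Mi i w = 0 & \int[P]_w (Mi i w ^+ 2) <= C * (t * q i)].
  have mom k := wiener_increment_moments hFil hW Qge0 (e i) (g0 k) (gS k).
  have iz k : (k < n.+1)%N -> I (fun w => Z i (grid t n k) w ^+ 2).
    by move=> kn; apply: (hC i _ _).1; rewrite g0/= grid_leT// ltnW.
  have Ez k : (k < n.+1)%N -> \int[P]_w (Z i (grid t n k) w ^+ 2) <= C.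
    by move=> kn; apply: (hC i _ _).2; rewrite g0/= grid_leT// ltnW.
  have iD k : I (fun w => (B i (grid t n k.+1) w - B i (grid t n k) w) ^+ 2).
    by case: (mom k).
  have ED k : \int[P]_w (B i (grid t n k.+1) w - B i (grid t n k) w) = 0.
    by case: (mom k).
  have ED2 k : \int[P]_w ((B i (grid t n k.+1) w - B i (grid t n k) w) ^+ 2) =
      (grid t n k.+1 - grid t n k) * q i by case: (mom k).
  have [m1 m2 m3 m4] := martingale_transform
    (G := fun k => Fil (grid t n k)) (z := fun k => Z i (grid t n k))
    (D := fun k w => B i (grid t n k.+1) w - B i (grid t n k) w)
    (q := fun k => (grid t n k.+1 - grid t n k) * q i)
    (fun k => sub_sigma_field_Fil hFil (g0 k))
    (fun k => hFil.2 _ _ (g0 k) (gS k))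
    (fun k => mZ i (g0 k))
    (fun k => wiener_increment_measurable hFil hW (e i) (g0 k) (gS k))
    (fun k => wiener_increment_independent hW (e i) (g0 k) (gS k))
    iz Ez
    iD ED ED2 (leqnn n.+1).
  split => //.
    exact: (measurable_wrtW (sub_sigma_field_Fil hFil (g0 n.+1)) m1).
  apply: (le_trans m4); rewrite ler_wpM2l// -mulr_suml.
  rewrite -(big_mkord xpredT (fun k => grid t n k.+1 - grid t n k)).
  by rewrite telescope_sumr// gridT grid0 subr0.
have mM : measurable_fun setT (M n).
  by apply: measurable_sum => i; case: (mart i).
have sq_le w : M n w ^+ 2 <= N%:R * \sum_i Mi i w ^+ 2.
  by have := sqr_sum_le (fun i => Mi i w); rewrite card_ord.
have isum : I (fun w => N%:R * \sum_(i < N) Mi i w ^+ 2).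
  apply: integrable_scale.
  rewrite (_ : EFin \o _ = fun w => (\sum_(i < N) (EFin \o (fun w => (Mi i w ^+ 2)%R)) w)%E).
    by apply: integrable_sum => // i _; case: (mart i).
  by apply/funext => w /=; rewrite sumEFin.
have iM2 : I (fun w => M n w ^+ 2).
  apply: (integrable_dominated _ _ isum); first exact: measurable_funX.
  by move=> w; rewrite ger0_norm ?sqr_ge0.
split => //.
- rewrite Rintegral_sum; last first.
    by move=> i; case: (mart i) => *; exact: integrable_L2_L1.
  by rewrite big1// => i _; case: (mart i).
- apply: (@le_trans _ _ (\int[P]_w (N%:R * \sum_(i < N) Mi i w ^+ 2))).
    exact: le_Rintegral.
  rewrite RintegralZl//.
    rewrite Rintegral_sum; last by move=> i; case: (mart i).
    by rewrite ler_wpM2l// ler_sum// => i _; case: (mart i).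
  rewrite (_ : EFin \o _ = fun w => (\sum_(i < N) (EFin \o (fun w => (Mi i w ^+ 2)%R)) w)%E).
    by apply: integrable_sum => // i _; case: (mart i).
  by apply/funext => w /=; rewrite sumEFin.
Qed.

Let L w := \sum_i Z i t w * B i t w +
  (ham (fun i => X i t w) (fun i => Z i t w) - ham (coord u0) (coord v0)).

(** [L] is the Ito integral of z against b, written without a limit by the energy
    balance. *)
Lemma stochastic_integral_mean : I L /\ \int[P]_w L w = 0.
Proof.
have [C hC] := left_sums_moments.
apply: (@zero_mean_limit _ _ _ P M L C).
- by move=> n; case: (hC n).
- have mham : measurable_fun setT (fun w => ham (fun i => X i t w) (fun i => Z i t w)).
    apply: measurable_funD.
      apply: measurable_sum => i; apply: measurable_funD;
        apply: measurable_funM => //; last first.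
        by apply: measurable_funX; exact: mZ'.
      by apply: measurable_funM => //; apply: measurable_funX; exact: mX'.
    apply: measurable_funD => //.
    by apply: (measurable_galerkin_potential (fun i : 'I_N => be i)) => i; exact: mX'.
  apply: measurable_funD; last exact: measurable_funB.
  by apply: measurable_sum => i; apply: measurable_funM; [exact: mZ'|exact: mB'].
- have := mild_driven_path lam_gt0 be onb hFil hW hX.
  apply: filterS => w [x [z [path coords]]].
  set b := fun (i : 'I_N) (s : R) => ip (W (Num.max s 0) w) (e i) in path coords.
  have := energy_balance dPhi cPhi cforce path t_ge0.
  have xE i s : 0 <= s -> x i s = X i s w by move=> s0; have [] := coords i s s0.
  have zE i s : 0 <= s -> z i s = Z i s w by move=> s0; have [] := coords i s s0.
  have bE i s : 0 <= s -> b i s = B i s w.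
    by move=> s0; have [_ _ _ _ h] := coords i s s0; rewrite /b h.
  rewrite (_ : (fun n => _) = M ^~ w); last first.
    apply/funext => n; apply: eq_bigr => i _; apply: eq_bigr => k _.
    by rewrite zE ?bE ?bE ?grid_ge0.
  congr (_ --> _); rewrite /L; congr (_ + (_ - _)).
  + by apply: eq_bigr => i _; rewrite zE// bE.
  + by rewrite /ham; congr (hamiltonian _ _ _ _); apply/funext => i; [exact: xE|exact: zE].
  + by rewrite /ham; congr (hamiltonian _ _ _ _); apply/funext => i;
      have [_ _ x0 z0 _] := coords i 0 (lexx 0).
- by move=> n; case: (hC n).
- by move=> n; case: (hC n).
- by move=> n; case: (hC n).
Qed.

Lemma energy_evolution C1 :
  ('E_P[fun w => energy lam e F C1 (u t w) (v t w)] =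
   (energy lam e F C1 (projN lam e N u0) (projN lam e N v0) +
    2^-1 * (t * \sum_(i < N) q i))%:E)%E.
Proof.
have [hUN _ _ _] := hX; have [iL EL] := stochastic_integral_mean.
pose E0 := energy lam e F C1 (projN lam e N u0) (projN lam e N v0).
have E0E : E0 = ham (coord u0) (coord v0) + C1.
  rewrite /E0 (energyE (N := N) lam_gt0 be onb hF); [|exact: in_UN_projN|exact: in_UN_projN].
  by congr (hamiltonian _ _ _ _ + _); apply/funext => i; exact: ip_projN.
have VE w : energy lam e F C1 (u t w) (v t w) =
    E0 + (L w + 2^-1 * \sum_i B i t w ^+ 2).
  have [uU vU] := hUN t w t_ge0.
  rewrite (energyE lam_gt0 be onb hF _ uU vU) E0E /L /galerkin_hamiltonian /hamiltonian.
  have -> : \sum_(i < N) (2^-1 * (lam i * ip (u t w) (e i) ^+ 2) +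
      2^-1 * ip (v t w) (e i) ^+ 2) =
    \sum_(i < N) (2^-1 * (lam i * X i t w ^+ 2) + 2^-1 * Z i t w ^+ 2) +
    \sum_(i < N) Z i t w * B i t w + 2^-1 * \sum_(i < N) B i t w ^+ 2.
    rewrite mulr_sumr -!big_split/=; apply: eq_bigr => i _.
    by rewrite /Z /X /B; field.
  by rewrite /X; ring.
have iB2 : I (fun w => 2^-1 * \sum_i B i t w ^+ 2).
  apply: integrable_scale.
  rewrite (_ : EFin \o _ = fun w => (\sum_(i < N) (EFin \o (fun w => (B i t w ^+ 2)%R)) w)%E).
    by apply: integrable_sum => // i _; exact: (noise_second_moment i).1.
  by apply/funext => w /=; rewrite sumEFin.
have iS : I (fun w => L w + 2^-1 * \sum_i B i t w ^+ 2) by exact: integrable_add.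
have iV : I (fun w => cst E0 w + (L w + 2^-1 * \sum_i B i t w ^+ 2)).
  by apply: integrable_add => //; exact: integrable_const.
rewrite expectation.unlock; under eq_integral do rewrite VE.
rewrite -(@fineK _ (\int[P]_w _)%E); last exact: integrable_fin_num iV.
congr EFin; rewrite -/(Rintegral P setT (fun w => cst E0 w + (L w + 2^-1 * \sum_i B i t w ^+ 2))).
rewrite RintegralD//; last exact: integrable_const.
rewrite Rintegral_const RintegralD// EL add0r; congr (_ + _).
rewrite RintegralZl//; last first.
  rewrite (_ : EFin \o _ = fun w => (\sum_(i < N) (EFin \o (fun w => (B i t w ^+ 2)%R)) w)%E).
    by apply: integrable_sum => // i _; exact: (noise_second_moment i).1.
  by apply/funext => w /=; rewrite sumEFin.
rewrite Rintegral_sum; last by move=> i; exact: (noise_second_moment i).1.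
by congr (_ * _); rewrite mulr_sumr; apply: eq_bigr => i _; exact: (noise_second_moment i).2.
Qed.

End energy_evolution.

Theorem proposition3p1 (R : realType) (d : nat) (hd : d = 1%N \/ d = 2%N)
    (lam : nat -> R) (e : nat -> L2 R d)
    (hlam : dirichlet_eigenbasis lam e)
    (dO : measure_display) (Omega : measurableType dO)
    (P : probability Omega R)
    (Fil : R -> set (set Omega)) (hFil : filtration Fil)
    (Q Qhalf : L2 R d -> L2 R d)
    (hQ_op : bounded_linear Q) (hQ_sym : symmetric_op Q)
    (hQ_pos : positive_definite Q) (hQ_tr : (trace e Q < +oo)%E)
    (hQhalf : is_sqrt_op Q Qhalf)
    (W : R -> Omega -> L2 R d) (hW : Q_wiener P Fil Q W)
    (c0 c1 c2 c3 : R) (hc3 : 0 < c3)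
    (F : ('rV[R]_d -> R) -> R) (hF : potential (cubic c0 c1 c2 c3) F)
    (a1 a2 b1 b2 : R) (ha1 : 0 < a1) (ha2 : 0 < a2)
    (hb1 : 0 < b1) (hb2 : 0 < b2)
    (hF_bound : forall u : L4 R d,
       a1 * normL 4 u ^+ 4 - b1 <= F u <= a2 * normL 4 u ^+ 4 + b2)
    (C1 : R) (hC1 : b1 <= C1)
    (u0 v0 : L2 R d) (hX0 : in_H1 lam e u0 v0)
    (hQhalf_HS : hilbert_schmidt e Qhalf)
    (N : nat) (hN : (0 < N)%N)
    (u v : R -> Omega -> L2 R d)
    (hX : galerkin_mild_solution P Fil lam e N (cubic c0 c1 c2 c3) W u0 v0 u v)
    (t : R) (ht : 0 <= t) :
  ('E_P[fun w => energy lam e F C1 (u t w) (v t w)] =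
   (energy lam e F C1 (projN lam e N u0) (projN lam e N v0))%:E +
   (2^-1)%:E *
   trace e ((fun x => projN lam e N (Qhalf x)) \o
            adjoint (fun x => projN lam e N (Qhalf x))) * t%:E)%E.
Proof.
have [lam_gt0 _ eigen onb] := hlam.
have be i : ess_bounded (cube_measure R d) (e i).
  exact: dirichlet_eigenpair_ess_bounded (eigen i).
have F_lb (w : L4 R d) : a1 * normL 4 w ^+ 4 - b1 <= F w.
  by have /andP[] := hF_bound w.
rewrite (energy_evolution lam_gt0 be onb hN hF ha1 F_lb hFil hW (Q_ge0 hQhalf) hX ht).
rewrite (trace_projN_sqrt lam onb N hQhalf) -!EFinM -EFinD.
by congr EFin; rewrite -mulrA; congr (_ + _ * _); rewrite mulrC.
Qed.
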